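(* Let $(P,\pi)$ be a regular Poisson manifold whose symplectic foliation $\mathcal F$ is transversally oriented. For a tangential 1-form $\alpha\in\mathcal A^1_{\mathcal F}$ let $\pi(\alpha)$ be the vector field on $P$ determined by $\beta\mapsto \alpha(\pi(\beta))$ for $\beta\in\Omega^1(P)$. Then the assignment $\alpha\mapsto\pi(\alpha)$ induces a well-defined injective linear map $$\pi^*:H^1_{\mathcal F}(P)\hookrightarrow H^1_\pi(P),\qquad \pi^*[\alpha]=[\pi(\alpha)],$$ from the first leafwise cohomology space into the first Poisson cohomology space, and $$\pi^*(mod(\mathcal F))=mod(P),$$ where $mod(\mathcal F)$ is the Reeb class of $\mathcal F$ and $mod(P)$ is the modular class of $(P,\pi)$.
   Context: A Poisson manifold $(P,\pi)$ is a smooth manifold with a Poisson bivector $\pi$; the bundle map $\pi:T^*P\to TP$ is defined by $\beta(\pi(\alpha))=\pi(\alpha,\beta)$. It is regular if $\pi:T^*P\to TP$ has constant rank; its symplectic foliation $\mathcal F$ is then the regular foliation with tangent bundle $T\mathcal F=\pi(T^*P)$. On $\Omega^1(P)$ one has the Lie bracket $[\alpha,\beta]_\pi=L_{\pi(\alpha)}\beta-L_{\pi(\beta)}\alpha-d(\pi(\alpha,\beta))$. Poisson cohomology: $H^*_\pi(P)$ is the cohomology of the complex $(\mathcal X^*(P),d_\pi)$ of multivector fields, where, for $Q\in\mathcal X^p(P)$, $d_\pi Q(\alpha_0,\dots,\alpha_p)=\sum_j(-1)^j\pi(\alpha_j).Q(\alpha_0,\dots,\hat\alpha_j,\dots,\alpha_p)+\sum_{i<j}(-1)^{i+j}Q([\alpha_i,\alpha_j]_\pi,\alpha_0,\dots,\hat\alpha_i,\dots,\hat\alpha_j,\dots,\alpha_p)$.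 Leafwise cohomology: $\mathcal A^r_{\mathcal F}$ is the space of smooth sections of $\wedge^rT^*\mathcal F\to P$ (tangential $r$-forms), $d_{\mathcal F}$ is the leafwise exterior derivative, given by the usual Koszul formula applied to vector fields tangent to $\mathcal F$, and $H^*_{\mathcal F}(P)$ is the cohomology of $(\mathcal A^*_{\mathcal F},d_{\mathcal F})$. Reeb class: if $\mathcal F$ has codimension $q$, a transverse orientation is given by a nowhere vanishing $q$-form $\nu$ on $P$ with $i_X\nu=0$ for all $X$ tangent to $\mathcal F$. For $X$ tangent to $\mathcal F$, $L_X\nu=\alpha_{\mathcal F}(X)\nu$ defines a tangential 1-form $\alpha_{\mathcal F}$ with $d_{\mathcal F}\alpha_{\mathcal F}=0$; its class $mod(\mathcal F)\in H^1_{\mathcal F}(P)$ is the Reeb class of $\mathcal F$. Modular class: for a volume form $\mu$ on $P$, the map $f\mapsto \mathrm{div}_\mu\,\pi(df)$, where $L_X\mu=(\mathrm{div}_\mu X)\mu$, is a derivation of $C^\infty(P)$, i.e. a vector field $\phi_\mu$ (the modular vector field). It satisfies $d_\pi\phi_\mu=0$ and its class in $H^1_\pi(P)$ does not depend on $\mu$; this class is $mod(P)$. (The leaves of $\mathcal F$ being symplectic, hence oriented, a transverse orientation of $\mathcal F$ makes $P$ orientable.) *)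

(* Defs.v *)
From HB Require Import structures.
From mathcomp Require Import all_boot all_order all_algebra.
From mathcomp Require Import ring.
From mathcomp Require Import generic_quotient ring_quotient.
From mathcomp Require Import all_classical all_reals all_analysis.

Set Implicit Arguments.
Unset Strict Implicit.
Unset Printing Implicit Defensive.

Import Order.TTheory GRing.Theory Num.Theory.
Import numFieldNormedType.Exports.

Local Open Scope classical_set_scope.
Local Open Scope ring_scope.
Local Open Scope quotient_scope.

Section LmodQuotient.
Variables (R : nzRingType) (V : lmodType R) (I : submodClosed V).

Definition lquot_pred : {pred V} := I.
Lemma lquot_pred_zmod : zmod_closed lquot_pred.
Proof.
split; first exact: rpred0.
by move=> u v Iu Iv; rewrite -scaleN1r rpredD // rpredZ.
Qed.
HB.instance Definition _ := GRing.isZmodClosed.Build V lquot_pred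
  lquot_pred_zmod.

Definition lquot : Type := Quotient.quot lquot_pred.
HB.instance Definition _ := GRing.Zmodule.on lquot.

Definition lquot_class (x : V) : lquot := \pi_(Quotient.quot lquot_pred) x.

Definition lquot_repr (x : lquot) : V := repr (x : Quotient.quot lquot_pred).

Lemma lquot_classP x y : (lquot_class x = lquot_class y) <-> (x - y \in I).
Proof.
rewrite -[I : {pred V}]/lquot_pred Quotient.idealrBE.
by split=> [xy|/eqP //]; apply/eqP.
Qed.

Lemma lquot_reprK : cancel lquot_repr lquot_class.
Proof. exact: reprK. Qed.

Lemma lquot_classD x y : lquot_class (x + y) = lquot_class x + lquot_class y.
Proof. exact: Quotient.pi_add. Qed.

Definition lquot_scale (a : R) (x : lquot) : lquot :=
  lquot_class (a *: lquot_repr x).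

Lemma lquot_classZ a x : lquot_class (a *: x) = lquot_scale a (lquot_class x).
Proof.
apply/lquot_classP; rewrite -scalerBr rpredZ //.
by apply/lquot_classP; rewrite lquot_reprK.
Qed.

Lemma lquot_scaleA a b v :
  lquot_scale a (lquot_scale b v) = lquot_scale (a * b) v.
Proof. by rewrite -[v]lquot_reprK -!lquot_classZ scalerA. Qed.

Lemma lquot_scale1 : left_id 1 lquot_scale.
Proof. by move=> v; rewrite -[v]lquot_reprK -!lquot_classZ scale1r. Qed.

Lemma lquot_scaleDr : right_distributive lquot_scale +%R.
Proof.
move=> a u v; rewrite -[u]lquot_reprK -[v]lquot_reprK.
by rewrite -lquot_classD -!lquot_classZ -lquot_classD scalerDr.
Qed.

Lemma lquot_scaleDl v : {morph lquot_scale^~ v : a b / a + b}.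
Proof.
move=> a b; rewrite -[v]lquot_reprK.
by rewrite -!lquot_classZ -lquot_classD scalerDl.
Qed.

HB.instance Definition _ := GRing.Zmodule_isLmodule.Build R lquot
  lquot_scaleA lquot_scale1 lquot_scaleDr lquot_scaleDl.

End LmodQuotient.

(* [subquot Z B] is Z / (Z ∩ B); it is Z / B as soon as B is contained in Z. *)
Section Subquotient.
Variables (R : nzRingType) (V : lmodType R) (Z B : submodClosed V).

Definition submod : Type := {x : V | x \in Z}.
HB.instance Definition _ := SubChoice.on submod.
HB.instance Definition _ := [SubChoice_isSubLmodule of submod by <:].

Definition submodI : {pred submod} := [pred z | val z \in B].
Lemma submodI_closed : submod_closed submodI.
Proof.
split; first by rewrite inE GRing.val0 rpred0.
move=> a u v; rewrite !inE GRing.valD GRing.valZ => Bu Bv.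
by rewrite rpredD ?rpredZ.
Qed.
HB.instance Definition _ := GRing.isSubmodClosed.Build R submod submodI
  submodI_closed.

Definition subquot : Type := lquot (submodI : submodClosed submod).
HB.instance Definition _ := GRing.Lmodule.on subquot.
Definition subquot_class (z : submod) : subquot := lquot_class submodI z.

End Subquotient.

(* All partial derivatives of order <= k exist and are continuous at every
   point of V; only meant for open V. *)
Fixpoint Ck (R : realType) (n k : nat) (V : set 'rV[R]_n) (f : 'rV[R]_n -> R)
    : Prop :=
  (forall x, V x -> {for x, continuous f}) /\
  (if k is k'.+1 then
     forall j : 'I_n, (forall x, V x -> derivable f x (delta_mx 0 j)) /\
       Ck k' V (fun x => 'D_(delta_mx 0 j) f x)
   else True).

Definition Cinf (R : realType) (n : nat) (V : set 'rV[R]_n)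
    (f : 'rV[R]_n -> R) : Prop :=
  forall k, Ck k V f.

Section CkTheory.
Variables (R : realType) (n : nat).
Implicit Types (V W : set 'rV[R]_n) (f g : 'rV[R]_n -> R).

Lemma Ck_subset k V W f : W `<=` V -> Ck k V f -> Ck k W f.
Proof.
move=> WV; elim: k f => [|k IHk] f /= [cf Df].
  by split=> // x /WV; exact: cf.
split=> [x /WV|j]; first exact: cf.
by have [df Cf] := Df j; split=> [x /WV|]; [exact: df | exact: IHk].
Qed.

Lemma Ck_ext k V f g : open V -> (forall x, V x -> f x = g x) ->
  Ck k V f -> Ck k V g.
Proof.
move=> oV; elim: k f g => [|k IHk] f g fg /= [cf Df].
all: have nfg x : V x -> \forall y \near x, f y = g y.
1,3: by move=> Vx; apply: filterS (open_nbhs_nbhs (conj oV Vx)).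
all: have cg x : V x -> {for x, continuous g}.
1,3: move=> Vx; rewrite /prop_for /continuous_at -(fg x Vx).
1,2: exact: cvg_trans (near_eq_cvg (nfg x Vx)) (cf x Vx).
  by split.
split=> // j; have [df Cf] := Df j; split=> [x Vx|].
  exact: near_eq_derivable (nfg x Vx) (df x Vx).
by apply: IHk Cf => x Vx; apply: near_eq_derive; exact: nfg.
Qed.

Lemma Ck_cst0 k V : Ck k V (fun=> 0).
Proof.
have c0 (x : 'rV[R]_n) : {for x, continuous (fun=> 0 : R)}.
  exact: cst_continuous.
elim: k => [|k IHk] /=; split=> // j.
split=> [x _|]; first exact: (derivable_cst (0 : R)).
rewrite (_ : (fun x => 'D_(delta_mx 0 j) _ x) = fun=> 0) //.
by apply/funext => x; exact: (derive_cst (0 : R)).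
Qed.

Lemma Ck_lin k V (c : R) f g : open V -> Ck k V f -> Ck k V g ->
  Ck k V (fun x => c * f x + g x).
Proof.
move=> oV; elim: k f g => [|k IHk] f g /= [cf Df] [cg Dg].
all: have cfg x : V x -> {for x, continuous (fun x => c * f x + g x)}.
1,3: move=> Vx; apply: continuousD; last exact: cg.
1,2: by apply: continuousM; [exact: cst_continuous | exact: cf].
  by split.
split=> // j; have [df Cf] := Df j; have [dg Cg] := Dg j; split=> [x Vx|].
  exact: (derivableD (derivableZ (k := c) (df x Vx)) (dg x Vx)).
apply: Ck_ext (IHk _ _ Cf Cg) => // x Vx.
have := deriveD (derivableZ (k := c) (df x Vx)) (dg x Vx).
by rewrite deriveZ //; exact: df.
Qed.

End CkTheory.

(* A smooth structure is given by an atlas (not necessarily maximal).  The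
   atlas comes with a choice [chart_at p] of a chart around each point p; it is
   only used to represent tangent vectors by their components. *)
Record manifold (R : realType) (n : nat) := Manifold {
  carrier :> topologicalType;
  carrier_hausdorff : hausdorff_space carrier;
  carrier_second_countable : @second_countable carrier;
  chart : Type;
  cdom : chart -> set carrier;
  coord : chart -> carrier -> 'rV[R]_n;
  icoord : chart -> 'rV[R]_n -> carrier;
  chart_at : carrier -> chart;
  cdom_chart_at : forall p, cdom (chart_at p) p;
  cdom_open : forall i, open (cdom i);
  coord_open : forall i, open (coord i @` cdom i);
  coordK : forall i p, cdom i p -> icoord i (coord i p) = p;
  coord_continuous : forall i p, cdom i p -> {for p, continuous (coord i)};
  icoord_continuous : forall i x, (coord i @` cdom i) x ->
    {for x, continuous (icoord i)};
  transition_smooth : forall i j (k : 'I_n),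
    Cinf (coord i @` (cdom i `&` cdom j)) (fun x => coord j (icoord i x) 0 k)
}.

Section Calculus.
Variables (R : realType) (n : nat) (P : manifold R n).
Implicit Types (U V : set P) (f g : P -> R) (p : P).

Definition smooth_on U f : Prop :=
  forall i, Cinf (coord i @` (U `&` cdom i)) (f \o icoord i).

Lemma open_coord_image i U : open U -> open (coord i @` (U `&` cdom i)).
Proof.
move=> oU; rewrite openE => _ [p [Up ip] <-].
have ci : (coord i @` cdom i) (coord i p) by exists p.
have := icoord_continuous ci; rewrite /prop_for /continuous_at coordK // => co.
have nU : nbhs (coord i p) (icoord i @^-1` U).
  exact: co _ (open_nbhs_nbhs (conj oU Up)).
have nc := open_nbhs_nbhs (conj (@coord_open _ _ P i) ci).
rewrite /interior; apply: filterS (filterI nU nc) => x [/= Ux [r ir rx]].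
by exists r => //; split=> //; move: Ux; rewrite -rx coordK.
Qed.

Lemma smooth_on_subset U V f : V `<=` U -> smooth_on U f -> smooth_on V f.
Proof.
move=> VU sf i k; apply: Ck_subset (sf i k).
by apply: image_subset => p [/VU Up ip].
Qed.

Lemma smooth_on0 U : smooth_on U (fun=> 0).
Proof. move=> i k; exact: Ck_cst0. Qed.

Lemma smooth_on_lin U (c : R) f g : open U -> smooth_on U f -> smooth_on U g ->
  smooth_on U (fun p => c * f p + g p).
Proof.
by move=> oU sf sg i k; apply: Ck_lin (sf i k) (sg i k); exact: open_coord_image.
Qed.

(* Tangent vectors at p are row vectors: v stands for
   \sum_j v 0 j * d/dx_j, where the x_j are the coordinates of [chart_at p].
   Cotangent vectors at p are column vectors, in the dual basis dx_j.
   A section over an open set U is a total function, smooth on U, whose values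
   off U are irrelevant.  Identities between tensor fields, such as d_F a = 0
   or L_X nu = h nu, are tested on sections over arbitrary open sets. *)
Definition vfield := P -> 'rV[R]_n.
Definition covfield := P -> 'cV[R]_n.
HB.instance Definition _ := GRing.Lmodule.copy vfield (P -> 'rV[R]_n).

Definition pairing (v : 'rV[R]_n) (b : 'cV[R]_n) : R := (v *m b) 0 0.

Definition partial p (j : 'I_n) f : R :=
  'D_(delta_mx 0 j) (f \o icoord (chart_at p)) (coord (chart_at p) p).

Definition dfun f : covfield := fun p => \col_j partial p j f.

Definition vderiv (X : vfield) f : P -> R := fun p => pairing (X p) (dfun f p).

Definition xcoord (i : chart P) (k : 'I_n) : P -> R := fun p => coord i p 0 k.

Definition vsmooth_on U (X : vfield) : Prop :=
  forall i k, smooth_on (U `&` cdom i) (vderiv X (xcoord i k)).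

Definition covsmooth_on U (b : covfield) : Prop :=
  forall V (X : vfield), open V -> V `<=` U -> vsmooth_on V X ->
    smooth_on V (fun p => pairing (X p) (b p)).

Lemma pairing_lin (c : R) u v b :
  pairing (c *: u + v) b = c * pairing u b + pairing v b.
Proof. by rewrite /pairing mulmxDl -scalemxAl !mxE. Qed.

Lemma pairing0 b : pairing 0 b = 0.
Proof. by rewrite /pairing mul0mx mxE. Qed.

Lemma pairing_linr (c : R) v a b :
  pairing v (c *: a + b) = c * pairing v a + pairing v b.
Proof. by rewrite /pairing mulmxDr -scalemxAr !mxE. Qed.

Lemma dfun0 p : dfun (fun=> 0) p = 0.
Proof. by apply/colP => j; rewrite !mxE /partial; exact: derive_cst. Qed.

Lemma dfun_lin U p (c : R) f g : open U -> U p ->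
  smooth_on U f -> smooth_on U g ->
  dfun (fun q => c * f q + g q) p = c *: dfun f p + dfun g p.
Proof.
move=> oU Up sf sg; apply/colP => j; rewrite !mxE /partial.
have px : (coord (chart_at p) @` (U `&` cdom (chart_at p)))
    (coord (chart_at p) p) by exists p => //; split=> //; exact: cdom_chart_at.
have [_ /(_ j)[/(_ _ px) df _]] := sf (chart_at p) 1%N.
have [_ /(_ j)[/(_ _ px) dg _]] := sg (chart_at p) 1%N.
by have := deriveD (derivableZ (k := c) df) dg; rewrite deriveZ // => <-.
Qed.

Lemma vderiv_lin U p X (c : R) f g : open U -> U p ->
  smooth_on U f -> smooth_on U g ->
  vderiv X (fun q => c * f q + g q) p = c * vderiv X f p + vderiv X g p.
Proof.
by move=> oU Up sf sg; rewrite /vderiv (dfun_lin _ oU Up) // pairing_linr.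
Qed.

Lemma vderiv0 p X : vderiv X (fun=> 0) p = 0.
Proof. by rewrite /vderiv dfun0 /pairing mulmx0 mxE. Qed.

Lemma vsmooth_on_subset U V X : V `<=` U -> vsmooth_on U X -> vsmooth_on V X.
Proof.
move=> VU sX i k; apply: smooth_on_subset (sX i k).
by move=> p [/VU Up ip].
Qed.

Lemma vsmooth_on0 U : vsmooth_on U 0.
Proof.
move=> i k; under [vderiv _ _]eq_fun do rewrite /vderiv pairing0.
exact: smooth_on0.
Qed.

Lemma vsmooth_on_lin U (c : R) X Y : open U -> vsmooth_on U X ->
  vsmooth_on U Y -> vsmooth_on U (c *: X + Y).
Proof.
move=> oU sX sY i k.
have oUi : open (U `&` cdom i) by apply: openI => //; exact: (@cdom_open _ _ P).
have := smooth_on_lin c oUi (sX i k) (sY i k).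
rewrite (_ : vderiv (c *: X + Y) _ =
  fun p => c * vderiv X (xcoord i k) p + vderiv Y (xcoord i k) p) //.
by apply/funext => p; rewrite /vderiv -pairing_lin.
Qed.

(* [X, Y] f = X (Y f) - Y (X f), on the coordinate functions around p *)
Definition lie_bracket (X Y : vfield) : vfield := fun p =>
  \row_k (vderiv X (vderiv Y (xcoord (chart_at p) k)) p
        - vderiv Y (vderiv X (xcoord (chart_at p) k)) p).

(* The coordinate vector field d/dx_j of the chart i, on cdom i; its components
   at q are taken in [chart_at q], whence the Jacobian. *)
Definition frame (i : chart P) (j : 'I_n) : vfield := fun q =>
  \row_k 'D_(delta_mx 0 j)
     (xcoord (chart_at q) k \o icoord i) (coord i q).

(* (L_X b)(Y) = X (b Y) - b [X, Y], with Y ranging over the coordinate vector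
   fields around p *)
Definition covLie (X : vfield) (b : covfield) : covfield := fun p =>
  \col_j (vderiv X (fun q => pairing (frame (chart_at p) j q) (b q)) p
          - pairing (lie_bracket X (frame (chart_at p) j) p) (b p)).

Definition kform k := P -> ('I_k -> 'rV[R]_n) -> R.

Definition set_slot k (w : 'I_k -> 'rV[R]_n) (i : 'I_k) (v : 'rV[R]_n) :
  'I_k -> 'rV[R]_n := fun j => if j == i then v else w j.

Definition is_form k (om : kform k) : Prop :=
  [/\ forall p w i (a : R) u v,
        om p (set_slot w i (a *: u + v))
          = a * om p (set_slot w i u) + om p (set_slot w i v),
      forall p w i j, i != j -> w i = w j -> om p w = 0
    & forall U (Y : 'I_k -> vfield), open U ->
        (forall i, vsmooth_on U (Y i)) ->
        smooth_on U (fun p => om p (fun i => Y i p))].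

Definition nowhere_vanishing k (om : kform k) : Prop :=
  forall p, exists w, om p w != 0.

(* (L_X om)(Y_1, .., Y_k) *)
Definition lie_form k (X : vfield) (om : kform k) (Y : 'I_k -> vfield) : P -> R :=
  fun p => vderiv X (fun q => om q (fun i => Y i q)) p
    - \sum_i om p (set_slot (fun j => Y j p) i (lie_bracket X (Y i) p)).

(* L_X om = h om on U *)
Definition lie_scales k U (X : vfield) (om : kform k) (h : P -> R) : Prop :=
  forall V (Y : 'I_k -> vfield), open V -> V `<=` U ->
    (forall i, vsmooth_on V (Y i)) ->
    forall p, V p -> lie_form X om Y p = h p * om p (fun i => Y i p).

Definition volume_form (mu : kform n) : Prop :=
  is_form mu /\ nowhere_vanishing mu.

End Calculus.

(* [biv p] is the matrix of the bivector in the coordinates of [chart_at p]. *)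
Record poisson (R : realType) (n : nat) (P : manifold R n) := Poisson {
  biv :> P -> 'M[R]_n;
  biv_skew : forall p, (biv p)^T = - biv p;
  biv_smooth : forall (U : set P) (a b : covfield P), open U ->
    covsmooth_on U a -> covsmooth_on U b ->
    smooth_on U (fun p => pairing ((a p)^T *m biv p) (b p));
  biv_jacobi :
    let pb f g := fun p => pairing ((dfun f p)^T *m biv p) (dfun g p) in
    forall (U : set P) (f g h : P -> R), open U ->
    smooth_on U f -> smooth_on U g -> smooth_on U h ->
    forall p, U p -> pb f (pb g h) p + pb g (pb h f) p + pb h (pb f g) p = 0
}.

Section Cohomology.
Variables (R : realType) (n : nat) (P : manifold R n) (Pi : poisson P).
Implicit Types (U V : set P) (f g : P -> R) (p : P).

(* pi(a), characterized by b (pi a) = pi(a, b) *)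
Definition sharp_at p (a : 'cV[R]_n) : 'rV[R]_n := a^T *m Pi p.
Definition sharp (a : covfield P) : vfield P := fun p => sharp_at p (a p).

(* [(v <= Pi p)%MS] says that v lies in the row space of [Pi p], which is the
   image of [sharp_at p], i.e., the tangent space of the leaf through p. *)
Definition tangent_on U (X : vfield P) : Prop :=
  vsmooth_on U X /\ (forall p, U p -> (X p <= Pi p)%MS).

Definition cobracket (a b : covfield P) : covfield P := fun p =>
  covLie (sharp a) b p - covLie (sharp b) a p
    - dfun (fun q => pairing (sharp a q) (b q)) p.

(* A linear form on the tangent space of the leaf is extended by 0 to the other
   tangent vectors, so that equality is that of tangential forms. *)
Definition tcovfield := P -> 'rV[R]_n -> R^o.
HB.instance Definition _ := GRing.Lmodule.copy tcovfield
  (P -> 'rV[R]_n -> R^o).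

Definition tangential (a : tcovfield) : Prop :=
  [/\ forall p (c : R) u v, (u <= Pi p)%MS -> (v <= Pi p)%MS ->
        a p (c *: u + v) = c * a p u + a p v,
      forall p v, ~~ (v <= Pi p)%MS -> a p v = 0
    & forall U X, open U -> tangent_on U X -> smooth_on U (fun p => a p (X p))].

(* d_F a (X, Y) *)
Definition dF (a : tcovfield) (X Y : vfield P) : P -> R := fun p =>
  vderiv X (fun q => a q (Y q)) p - vderiv Y (fun q => a q (X q)) p
    - a p (lie_bracket X Y p).

Definition leafwise_cocycle : {pred tcovfield} :=
  [pred a | `[< tangential a /\
     forall U X Y, open U -> tangent_on U X -> tangent_on U Y ->
       forall p, U p -> dF a X Y p = 0 >]].

Definition leafwise_coboundary : {pred tcovfield} :=
  [pred a | `[< tangential a /\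
     exists2 f, smooth_on setT f &
       forall p v, (v <= Pi p)%MS -> a p v = pairing v (dfun f p) >]].

(* (d_pi X)(a, b) for a vector field X *)
Definition dpi (X : vfield P) (a b : covfield P) : P -> R := fun p =>
  vderiv (sharp a) (fun q => pairing (X q) (b q)) p
    - vderiv (sharp b) (fun q => pairing (X q) (a q)) p
    - pairing (X p) (cobracket a b p).

Definition poisson_cocycle : {pred vfield P} :=
  [pred X | `[< vsmooth_on setT X /\
     forall U a b, open U -> covsmooth_on U a -> covsmooth_on U b ->
       forall p, U p -> dpi X a b p = 0 >]].

(* (d_pi f)(a) = pi(a) f *)
Definition poisson_coboundary : {pred vfield P} :=
  [pred X | `[< vsmooth_on setT X /\
     exists2 f, smooth_on setT f &
       forall p a, pairing (X p) a = pairing (sharp_at p a) (dfun f p) >]].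

Lemma tangential0 : tangential 0.
Proof.
split=> // [p c u v _ _|U X _ _]; last exact: smooth_on0.
by rewrite /= mulr0 addr0.
Qed.

Lemma tangential_lin (c : R) (a b : tcovfield) :
  tangential a -> tangential b -> tangential (c *: a + b).
Proof.
move=> [la a0 sa] [lb b0 sb]; split=> [p d u v Pu Pv|p v Pv|U X oU tX].
- rewrite -[LHS]/(c * a p (d *: u + v) + b p (d *: u + v)) la // lb //.
  rewrite -[(c *: a + b) p u]/(c * a p u + b p u).
  rewrite -[(c *: a + b) p v]/(c * a p v + b p v).
  by rewrite !mulrDr mulrCA !addrA; congr (_ + _); rewrite addrAC.
- rewrite -[LHS]/(c * a p v + b p v) a0 // b0 //.
  by rewrite mulr0 addr0.
- exact: smooth_on_lin (sa U X oU tX) (sb U X oU tX).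
Qed.

Lemma leafwise_cocycle_closed : submod_closed leafwise_cocycle.
Proof.
split=> [|c a b].
  apply/asboolP; split=> [|U X Y oU tX tY p Up]; first exact: tangential0.
  by rewrite /dF !vderiv0 subr0 sub0r oppr0.
move=> /asboolP[ta za] /asboolP[tb zb]; apply/asboolP.
split=> [|U X Y oU tX tY p Up]; first exact: tangential_lin.
have [[_ _ sa] [_ _ sb]] := (ta, tb).
have := za U X Y oU tX tY p Up; have := zb U X Y oU tX tY p Up; rewrite /dF.
rewrite -[(c *: a + b) p _]/(c * a p (lie_bracket X Y p) + b p (lie_bracket X Y p)).
rewrite (vderiv_lin X c oU Up (sa U Y oU tY) (sb U Y oU tY)).
rewrite (vderiv_lin Y c oU Up (sa U X oU tX) (sb U X oU tX)).
set A := vderiv X _ p; set B := vderiv Y _ p; set C := b p _.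
set A' := vderiv X _ p; set B' := vderiv Y _ p; set C' := a p _ => b0 a0.
rewrite (_ : _ - _ = c * (A' - B' - C') + (A - B - C)).
  by rewrite a0 b0 mulr0 addr0.
by move: A B C A' B' C' {a0 b0} => A B C A' B' C'; ring.
Qed.

Lemma leafwise_coboundary_closed : submod_closed leafwise_coboundary.
Proof.
split=> [|c a b].
  apply/asboolP; split; first exact: tangential0.
  exists (fun=> 0) => [|p v _]; first exact: smooth_on0.
  by rewrite -[LHS]/(0 : R) dfun0 /pairing mulmx0 mxE.
move=> /asboolP[ta [f sf fa]] /asboolP[tb [g sg gb]]; apply/asboolP; split.
  exact: tangential_lin.
exists (fun p => c * f p + g p) => [|p v Pv].
  exact: smooth_on_lin openT sf sg.
rewrite -[LHS]/(c * a p v + b p v) fa // gb //.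
by rewrite (dfun_lin c openT I sf sg) pairing_linr.
Qed.

Lemma poisson_cocycle_closed : submod_closed poisson_cocycle.
Proof.
split=> [|c X Y].
  apply/asboolP; split=> [|U a b oU sa sb p Up]; first exact: vsmooth_on0.
  rewrite /dpi (_ : (fun q => pairing _ (b q)) = fun=> 0); last first.
    by apply/funext => q; exact: pairing0.
  rewrite (_ : (fun q => pairing _ (a q)) = fun=> 0); last first.
    by apply/funext => q; exact: pairing0.
  by rewrite !vderiv0 pairing0 !subr0.
move=> /asboolP[sX zX] /asboolP[sY zY]; apply/asboolP.
split=> [|U a b oU sa sb p Up]; first exact: vsmooth_on_lin openT sX sY.
have sXU : vsmooth_on U X by exact: vsmooth_on_subset sX.
have sYU : vsmooth_on U Y by exact: vsmooth_on_subset sY.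
have := zX U a b oU sa sb p Up; have := zY U a b oU sa sb p Up; rewrite /dpi.
have E (e : covfield P) : (fun q => pairing ((c *: X + Y) q) (e q)) =
    fun q => c * pairing (X q) (e q) + pairing (Y q) (e q).
  by apply/funext => q; rewrite -pairing_lin.
rewrite !E -[(c *: X + Y) p]/(c *: X p + Y p) pairing_lin.
rewrite (vderiv_lin _ c oU Up (sb U X oU _ sXU) (sb U Y oU _ sYU)) //.
rewrite (vderiv_lin _ c oU Up (sa U X oU _ sXU) (sa U Y oU _ sYU)) //.
set A := vderiv _ _ p; set B := vderiv _ _ p; set C := pairing (Y p) _.
set A' := vderiv _ _ p; set B' := vderiv _ _ p; set C' := pairing _ _ => b0 a0.
rewrite (_ : _ - _ = c * (A' - B' - C') + (A - B - C)).
  by rewrite a0 b0 mulr0 addr0.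
by move: A B C A' B' C' {a0 b0} => A B C A' B' C'; ring.
Qed.

Lemma poisson_coboundary_closed : submod_closed poisson_coboundary.
Proof.
split=> [|c X Y].
  apply/asboolP; split; first exact: vsmooth_on0.
  exists (fun=> 0) => [|p a]; first exact: smooth_on0.
  by rewrite -[LHS]/(pairing 0 a) pairing0 dfun0 /pairing mulmx0 mxE.
move=> /asboolP[sX [f sf fX]] /asboolP[sY [g sg gY]]; apply/asboolP; split.
  exact: vsmooth_on_lin openT sX sY.
exists (fun p => c * f p + g p) => [|p a].
  exact: smooth_on_lin openT sf sg.
rewrite -[LHS]/(pairing (c *: X p + Y p) a) pairing_lin fX gY.
by rewrite (dfun_lin c openT I sf sg) pairing_linr.
Qed.

HB.instance Definition _ := GRing.isSubmodClosed.Build R tcovfield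
  leafwise_cocycle leafwise_cocycle_closed.
HB.instance Definition _ := GRing.isSubmodClosed.Build R tcovfield
  leafwise_coboundary leafwise_coboundary_closed.
HB.instance Definition _ := GRing.isSubmodClosed.Build R (vfield P)
  poisson_cocycle poisson_cocycle_closed.
HB.instance Definition _ := GRing.isSubmodClosed.Build R (vfield P)
  poisson_coboundary poisson_coboundary_closed.

(* Z1_F, H1_F, Z1_pi and H1_pi *)
Definition leafwise_Z1 : lmodType R := submod leafwise_cocycle.
Definition leafwise_H1 : lmodType R :=
  subquot leafwise_cocycle leafwise_coboundary.
Definition leafwise_class : leafwise_Z1 -> leafwise_H1 :=
  @subquot_class _ _ leafwise_cocycle leafwise_coboundary.

Definition poisson_Z1 : lmodType R := submod poisson_cocycle.
Definition poisson_H1 : lmodType R :=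
  subquot poisson_cocycle poisson_coboundary.
Definition poisson_class : poisson_Z1 -> poisson_H1 :=
  @subquot_class _ _ poisson_cocycle poisson_coboundary.

(* X is the vector field pi(a), i.e., b (X) = a (pi b) *)
Definition is_tsharp (a : tcovfield) (X : vfield P) : Prop :=
  forall p (b : 'cV[R]_n), pairing (X p) b = a p (sharp_at p b).

Definition transverse_orientation q (nu : kform P q) : Prop :=
  [/\ is_form nu, nowhere_vanishing nu
    & forall p w i, (w i <= Pi p)%MS -> nu p w = 0].

Definition is_reeb_class q (nu : kform P q) (c : leafwise_H1) : Prop :=
  exists2 a : leafwise_Z1, c = leafwise_class a &
    forall U X, open U -> tangent_on U X ->
      lie_scales U X nu (fun p => val a p (X p)).

(* phi is the modular vector field of mu: L_{pi(df)} mu = phi(f) mu *)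
Definition is_modular_field (mu : kform P n) (phi : vfield P) : Prop :=
  forall U f, open U -> smooth_on U f ->
    lie_scales U (sharp (dfun f)) mu (vderiv phi f).

(* The class of the modular vector field of every volume form; the first
   conjunct makes it unique. *)
Definition is_modular_class (c : poisson_H1) : Prop :=
  (exists mu : kform P n, volume_form mu) /\
  forall mu : kform P n, volume_form mu ->
    exists2 phi : poisson_Z1, c = poisson_class phi &
      is_modular_field mu (val phi).

End Cohomology.

(* Main.v *)
(* For a leafwise cocycle alpha the field pi(alpha) satisfies
   d_pi(pi(alpha))(a, b) = d_F alpha(pi a, pi b), because pi intertwines the
   bracket of 1-forms with the Lie bracket; and pi(alpha) is the Hamiltonian
   field of f (up to sign) iff alpha = d_F f, because the values pi(a) exhaust
   the tangent spaces of the leaves.  This gives the injection on H^1.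

   To compare the two classes, let rank pi = 2m and let mu0 be the volume form
   whose contraction with pi^m is the transverse form nu; pointwise it exists
   because, in a symplectic basis g_t, h_t of the leaf,
   (i_pi)^m F = 2^m m! F(g_1, h_1, ..., g_m, h_m, -).  A Hamiltonian field X
   preserves pi, so its Lie derivative commutes with this contraction:
   L_X mu0 = t mu0 implies L_X nu = t nu.  Hence the modular field of mu0 is
   exactly pi of the Reeb form.  For an arbitrary volume form mu = g mu0 the
   modular field changes by the coboundary of log |g|.

   The Reeb form is closed because on Hamiltonian fields it is the divergence
   with respect to mu0, div [X, Y] = X div Y - Y div X, and its leafwise
   differential is tensorial. *)
Require Import Defs.
From HB Require Import structures.
From mathcomp Require Import all_boot all_order all_fingroup all_algebra.
From mathcomp Require Import ring lra.
From mathcomp Require Import all_classical all_reals all_analysis.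

Set Implicit Arguments.
Unset Strict Implicit.
Unset Printing Implicit Defensive.

Import Order.TTheory GRing.Theory Num.Theory.
Import numFieldNormedType.Exports.
Import Defs.

Local Open Scope classical_set_scope.
Local Open Scope ring_scope.

(** * Calculus in R^n *)

(** The components of a field at [p] refer to [chart_at p], which may jump from point to point, so
    raw components such as [Pi p] need not be smooth in [p]. Derivatives are therefore computed in
    one fixed chart [c], with the components [vcoord], [acoord], [bivc] and [coform]; these agree
    with the raw ones at [p] when [c] is [chart_at p].

    The volume form [mu0] and the Reeb form are obtained point by point, by choice, without smooth
    symplectic frames or partitions of unity. Their smoothness is recovered afterwards: near each
    point they are quotients of smooth functions.

    Leafwise identities are obtained for Hamiltonian fields first. They reach all tangent fields
    because every vector tangent to a leaf is the value of a Hamiltonian field, and because the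
    expressions concerned depend only on values at the point: for tangent X, Cartan's formula gives
    L_X nu = i_X d nu, and d_F of the Reeb form is tensorial. *)

Section LineCalculus.
Variables (R : realType) (V : normedModType R).
Implicit Types (f : V -> R) (u v z : V).

Lemma open_norm_ball (W : set V) z : open W -> W z ->
  exists2 r : R, 0 < r & forall x, `|x - z| < r -> W x.
Proof.
move=> oW Wz; have /nbhs_normP[r /= r0 rW] := open_nbhs_nbhs (conj oW Wz).
by exists r => // x xr; apply: rW; rewrite /ball_ /= distrC.
Qed.

Lemma continuous_dist f z e : {for z, continuous f} -> 0 < e ->
  exists2 r : R, 0 < r & forall x, `|x - z| < r -> `|f x - f z| < e.
Proof.
move=> cf e0; move/cvgrPdist_lt : (cf) => /(_ _ e0) /nbhs_normP[r /= r0 H].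
by exists r => // x xr; rewrite distrC; apply: H; rewrite /ball_ /= distrC.
Qed.

Lemma derivable_line (W : normedModType R) (f : V -> W) v z (t : R) :
  derivable f (t *: v + z) v ->
  is_derive t 1 (fun s : R => f (s *: v + z)) ('D_v f (t *: v + z)).
Proof.
have E : (fun h : R => h^-1 *: (((fun s : R => f (s *: v + z)) \o shift t)
       (h *: (1 : R)) - f (t *: v + z))) =
     (fun h : R => h^-1 *: ((f \o shift (t *: v + z)) (h *: v) -
        f (t *: v + z))).
  by apply/funext => h /=; rewrite [h *: 1]mulr1 scalerDl addrA.
by move=> df; split; rewrite /derivable /derive E.
Qed.

Lemma mean_value_line f v z (s : R) :
  (forall t : R, `|t| <= `|s| -> derivable f (t *: v + z) v) ->
  exists2 t : R, `|t| <= `|s| & f (s *: v + z) - f z = s * 'D_v f (t *: v + z).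
Proof.
move=> df; pose g : R -> R := fun t => f (t *: v + z).
have dg (t : R) : `|t| <= `|s| -> is_derive t 1 g ('D_v f (t *: v + z)).
  by move=> /df/derivable_line.
have g0 : g 0 = f z by rewrite /g scale0r add0r.
have cg a b : (forall t, t \in `[a, b]%R -> `|t| <= `|s|) ->
    {within `[a, b], continuous g}.
  move=> ab; apply: derivable_within_continuous => t /ab /dg[].
  by [].
have [s0|s0] := leP 0 s.
  have sub t : t \in `[0, s]%R -> `|t| <= `|s|.
    by rewrite in_itv /= => /andP[t0 ts]; rewrite !ger0_norm.
  have [||c cs E] := @MVT_segment R g (fun t => 'D_v f (t *: v + z)) 0 s s0.
  - by move=> t /subset_itv_oo_cc /sub /dg.
  - exact: cg.
  - by exists c; [exact: sub | rewrite -g0 -/(g s) E subr0 mulrC].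
have sub t : t \in `[s, 0]%R -> `|t| <= `|s|.
  rewrite in_itv /= => /andP[st t0].
  by rewrite !ler0_norm ?lerN2 // ltW.
have [||c cs E] := @MVT_segment R g (fun t => 'D_v f (t *: v + z)) s 0 (ltW s0).
- by move=> t /subset_itv_oo_cc /sub /dg.
- exact: cg.
- exists c; first exact: sub.
  by rewrite -g0 -/(g s) -opprB E sub0r mulrN opprK mulrC.
Qed.

Lemma derivable_shift f (a : V) v z : derivable f (z + a) v ->
  derivable (fun x => f (x + a)) z v.
Proof.
rewrite /derivable (_ : (fun h : R => _) = (fun h : R => h^-1 *:
  (((fun x => f (x + a)) \o shift z) (h *: v) - f (z + a)))) //.
by apply/funext => h /=; rewrite addrA.
Qed.

Lemma derive_shift f (a : V) v z :
  'D_v (fun x => f (x + a)) z = 'D_v f (z + a).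
Proof.
rewrite /derive (_ : (fun h : R => _) = (fun h : R => h^-1 *:
  ((f \o shift (z + a)) (h *: v) - f (z + a)))) //.
by apply/funext => h /=; rewrite addrA.
Qed.

Lemma close_via (a b c e : R) :
  `|c - a| < e / 2 -> `|c - b| < e / 2 -> `|a - b| <= e.
Proof.
rewrite !ltr_norml ler_norml => /andP[? ?] /andP[? ?]; apply/andP; split; lra.
Qed.

(* The double difference of f along s u and s v equals s^2 times a value of
   either mixed derivative near z. *)
Lemma derive_comm f u v z (W : set V) : open W -> W z ->
  (forall x, W x -> derivable f x u) ->
  (forall x, W x -> derivable f x v) ->
  (forall x, W x -> derivable ('D_u f) x v) ->
  (forall x, W x -> derivable ('D_v f) x u) ->
  {for z, continuous ('D_v ('D_u f))} -> {for z, continuous ('D_u ('D_v f))} ->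
  'D_v ('D_u f) z = 'D_u ('D_v f) z.
Proof.
move=> oW Wz du dv duv dvu cuv cvu.
apply/eqP; rewrite -subr_eq0 -normr_le0; apply/ler_addgt0Pl => e e0.
rewrite addr0.
have e20 : 0 < e / 2 by rewrite divr_gt0.
have [r r0 rW] := open_norm_ball oW Wz.
have [r1 r10 H1] := continuous_dist cuv e20.
have [r2 r20 H2] := continuous_dist cvu e20.
pose rho := Num.min r (Num.min r1 r2).
have rho0 : 0 < rho by rewrite !lt_min r0 r10 r20.
(* The summand 1 keeps [K] positive when [u] and [v] vanish; [s * K < rho] keeps all points a u + b
   v + z with |a|, |b| <= s in the ball of radius [rho]. *)
pose K := `|u| + `|v| + 1.
have K0 : 0 < K by rewrite /K ltr_wpDl // addr_ge0.
pose s := rho / 2 / K.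
have s0 : 0 < s by rewrite /s !divr_gt0.
have sK : s * K < rho.
  by rewrite /s divfK ?gt_eqF // ltr_pdivrMr // mulr_natr mulr2n ltrDl.
have near a b : `|a| <= s -> `|b| <= s -> `|a *: u + b *: v| < rho.
  move=> ha hb; apply: le_lt_trans sK.
  apply: (le_trans (ler_normD _ _)); rewrite !normrZ.
  rewrite /K !mulrDr mulr1.
  have := ler_wpM2r (normr_ge0 u) ha; have := ler_wpM2r (normr_ge0 v) hb.
  by move: s0; lra.
have Wn a b : `|a| <= s -> `|b| <= s -> W (a *: u + b *: v + z).
  move=> ha hb; apply: rW; rewrite addrK.
  by apply: lt_le_trans (near _ _ ha hb) _; rewrite ge_min lexx.
have ns : `|s| = s by rewrite gtr0_norm.
have n0 : `|0 : R| <= s by rewrite normr0 ltW.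
have nss : `|s| <= s by rewrite ns.
pose D := f (s *: u + s *: v + z) - f (s *: u + z) - f (s *: v + z) + f z.
have DE : D = f (s *: u + s *: v + z) - f (s *: u + z) - f (s *: v + z) + f z.
  by [].
clearbody D.
(* [D] is the increment along [s *: u] of x -> f (x + s v) - f x. The mean value theorem along [u],
   then along [v], gives one mixed derivative; exchanging the roles of [u] and [v] below gives the
   other. *)
have [a1 [b1 [h1 h2 E1]]] : exists a b, [/\ `|a| <= s, `|b| <= s &
    D = s * (s * 'D_v ('D_u f) (a *: u + b *: v + z))].
  have [|a ha Ea] := @mean_value_line (fun x => f (x + s *: v) - f x) u z s.
    rewrite ns => t ht; apply: derivableB.
      by apply: derivable_shift; apply: du; rewrite addrAC; exact: Wn.
    by apply: du; have := Wn t 0 ht n0; rewrite scale0r addr0.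
  rewrite ns in ha.
  have [|b hb Eb] := @mean_value_line ('D_u f) v (a *: u + z) s.
    rewrite ns => t ht; apply: duv; rewrite addrCA addrA; exact: Wn.
  rewrite ns in hb; exists a, b; split; [exact: ha | exact: hb |].
  rewrite (_ : a *: u + b *: v + z = b *: v + (a *: u + z)); last first.
    by rewrite [a *: u + _]addrC -addrA.
  rewrite -Eb.
  have -> : D = f (s *: u + z + s *: v) - f (s *: u + z) - (f (z + s *: v) - f z).
    by rewrite DE [z + _]addrC [s *: u + z + _]addrAC; ring.
  rewrite Ea; congr (_ * _); rewrite deriveB.
  - by rewrite derive_shift [s *: v + _]addrC.
  - by apply: derivable_shift; apply: du; rewrite addrAC; exact: Wn.
  - by apply: du; have := Wn a 0 ha n0; rewrite scale0r addr0.
have [a2 [b2 [h3 h4 E2]]] : exists a b, [/\ `|a| <= s, `|b| <= s &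
    D = s * (s * 'D_u ('D_v f) (a *: u + b *: v + z))].
  have [|b hb Eb] := @mean_value_line (fun x => f (x + s *: u) - f x) v z s.
    rewrite ns => t ht; apply: derivableB.
      apply: derivable_shift; apply: dv; rewrite addrC addrA; exact: Wn.
    by apply: dv; have := Wn 0 t n0 ht; rewrite scale0r add0r.
  rewrite ns in hb.
  have [|a ha Ea] := @mean_value_line ('D_v f) u (b *: v + z) s.
    rewrite ns => t ht; apply: dvu; rewrite addrA; exact: Wn.
  rewrite ns in ha; exists a, b; split; [exact: ha | exact: hb |].
  rewrite (_ : a *: u + b *: v + z = a *: u + (b *: v + z)); last first.
    by rewrite addrA.
  rewrite -Ea.
  have -> : D = f (s *: v + z + s *: u) - f (s *: v + z) - (f (z + s *: u) - f z).
    by rewrite DE [z + _]addrC [s *: v + z + _]addrC addrA; ring.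
  rewrite Eb; congr (_ * _); rewrite deriveB.
  - by rewrite derive_shift [s *: u + _]addrC.
  - by apply: derivable_shift; apply: dv; rewrite addrC addrA; exact: Wn.
  - by apply: dv; have := Wn 0 b n0 hb; rewrite scale0r add0r.
have sn0 : s != 0 by rewrite gt_eqF.
have E : 'D_v ('D_u f) (a1 *: u + b1 *: v + z) =
    'D_u ('D_v f) (a2 *: u + b2 *: v + z).
  by rewrite E1 in E2; exact: (mulfI sn0 (mulfI sn0 E2)).
have G1 : `|a1 *: u + b1 *: v + z - z| < r1.
  by rewrite addrK; apply: lt_le_trans (near _ _ h1 h2) _; rewrite !ge_min lexx orbT.
have G2 : `|a2 *: u + b2 *: v + z - z| < r2.
  by rewrite addrK; apply: lt_le_trans (near _ _ h3 h4) _; rewrite !ge_min lexx !orbT.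
apply: close_via (H1 _ G1) _.
by rewrite E; exact: H2 _ G2.
Qed.

End LineCalculus.

Lemma differentiable_linear_approx (R : realType) (V W : normedModType R)
    (f : V -> W) (L : {linear V -> W}) (x : V) : continuous L ->
  (forall e, 0 < e -> \forall h \near (0 : V),
     `|f (h + x) - f x - L h| <= e * `|h|) ->
  differentiable f x.
Proof.
move=> cL fL.
have key : f \o shift x = cst (f x) + L +o_ 0 id.
  apply/eqaddoP => e e0; apply: filterS (fL e e0) => h.
  by rewrite /= opprD addrA.
by apply/diff_locallyP; rewrite (diff_unique cL key); split.
Qed.

(** * Continuous partial derivatives and differentiability *)

Section CoordinateCalculus.
Variables (R : realType) (n : nat).
Implicit Types (V W : set 'rV[R]_n) (f g : 'rV[R]_n -> R).

Local Notation e_ j := (delta_mx 0 j : 'rV[R]_n).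

Lemma entry_le_norm (x : 'rV[R]_n) j : `|x 0 j| <= `|x|.
Proof.
by rewrite [leRHS]/Num.Def.normr /= mx_normrE; exact: (le_bigmax _ _ (0, j)).
Qed.

Lemma norm_le_entries (x : 'rV[R]_n) (r : R) : 0 <= r ->
  (forall j, `|x 0 j| <= r) -> `|x| <= r.
Proof.
move=> r0 xr; rewrite [leLHS]/Num.Def.normr /= mx_normrE.
by apply: bigmax_le => // -[i j] _ /=; rewrite (ord1 i).
Qed.

(** The points [x] and [h + x] are joined by a path parallel to the axes. On each piece the mean
    value theorem replaces the increment by a partial derivative taken near [x], hence close to its
    value at [x]. *)
Lemma derivable_differentiable V f x : open V -> V x ->
  (forall j y, V y -> derivable f y (e_ j)) ->
  (forall j, {for x, continuous ('D_(e_ j) f)}) ->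
  differentiable f x.
Proof.
move=> oV Vx df cf.
pose c : 'cV[R]_n := \col_j 'D_(e_ j) f x.
pose L0 (h : 'rV[R]_n) : R := (h *m c) 0 0.
have L0E h : L0 h = \sum_j h 0 j * 'D_(e_ j) f x.
  by rewrite /L0 mxE; apply: eq_bigr => j _; rewrite mxE.
have L0lin : linear L0.
  by move=> a u v; rewrite /L0 mulmxDl -scalemxAl !mxE.
pose Laux := GRing.isLinear.Build _ _ _ _ L0 L0lin.
pose L : {linear 'rV[R]_n -> R} := HB.pack L0 Laux.
have cL : continuous L.
  rewrite (_ : L = (fun h => \sum_j h 0 j * 'D_(e_ j) f x) :> (_ -> _)); last first.
    exact/funext.
  apply: continuous_big => [|j _]; first exact: add_continuous.
  move=> z; apply: (@continuousM _ _ (fun h : 'rV[R]_n => h 0 j) (fun=> _)).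
    exact: matrix_normedtype.coord_continuous.
  exact: cst_continuous.
have step (h : 'rV[R]_n) (r : R) : `|h| < r ->
    (forall y, `|y - x| < r -> V y) ->
    forall e, (forall j y, `|y - x| < r ->
        `|'D_(e_ j) f y - 'D_(e_ j) f x| <= e) ->
    `|f (h + x) - f x - L h| <= e * n%:R * `|h|.
  move=> hr rV e He.
  (* Vertices of the path: [p l] keeps the first [l] coordinates of [h], so that consecutive
     vertices differ along one axis. *)
  pose p (l : nat) : 'rV[R]_n := \row_i (if (i < l)%N then h 0 i else 0).
  have pS (l : 'I_n) : p l.+1 = h 0 l *: e_ l + p l.
    apply/rowP => i; rewrite !mxE eqxx /= ltnS leq_eqVlt.
    have [->|il] := eqVneq i l; first by rewrite eqxx ltnn mulr1 addr0.
    by rewrite -val_eqE in il; rewrite (negbTE il) mulr0 add0r.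
  have pn : p n = h by apply/rowP => i; rewrite mxE ltn_ord.
  have p0 : p 0%N = 0 by apply/rowP => i; rewrite !mxE.
  have ple (l : 'I_n) t : `|t| <= `|h 0 l| -> `|t *: e_ l + p l| <= `|h|.
    move=> th; apply: norm_le_entries => // i; rewrite !mxE eqxx /=.
    have [->|il] := eqVneq i l.
      by rewrite ltnn mulr1 addr0 (le_trans th) // entry_le_norm.
    by rewrite mulr0 add0r; case: ifP => _; rewrite ?normr0 // entry_le_norm.
  have tele : f (h + x) - f x = \sum_(l < n) (f (p l.+1 + x) - f (p l + x)).
    rewrite -(big_mkord xpredT (fun l => f (p l.+1 + x) - f (p l + x))).
    by rewrite (telescope_sumr (fun l => f (p l + x))) // pn p0 add0r.
  rewrite tele /L /= L0E -sumrB.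
  apply: le_trans (ler_norm_sum _ _ _) _.
  apply: (@le_trans _ _ (\sum_(l < n) e * `|h|)); last first.
    by rewrite sumr_const card_ord mulrAC mulr_natr lexx.
  apply: ler_sum => l _; rewrite pS -[_ *: _ + _ + x]addrA.
  have inr t : `|t| <= `|h 0 l| -> `|t *: e_ l + (p l + x) - x| < r.
    by move=> th; rewrite addrA addrK; apply: le_lt_trans (ple l t th) hr.
  have [t th|t th ->] := @mean_value_line R _ f (e_ l) (p l + x) (h 0 l).
    by apply: df; apply: rV; exact: inr.
  rewrite -mulrBr normrM mulrC; apply: ler_pM => //; last exact: entry_le_norm.
  by apply: He; exact: inr.
apply: (differentiable_linear_approx (L := L) cL) => e e0.
have n0 : 0 < n%:R + 1 :> R by rewrite ltr_wpDl // ler0n.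
  (* The [n] pieces contribute at most [e' * |h|] each; [n + 1] instead of [n] avoids a division by
     zero in dimension 0. *)
  pose e' := e / (n%:R + 1).
  have e'0 : 0 < e' by rewrite divr_gt0.
  have [r r0 rV] := open_norm_ball oV Vx.
  have /choice[rj Hrj] : forall j, exists s : R, 0 < s /\
      forall y, `|y - x| < s -> `|'D_(e_ j) f y - 'D_(e_ j) f x| < e'.
    by move=> j; have [s] := continuous_dist (cf j) e'0; exists s.
  pose rho := \big[Num.min/r]_j rj j.
  have rho0 : 0 < rho.
    by apply: lt_bigmin => // j _; have [] := Hrj j.
  apply/nbhs_normP; exists rho => //= h; rewrite /ball_ /= sub0r normrN => hr.
  apply: le_trans (@step h rho hr _ e' _) _.
  - move=> y /lt_le_trans yr; apply: rV; apply: yr; exact: bigmin_le_id.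
  - move=> j y yr; apply: ltW; apply: (Hrj j).2; apply: lt_le_trans yr _.
    exact: bigmin_le.
  apply: ler_wpM2r => //; rewrite /e' mulrAC ler_pdivrMr //.
  by rewrite ler_wpM2l ?ltW// ltrDl.
Qed.

End CoordinateCalculus.

(** As [phi] is derivable in the single direction [v], the chain rule is applied to the curve t ->
    phi (t v + x), which is differentiable at 0 because its variable is real. *)
Lemma derive_comp_differentiable (R : realType) (U V W : normedModType R)
    (phi : U -> V) (g : V -> W) (x v : U) :
  derivable phi x v -> differentiable g (phi x) ->
  derivable (g \o phi) x v /\ 'D_v (g \o phi) x = 'd g (phi x) ('D_v phi x).
Proof.
move=> dphi dg; pose gam : R -> V := fun t => phi (t *: v + x).
have gam0 : gam 0 = phi x by rewrite /gam scale0r add0r.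
have x0 : 0 *: v + x = x by rewrite scale0r add0r.
have [dgam Dgam] : is_derive (0 : R) (1 : R) gam ('D_v phi x).
  by have := @derivable_line _ _ _ phi v x 0; rewrite x0; apply.
have fgam : differentiable gam (0 : R) by exact/derivable1_diffP.
have dg0 : differentiable g (gam 0) by rewrite gam0.
have fc := differentiable_comp fgam dg0.
have dc : derivable (g \o phi) x v by apply/derivable1P/derivable1_diffP.
split=> //.
have [_ <-] : is_derive (0 : R) (1 : R) (g \o gam) ('D_v (g \o phi) x).
  by have := @derivable_line _ _ _ (g \o phi) v x 0; rewrite x0; apply.
rewrite (deriveE (1 : R) fc) diff_comp //=.
by rewrite -(deriveE (1 : R) fgam) Dgam gam0.
Qed.

(** * Stability of C^k functions under products, quotients and logarithms *)

Section CkAlgebra.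
Variables (R : realType) (n : nat).
Implicit Types (V W : set 'rV[R]_n) (f g : 'rV[R]_n -> R).

Local Notation e_ j := (delta_mx 0 j : 'rV[R]_n).

Lemma Ck_weaken k V f : Ck k.+1 V f -> Ck k V f.
Proof.
elim: k f => [|k IHk] f /= [cf Df]; split=> // j.
by have [df Cf] := Df j; split=> //; exact: IHk.
Qed.

Lemma Ck_le k m V f : (k <= m)%N -> Ck m V f -> Ck k V f.
Proof.
move=> /subnK <-; elim: (m - k)%N => //= d IHd Cf; apply: IHd.
exact: Ck_weaken.
Qed.

Lemma Ck_local k V f :
  (forall x, V x -> exists W, [/\ open W, W x & Ck k W f]) -> Ck k V f.
Proof.
elim: k f => [|k IHk] f H.
  by split=> // x Vx; have [W [_ Wx [cf _]]] := H x Vx; exact: cf.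
split=> [x Vx|j].
  by have [W [_ Wx [cf _]]] := H x Vx; exact: cf.
split=> [x Vx|].
  by have [W [_ Wx [_ /(_ j)[df _]]]] := H x Vx; exact: df.
apply: IHk => x Vx; have [W [oW Wx [_ /(_ j)[_ Cf]]]] := H x Vx.
by exists W.
Qed.

Lemma Ck_differentiable V f x : open V -> Ck 1 V f -> V x -> differentiable f x.
Proof.
move=> oV [_ Df] Vx; apply: (derivable_differentiable oV Vx) => [j y|j].
  by have [+ _] := Df j; exact.
by have [_ [+ _]] := Df j; exact.
Qed.

Lemma Ck_cst k V (c : R) : Ck k V (fun=> c).
Proof.
have c0 (x : 'rV[R]_n) : {for x, continuous (fun=> c)}.
  exact: cst_continuous.
case: k => [|k] /=; split=> // j.
split=> [x _|]; first exact: (derivable_cst c).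
rewrite (_ : (fun x => 'D_(e_ j) _ x) = fun=> 0); first exact: Ck_cst0.
by apply/funext => x; exact: (derive_cst c).
Qed.

Lemma CkD k V f g : open V -> Ck k V f -> Ck k V g ->
  Ck k V (fun x => f x + g x).
Proof.
move=> oV Cf Cg; apply: (Ck_ext oV _ (Ck_lin 1 oV Cf Cg)) => x _.
by rewrite mul1r.
Qed.

Lemma CkM k V f g : open V -> Ck k V f -> Ck k V g ->
  Ck k V (fun x => f x * g x).
Proof.
move=> oV; elim: k f g => [|k IHk] f g Cf Cg.
all: have [cf Df] := Cf; have [cg Dg] := Cg.
all: have cfg x : V x -> {for x, continuous (fun x => f x * g x)}.
1,3: by move=> Vx; apply: continuousM; [exact: cf | exact: cg].
  by split.
split=> // j; have [df Cf'] := Df j; have [dg Cg'] := Dg j; split=> [x Vx|].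
  exact: (derivableM (df x Vx) (dg x Vx)).
have Ckf := Ck_weaken Cf; have Ckg := Ck_weaken Cg.
apply: Ck_ext (CkD oV (IHk _ _ Ckf Cg') (IHk _ _ Ckg Cf')) => // x Vx.
by have := deriveM (df x Vx) (dg x Vx) => /= ->.
Qed.

Lemma Ck_big (I : Type) (s : seq I) (F : I -> 'rV[R]_n -> R) k V : open V ->
  (forall i, Ck k V (F i)) ->
  Ck k V (fun x => \sum_(i <- s) F i x) /\ Ck k V (fun x => \prod_(i <- s) F i x).
Proof.
move=> oV CF; elim: s => [|i s [IHs IHp]].
  split; [under eq_fun do rewrite big_nil | under eq_fun do rewrite big_nil];
    exact: Ck_cst.
split; under eq_fun do rewrite big_cons; first exact: CkD.
exact: CkM.
Qed.

Lemma CkV k V f : open V -> (forall x, V x -> f x != 0) -> Ck k V f ->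
  Ck k V (fun x => (f x)^-1).
Proof.
move=> oV f0; elim: k => [|k IHk] Cf.
all: have [cf Df] := Cf.
all: have cif x : V x -> {for x, continuous (fun x => (f x)^-1)}.
1,3: by move=> Vx; apply: continuousV; [exact: f0 | exact: cf].
  by split.
split=> // j; have [df Cf'] := Df j; split=> [x Vx|].
  by have := derivableV (f0 x Vx) (df x Vx).
have Ci := IHk (Ck_weaken Cf).
apply: Ck_ext (CkM oV (Ck_cst k V (-1)) (CkM oV Cf' (CkM oV Ci Ci))) => // x Vx.
have /= -> := deriveV (f0 x Vx) (df x Vx).
by rewrite -[_ *: _]/(_ * _) mulN1r mulNr [_ * (_ * _)]mulrC expr2 invfM.
Qed.

Lemma derive_ln (V : normedModType R) (f : V -> R) x v : 0 < f x ->
  derivable f x v -> derivable (fun y => ln (f y)) x v /\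
  'D_v (fun y => ln (f y)) x = (f x)^-1 * 'D_v f x.
Proof.
move=> f0 df.
have [dl El] := is_derive1_ln f0.
have fl : differentiable (@ln R) (f x) by exact/derivable1_diffP.
have [d E] := derive_comp_differentiable df fl.
by split=> //; rewrite E -[X in 'd _ _ X]mulr1 linearZ /= -deriveE // El mulrC.
Qed.

Lemma Ck_ln k V f : open V -> (forall x, V x -> 0 < f x) -> Ck k V f ->
  Ck k V (fun x => ln (f x)).
Proof.
move=> oV f0; elim: k => [|k IHk] Cf.
all: have [cf Df] := Cf.
all: have clf x : V x -> {for x, continuous (fun x => ln (f x))}.
1,3: move=> Vx; apply: (continuous_comp (cf x Vx)); exact: continuous_ln (f0 x Vx).
  by split.
split=> // j; have [df Cf'] := Df j; split=> [x Vx|].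
  by have [] := derive_ln (f0 x Vx) (df x Vx).
have fn0 x : V x -> f x != 0 by move=> /f0; rewrite lt0r => /andP[].
have Ci := CkV oV fn0 (Ck_weaken Cf).
apply: Ck_ext (CkM oV Ci Cf') => // x Vx.
by have [_ ->] := derive_ln (f0 x Vx) (df x Vx).
Qed.

Lemma Ck_derive_comm V f i j x : open V -> Ck 2 V f -> V x ->
  'D_(e_ i) ('D_(e_ j) f) x = 'D_(e_ j) ('D_(e_ i) f) x.
Proof.
move=> oV [_ Df] Vx; have [di [_ Dfi]] := Df i; have [dj [_ Dfj]] := Df j.
have [dji [cji _]] := Dfj i; have [dij [cij _]] := Dfi j.
by apply: (derive_comm oV Vx dj di dji dij); [exact: cji | exact: cij].
Qed.

End CkAlgebra.

(** * Composition of C^k maps *)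

Section CkComp.
Variables (R : realType) (m n : nat).
Variables (V : set 'rV[R]_m) (W : set 'rV[R]_n).
Hypotheses (oV : open V) (oW : open W).
Variable phi : 'rV[R]_m -> 'rV[R]_n.
Hypothesis phiVW : forall x, V x -> W (phi x).

Lemma continuous_rV (x : 'rV[R]_m) : (forall l, {for x, continuous (fun y => phi y 0 l)}) ->
  {for x, continuous phi}.
Proof.
move=> c; apply/(@cvgrPdist_le _ _ _ (nbhs x) (nbhs_filter x)) => e e0.
have Hl l : \forall y \near x, `|phi x 0 l - phi y 0 l| <= e.
  by move/cvgrPdist_le : (c l) => /(_ e e0).
have : \forall y \near x, forall l, `|phi x 0 l - phi y 0 l| <= e.
  exact: (@filter_forall _ _ _ _ (nbhs_filter x)).
apply: (@filterS _ (nbhs x) (nbhs_filter x)) => y H.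
apply: norm_le_entries (ltW e0) _ => l.
by rewrite !mxE.
Qed.

Lemma derive_Ck1_comp (g : 'rV[R]_n -> R) j x : Ck 1 W g -> V x ->
  (forall l, derivable (fun y => phi y 0 l) x (delta_mx 0 j)) ->
  derivable (g \o phi) x (delta_mx 0 j) /\
  'D_(delta_mx 0 j) (g \o phi) x = \sum_l
    'D_(delta_mx 0 l) g (phi x) * 'D_(delta_mx 0 j) (fun y => phi y 0 l) x.
Proof.
move=> Cg Vx dphi.
have dp : derivable phi x (delta_mx 0 j).
  by apply/derivable_mxP => i l; rewrite (ord1 i).
have dg := Ck_differentiable oW Cg (phiVW Vx).
have [d ->] := derive_comp_differentiable dp dg; split=> //.
rewrite derive_mx // [X in 'd _ _ X]row_sum_delta raddf_sum /=.
apply: eq_bigr => l _.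
by rewrite linearZ /= -deriveE // !mxE mulrC.
Qed.

(** By the chain rule a partial derivative of [g \o phi] is a sum of products of partial derivatives
    of [g], composed with [phi], and of [phi]; the induction hypothesis applies to the former. *)
Lemma Ck_comp k (g : 'rV[R]_n -> R) :
  (forall l, Ck k V (fun y => phi y 0 l)) -> Ck k W g -> Ck k V (g \o phi).
Proof.
elim: k g => [|k IHk] g Cphi Cg.
all: have [cg Dg] := Cg.
all: have cgp x : V x -> {for x, continuous (g \o phi)}.
1,3: move=> Vx; apply: continuous_comp; last by apply: cg; exact: phiVW.
1,2: by apply: continuous_rV => l; have [cp _] := Cphi l; exact: cp.
  by split.
split=> // j.
have C1 : Ck 1 W g by exact: Ck_le Cg.
have dphi x l : V x -> derivable (fun y => phi y 0 l) x (delta_mx 0 j).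
  by have [_ /(_ j)[+ _]] := Cphi l; exact.
split=> [x Vx|]; first by have [] := derive_Ck1_comp C1 Vx (fun l => dphi x l Vx).
pose F (l : 'I_n) x := ('D_(delta_mx 0 l) g \o phi) x *
  'D_(delta_mx 0 j) (fun y => phi y 0 l) x.
have CF l : Ck k V (F l).
  apply: CkM oV _ _; last by have [_ /(_ j)[]] := Cphi l.
  apply: (IHk ('D_(delta_mx 0 l) g)) => [i|]; first exact: Ck_weaken (Cphi i).
  by have [] := Dg l.
apply: (Ck_ext oV _ (Ck_big (index_enum _) oV CF).1) => x Vx.
by have [_ ->] := derive_Ck1_comp C1 Vx (fun l => dphi x l Vx).
Qed.

End CkComp.

(** * Smooth functions and vector fields on manifolds *)

Section SmoothFunctions.
Variables (R : realType) (n : nat) (P : manifold R n).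
Implicit Types (U V W : set P) (f g : P -> R) (c i : chart P) (p q : P).

Lemma mem_cdom_chart_at p : cdom (chart_at p) p.
Proof. exact: cdom_chart_at. Qed.

Lemma open_cdom c : open (@cdom _ _ P c).
Proof. exact: (@cdom_open _ _ P). Qed.

Lemma open_setI_cdom U c : open U -> open (U `&` cdom c).
Proof. by move=> oU; apply: openI => //; exact: open_cdom. Qed.

Lemma icoordK c x : (coord c @` (@cdom _ _ P c)) x -> coord c (icoord c x) = x.
Proof. by case=> p cp <-; rewrite coordK. Qed.

Lemma smooth_local U f :
  (forall p, U p -> exists W, [/\ open W, W p & smooth_on W f]) ->
  smooth_on U f.
Proof.
move=> H i k; apply: Ck_local => _ [p [Up ip] <-].
have [W [oW Wp sf]] := H p Up.
exists (coord i @` (W `&` cdom i)); split; first exact: open_coord_image.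
  by exists p.
exact: sf.
Qed.

Lemma smooth_ext U f g : open U -> (forall p, U p -> f p = g p) ->
  smooth_on U f -> smooth_on U g.
Proof.
move=> oU fg sf i k; have := sf i k.
apply: Ck_ext; first exact: open_coord_image.
by move=> _ [p [Up ip] <-] /=; rewrite coordK //; exact: fg.
Qed.

(** One chart that covers the set suffices: every other coordinate expression is obtained by
    composing with a smooth transition map. *)
Lemma smooth_chart W c f : open W -> W `<=` cdom c ->
  Cinf (coord c @` W) (f \o icoord c) -> smooth_on W f.
Proof.
move=> oW Wc Cf i k.
have oi := open_coord_image (i := i) oW.
have oc : open (coord c @` W).
  by have := open_coord_image (i := c) oW; rewrite (setIidl Wc).
pose phi := fun x => coord c (icoord i x) : 'rV[R]_n.
have phiW x : (coord i @` (W `&` cdom i)) x -> (coord c @` W) (phi x).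
  by move=> [p [Wp ip] <-]; rewrite /phi coordK //; exists p.
have Cphi l : Ck k (coord i @` (W `&` cdom i)) (fun x => phi x 0 l).
  apply: Ck_subset (transition_smooth i c l k).
  by apply: image_subset => p [Wp ip]; split=> //; exact: Wc.
apply: (Ck_ext oi _ (Ck_comp oi oc phiW Cphi (Cf k))).
move=> _ [p [Wp ip] <-] /=; rewrite /phi coordK // coordK //; exact: Wc.
Qed.

Lemma smooth_in_chart W c f : W `<=` cdom c -> smooth_on W f ->
  Cinf (coord c @` W) (f \o icoord c).
Proof. by move=> Wc /(_ c); rewrite (setIidl Wc). Qed.

Lemma smooth_cst U (r : R) : smooth_on U (fun=> r).
Proof. by move=> i k; exact: Ck_cst. Qed.

Lemma smoothD U f g : open U -> smooth_on U f -> smooth_on U g ->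
  smooth_on U (fun p => f p + g p).
Proof.
by move=> oU sf sg i k; apply: CkD (sf i k) (sg i k); exact: open_coord_image.
Qed.

Lemma smoothM U f g : open U -> smooth_on U f -> smooth_on U g ->
  smooth_on U (fun p => f p * g p).
Proof.
by move=> oU sf sg i k; apply: CkM (sf i k) (sg i k); exact: open_coord_image.
Qed.

Lemma smoothN U f : open U -> smooth_on U f -> smooth_on U (fun p => - f p).
Proof.
move=> oU sf; apply: (smooth_ext oU _ (smoothM oU (smooth_cst U (-1)) sf)).
by move=> p _; rewrite mulN1r.
Qed.

Lemma smoothB U f g : open U -> smooth_on U f -> smooth_on U g ->
  smooth_on U (fun p => f p - g p).
Proof. by move=> oU sf sg; apply: smoothD => //; exact: smoothN. Qed.

Lemma smooth_sum (I : Type) (s : seq I) U (F : I -> P -> R) : open U ->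
  (forall m, smooth_on U (F m)) -> smooth_on U (fun p => \sum_(i <- s) F i p).
Proof.
move=> oU sF i k; have oi := open_coord_image (i := i) oU.
exact: (Ck_big s oi (fun j => sF j i k)).1.
Qed.

Lemma smooth_prod (I : Type) (s : seq I) U (F : I -> P -> R) : open U ->
  (forall m, smooth_on U (F m)) -> smooth_on U (fun p => \prod_(i <- s) F i p).
Proof.
move=> oU sF i k; have oi := open_coord_image (i := i) oU.
exact: (Ck_big s oi (fun j => sF j i k)).2.
Qed.

Lemma smoothV U f : open U -> (forall p, U p -> f p != 0) -> smooth_on U f ->
  smooth_on U (fun p => (f p)^-1).
Proof.
move=> oU f0 sf i k; apply: CkV (sf i k); first exact: open_coord_image.
by move=> _ [p [Up ip] <-] /=; rewrite coordK //; exact: f0.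
Qed.

Lemma smooth_ln U f : open U -> (forall p, U p -> 0 < f p) -> smooth_on U f ->
  smooth_on U (fun p => ln (f p)).
Proof.
move=> oU f0 sf i k; apply: Ck_ln (sf i k); first exact: open_coord_image.
by move=> _ [p [Up ip] <-] /=; rewrite coordK //; exact: f0.
Qed.

(** Supplies the neighbourhoods on which one may divide by [f]. They are cut out by a ball of the
    chart, continuity being known for the coordinate expression of [f]. *)
Lemma smooth_neq0 U f p : open U -> U p -> smooth_on U f -> f p != 0 ->
  exists W, [/\ open W, W p, W `<=` U & forall q, W q -> f q != 0].
Proof.
move=> oU Up sf f0; pose c := chart_at p.
pose A := coord c @` (U `&` cdom c).
have oA : open A by exact: open_coord_image.
have Ap : A (coord c p) by exists p => //; split=> //; exact: mem_cdom_chart_at.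
have [cf _] := sf c 0%N.
have e0 : 0 < `|f p| by rewrite normr_gt0.
have [r r0 Hr] := continuous_dist (cf _ Ap) e0.
pose W := (U `&` cdom c) `&` coord c @^-1` [set x | `|x - coord c p| < r].
exists W; split.
- rewrite openE => q [[Uq cq] rq]; rewrite /interior.
  have oUc := open_nbhs_nbhs (conj (open_setI_cdom c oU) (conj Uq cq)).
  apply: filterI oUc _; apply: (coord_continuous cq).
  have : open [set x | `|x - coord c p| < r].
    have -> : [set x | `|x - coord c p| < r] = ball (coord c p) r.
      by rewrite -ball_normE; apply/seteqP; split=> x /=; rewrite /ball_ /= distrC.
    exact: ball_open.
  by move=> o; exact: (open_nbhs_nbhs (conj o rq)).
- split; first by split=> //; exact: mem_cdom_chart_at.
  by rewrite /= subrr normr0.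
- by move=> q [[]].
move=> q [[Uq cq] /= /Hr] /=; rewrite !coordK //; last exact: mem_cdom_chart_at.
by apply: contraTneq => ->; rewrite sub0r normrN ltxx.
Qed.

(* The partial derivatives in an arbitrary chart c; [partial p j] is
   [pd (chart_at p) j] at p. *)
Definition pd c (j : 'I_n) f : P -> R :=
  fun q => 'D_(delta_mx 0 j) (f \o icoord c) (coord c q).

Section AtPoint.
Variables (U : set P) (c : chart P) (q : P).
Hypotheses (oU : open U) (Uq : U q) (cq : cdom c q).

Let A := coord c @` (U `&` cdom c).
Let oA : open A. Proof. exact: open_coord_image. Qed.
Let Aq : A (coord c q). Proof. by exists q. Qed.

Lemma smooth_derivable f j : smooth_on U f ->
  derivable (f \o icoord c) (coord c q) (delta_mx 0 j).
Proof. by move=> sf; have [_ /(_ j)[/(_ _ Aq)]] := sf c 1%N. Qed.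

Lemma pd_local f g j : (forall p, U p -> f p = g p) -> pd c j f q = pd c j g q.
Proof using oU Uq cq.
move=> fg; apply: near_eq_derive.
apply: filterS (open_nbhs_nbhs (conj oA Aq)) => _ [p [Up cp] <-] /=.
by rewrite coordK //; exact: fg.
Qed.

Lemma pdM f g j : smooth_on U f -> smooth_on U g ->
  pd c j (fun p => f p * g p) q = f q * pd c j g q + g q * pd c j f q.
Proof using oU Uq cq.
move=> sf sg; have df := smooth_derivable (j := j) sf; have dg := smooth_derivable (j := j) sg.
by have := deriveM df dg => /=; rewrite coordK.
Qed.

Lemma pd_ln f j : 0 < f q -> smooth_on U f ->
  pd c j (fun p => ln (f p)) q = (f q)^-1 * pd c j f q.
Proof using oU Uq cq.
move=> f0 sf; have df := smooth_derivable (j := j) sf.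
have f0' : 0 < (f \o icoord c) (coord c q) by rewrite /= coordK.
by have [_] := derive_ln f0' df; rewrite /= coordK.
Qed.

Lemma pd_comm f (a b : 'I_n) : smooth_on U f ->
  pd c a (pd c b f) q = pd c b (pd c a f) q.
Proof using oU Uq cq.
have E (k l : 'I_n) : 'D_(delta_mx 0 l) (pd c k f \o icoord c) (coord c q) =
    'D_(delta_mx 0 l) ('D_(delta_mx 0 k) (f \o icoord c)) (coord c q).
  apply: near_eq_derive.
  apply: filterS (open_nbhs_nbhs (conj oA Aq)) => _ [p [Up cp] <-] /=.
  by rewrite /pd coordK.
move=> sf; rewrite {1}/pd E [RHS]/pd E.
exact: (Ck_derive_comm a b oA (sf c 2%N) Aq).
Qed.

Lemma pd_chain f i j : cdom i q -> smooth_on U f ->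
  pd i j f q = \sum_l pd i j (xcoord c l) q * pd c l f q.
Proof using oU Uq cq.
move=> iq sf; pose W := coord i @` ((U `&` cdom c) `&` cdom i).
have oW : open W by apply: open_coord_image; exact: open_setI_cdom.
have Wq : W (coord i q) by exists q.
pose phi (x : 'rV[R]_n) : 'rV[R]_n := coord c (icoord i x).
have phiW x : W x -> A (phi x).
  by move=> [p [[Up cp] ip] <-]; rewrite /phi coordK //; exists p.
have dphi l : derivable (fun x => phi x 0 l) (coord i q) (delta_mx 0 j).
  have [_ /(_ j)[+ _]] := transition_smooth i c l 1%N; apply.
  by exists q.
have [_ E] := derive_Ck1_comp oA phiW (sf c 1%N) Wq dphi.
rewrite /pd; transitivity ('D_(delta_mx 0 j) ((f \o icoord c) \o phi) (coord i q)).
  apply: near_eq_derive.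
  apply: filterS (open_nbhs_nbhs (conj oW Wq)) => _ [p [[Up cp] ip] <-] /=.
  by rewrite /phi coordK // coordK.
by rewrite E; apply: eq_bigr => l _; rewrite mulrC /phi coordK.
Qed.

End AtPoint.

Lemma pd_xcoord c q j k : cdom c q -> pd c j (xcoord c k) q = (j == k)%:R.
Proof.
move=> cq; have Aq : (coord c @` cdom c) (coord c q) by exists q.
transitivity ('D_(delta_mx 0 j) (fun x : 'rV[R]_n => x 0 k) (coord c q)).
  apply: near_eq_derive.
  apply: filterS (open_nbhs_nbhs (conj (@coord_open _ _ P c) Aq)) => x Ax.
  by rewrite /= /xcoord icoordK.
have dc := differentiable_coord (coord c q) (0 : 'I_1) k.
rewrite (@deriveE _ _ _ (fun x : 'rV[R]_n => x 0 k)) //.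
rewrite (_ : 'd _ _ = (fun x : 'rV[R]_n => x 0 k) :> (_ -> _)).
  by rewrite /= mxE eqxx eq_sym.
have lin : linear (fun x : 'rV[R]_n => x 0 k) by move=> a u v; rewrite !mxE.
pose aux := GRing.isLinear.Build _ _ _ _ _ lin.
pose L : {linear 'rV[R]_n -> R} := HB.pack (fun x : 'rV[R]_n => x 0 k) aux.
have cL : continuous (fun x : 'rV[R]_n => x 0 k) by exact: matrix_normedtype.coord_continuous.
exact: (@diff_lin _ _ _ L _ cL).
Qed.

Lemma smooth_xcoord c k : smooth_on (cdom c) (xcoord c k).
Proof.
move=> i m; have := transition_smooth i c k m; apply: Ck_subset.
by rewrite setIC.
Qed.

Lemma smooth_pd U c f j : open U -> U `<=` cdom c -> smooth_on U f ->
  smooth_on U (pd c j f).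
Proof.
move=> oU Uc sf; apply: (smooth_chart oU Uc) => k.
have oc : open (coord c @` U).
  by have := open_coord_image (i := c) oU; rewrite (setIidl Uc).
have [_ /(_ j)[_ C]] := smooth_in_chart Uc sf k.+1.
apply: (Ck_ext oc _ C) => _ [p Up <-] /=.
by rewrite /pd coordK //; exact: Uc.
Qed.

End SmoothFunctions.

(** * Vector fields and their components in a fixed chart *)

Section VectorFields.
Variables (R : realType) (n : nat) (P : manifold R n).
Implicit Types (U V W : set P) (f g : P -> R) (c i : chart P) (p q : P).
Implicit Types (X Y : vfield P) (a b : covfield P).

(** Components of [X] in the fixed chart [c]. Unlike those of [X q], which refer to [chart_at q],
    they are smooth in [q] when [X] is. *)
Definition vcoord c X q : 'rV[R]_n := \row_k vderiv X (xcoord c k) q.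

(** Change of basis from [chart_at q] to [c]; on the domain of [c] its inverse is [frames c q]. *)
Definition jac c q : 'M[R]_n :=
  \matrix_(j, k) pd (chart_at q) j (xcoord c k) q.

Definition frames c q : 'M[R]_n := \matrix_j frame c j q.

Lemma vderiv_pd_at X f q :
  vderiv X f q = \sum_j X q 0 j * pd (chart_at q) j f q.
Proof.
by rewrite /vderiv /pairing mxE; apply: eq_bigr => j _; rewrite mxE.
Qed.

Lemma vcoordE c X q : vcoord c X q = X q *m jac c q.
Proof.
apply/rowP => k; rewrite !mxE vderiv_pd_at.
by apply: eq_bigr => j _; rewrite mxE.
Qed.

Lemma frameE c j k q : frame c j q 0 k = pd c j (xcoord (chart_at q) k) q.
Proof. by rewrite mxE. Qed.

Lemma frames_jac c q : cdom c q -> frames c q *m jac c q = 1%:M.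
Proof.
move=> cq; apply/matrixP => j k; rewrite !mxE.
have qq := mem_cdom_chart_at q.
rewrite -(pd_xcoord j k cq).
have := pd_chain (@open_cdom _ _ P c) cq qq (i := c) (f := xcoord c k) j cq.
move=> ->; last exact: smooth_xcoord.
by apply: eq_bigr => l _; rewrite !mxE.
Qed.

Lemma jac_frames c q : cdom c q -> jac c q *m frames c q = 1%:M.
Proof. by move=> /frames_jac /mulmx1C. Qed.

Lemma vcoord_frames c X q : cdom c q -> X q = vcoord c X q *m frames c q.
Proof. by move=> cq; rewrite vcoordE -mulmxA jac_frames // mulmx1. Qed.

Lemma jac_chart_at p : jac (chart_at p) p = 1%:M.
Proof.
apply/matrixP => j k; rewrite !mxE pd_xcoord //; exact: mem_cdom_chart_at.
Qed.

Lemma frames_chart_at p : frames (chart_at p) p = 1%:M.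
Proof.
have := frames_jac (mem_cdom_chart_at p).
by rewrite jac_chart_at mulmx1.
Qed.

Lemma vcoord_chart_at X p : vcoord (chart_at p) X p = X p.
Proof. by rewrite vcoordE jac_chart_at mulmx1. Qed.

Lemma row_frames c j q : row j (frames c q) = frame c j q.
Proof. by apply/rowP => k; rewrite !mxE. Qed.

Lemma vderiv_pd U c X f q : open U -> U q -> cdom c q -> smooth_on U f ->
  vderiv X f q = \sum_k vcoord c X q 0 k * pd c k f q.
Proof.
move=> oU Uq cq sf; rewrite vderiv_pd_at.
under [LHS]eq_bigr => j _ do rewrite
  (pd_chain oU Uq cq j (mem_cdom_chart_at q) sf) mulr_sumr.
rewrite exchange_big /=; apply: eq_bigr => k _.
rewrite mxE vderiv_pd_at mulr_suml.
by apply: eq_bigr => j _; rewrite mulrA.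
Qed.

Lemma vderiv_frame U c j f q : open U -> U q -> cdom c q -> smooth_on U f ->
  vderiv (frame c j) f q = pd c j f q.
Proof.
move=> oU Uq cq sf; rewrite vderiv_pd_at.
rewrite (pd_chain oU Uq (mem_cdom_chart_at q) j cq sf).
by apply: eq_bigr => l _; rewrite frameE.
Qed.

Lemma vsmooth_coord U c X k : open U -> U `<=` cdom c -> vsmooth_on U X ->
  smooth_on U (fun q => vcoord c X q 0 k).
Proof.
move=> oU Uc sX; have := sX c k; rewrite (setIidl Uc).
by apply: smooth_ext => // q _; rewrite mxE.
Qed.

Lemma smooth_vderiv U X f : open U -> vsmooth_on U X -> smooth_on U f ->
  smooth_on U (vderiv X f).
Proof.
move=> oU sX sf; apply: smooth_local => p Up; pose c := chart_at p.
have oW : open (U `&` cdom c) by exact: open_setI_cdom.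
have Wc : U `&` cdom c `<=` cdom c by move=> ? [].
have WU : U `&` cdom c `<=` U by move=> ? [].
exists (U `&` cdom c); split=> //; first by split=> //; exact: mem_cdom_chart_at.
have H k : smooth_on (U `&` cdom c) (fun q => vcoord c X q 0 k * pd c k f q).
  apply: smoothM => //.
    by apply: vsmooth_coord => //; exact: vsmooth_on_subset sX.
  by apply: smooth_pd => //; exact: smooth_on_subset sf.
have := smooth_sum (index_enum _) oW H.
by apply: smooth_ext => // q [Uq cq]; rewrite (vderiv_pd _ oU Uq cq sf).
Qed.

(** Whereas [vsmooth_on] tests all charts, one chart around each point is enough: the other
    components are combinations of the given ones with derivatives of transition functions. *)
Lemma vsmooth_chart U X : open U ->
  (forall p, U p -> exists c W, [/\ open W, W p, W `<=` cdom c &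
     forall k, smooth_on W (fun q => vcoord c X q 0 k)]) ->
  vsmooth_on U X.
Proof.
move=> oU H i k; apply: smooth_local => p [Up ip].
have [c [W [oW Wp Wc sX]]] := H p Up.
have oWi : open (W `&` cdom i) by exact: open_setI_cdom.
exists (W `&` cdom i); split=> //.
have WiW : W `&` cdom i `<=` W by move=> ? [].
have Wii : W `&` cdom i `<=` cdom i by move=> ? [].
have sx : smooth_on (W `&` cdom i) (xcoord i k).
  by apply: smooth_on_subset (smooth_xcoord i k).
have F l : smooth_on (W `&` cdom i)
    (fun q => vcoord c X q 0 l * pd c l (xcoord i k) q).
  apply: smoothM => //; first exact: smooth_on_subset (sX l).
  by apply: smooth_pd => // q /WiW /Wc.
have := smooth_sum (index_enum _) oWi F.
apply: smooth_ext => // q Wq.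
by rewrite (vderiv_pd _ oWi Wq (Wc _ (WiW _ Wq)) sx).
Qed.

Lemma vcoord_frame c j q : cdom c q -> vcoord c (frame c j) q = delta_mx 0 j.
Proof.
move=> cq; rewrite vcoordE -row_frames -row_mul frames_jac //.
by rewrite row1.
Qed.

Lemma vsmooth_frame c j : vsmooth_on (cdom c) (frame c j).
Proof.
apply: vsmooth_chart; first exact: open_cdom.
move=> p cp; exists c, (cdom c); split=> //; first exact: open_cdom.
move=> k; have := smooth_cst (cdom c) ((delta_mx 0 j : 'rV[R]_n) 0 k).
by apply: smooth_ext => [|q cq]; [exact: open_cdom | rewrite vcoord_frame].
Qed.

Section Derivation.
Variables (U : set P) (q : P) (X : vfield P).
Hypotheses (oU : open U) (Uq : U q).

Lemma vderiv_local f g : (forall p, U p -> f p = g p) ->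
  vderiv X f q = vderiv X g q.
Proof using oU Uq.
move=> fg; rewrite !vderiv_pd_at; apply: eq_bigr => j _.
by rewrite (pd_local oU Uq (mem_cdom_chart_at q) j fg).
Qed.

Lemma vderivM f g : smooth_on U f -> smooth_on U g ->
  vderiv X (fun p => f p * g p) q = f q * vderiv X g q + g q * vderiv X f q.
Proof using oU Uq.
move=> sf sg; rewrite !vderiv_pd_at !mulr_sumr -big_split /=.
apply: eq_bigr => j _.
by rewrite (pdM oU Uq (mem_cdom_chart_at q) j sf sg); ring.
Qed.

Lemma vderivD f g : smooth_on U f -> smooth_on U g ->
  vderiv X (fun p => f p + g p) q = vderiv X f q + vderiv X g q.
Proof using oU Uq.
move=> sf sg; have := vderiv_lin X 1 oU Uq sf sg; rewrite mul1r => <-.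
by apply: vderiv_local => p _; rewrite mul1r.
Qed.

Lemma vderiv_cst (r : R) : vderiv X (fun=> r) q = 0.
Proof.
by rewrite vderiv_pd_at big1 // => j _; rewrite /pd derive_cst mulr0.
Qed.

Lemma vderivZ (r : R) f : smooth_on U f ->
  vderiv X (fun p => r * f p) q = r * vderiv X f q.
Proof using oU Uq.
move=> sf; rewrite vderivM //; last exact: smooth_cst.
by rewrite vderiv_cst mulr0 addr0.
Qed.

Lemma vderivN f : smooth_on U f -> vderiv X (fun p => - f p) q = - vderiv X f q.
Proof using oU Uq.
move=> sf; rewrite -mulN1r -(vderivZ _ sf).
by apply: vderiv_local => p _; rewrite mulN1r.
Qed.

Lemma vderivB f g : smooth_on U f -> smooth_on U g ->
  vderiv X (fun p => f p - g p) q = vderiv X f q - vderiv X g q.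
Proof using oU Uq.
by move=> sf sg; rewrite vderivD //; [rewrite vderivN | exact: smoothN].
Qed.

Lemma vderiv_sum (I : Type) (s : seq I) (F : I -> P -> R) :
  (forall m, smooth_on U (F m)) ->
  vderiv X (fun p => \sum_(m <- s) F m p) q = \sum_(m <- s) vderiv X (F m) q.
Proof using oU Uq.
move=> sF; elim: s => [|j s IHs].
  rewrite big_nil -[RHS](vderiv_cst 0).
  by apply: vderiv_local => p _; rewrite big_nil.
rewrite big_cons -IHs -vderivD //; last exact: smooth_sum.
by apply: vderiv_local => p _; rewrite big_cons.
Qed.

Lemma vderiv_ln f : 0 < f q -> smooth_on U f ->
  vderiv X (fun p => ln (f p)) q = (f q)^-1 * vderiv X f q.
Proof using oU Uq.
move=> f0 sf; rewrite !vderiv_pd_at mulr_sumr; apply: eq_bigr => j _.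
by rewrite (pd_ln oU Uq (mem_cdom_chart_at q) j f0 sf) mulrCA.
Qed.

End Derivation.

(** The definition of the bracket tests it on the coordinates of [chart_at q] only; here [f] is
    arbitrary. *)
Lemma vderiv_lie_bracket U X Y f q : open U -> U q ->
  vsmooth_on U X -> vsmooth_on U Y -> smooth_on U f ->
  vderiv (lie_bracket X Y) f q =
    vderiv X (vderiv Y f) q - vderiv Y (vderiv X f) q.
Proof.
move=> oU Uq sX sY sf; set c := chart_at q.
pose W := U `&` cdom c.
have oW : open W by exact: open_setI_cdom.
have Wc : W `<=` cdom c by move=> ? [].
have WU : W `<=` U by move=> ? [].
have cq : cdom c q by exact: mem_cdom_chart_at.
have Wq : W q by [].
have sfW : smooth_on W f by exact: smooth_on_subset sf.
have spd k : smooth_on W (pd c k f) by exact: smooth_pd.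
(* The first sum differentiates the components of [Z']; the second is the Hessian of [f], symmetric
   in [Z] and [Z'], and drops out of the commutator. *)
have second Z Z' : vsmooth_on U Z' ->
    vderiv Z (vderiv Z' f) q =
    \sum_k vderiv Z (fun p => vcoord c Z' p 0 k) q * pd c k f q +
    \sum_k \sum_l vcoord c Z' q 0 k * (vcoord c Z q 0 l * pd c l (pd c k f) q).
  move=> sZ'; have sc k : smooth_on W (fun p => vcoord c Z' p 0 k).
    by apply: vsmooth_coord => //; exact: vsmooth_on_subset sZ'.
  rewrite (@vderiv_local W q Z oW Wq (vderiv Z' f)
    (fun p => \sum_k vcoord c Z' p 0 k * pd c k f p)); last first.
    by move=> p [Up cp]; rewrite (vderiv_pd _ oU Up cp sf).
  rewrite (vderiv_sum _ oW Wq) => [|k]; last exact: smoothM.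
  rewrite -big_split /=; apply: eq_bigr => k _.
  rewrite (vderivM Z oW Wq (sc k) (spd k)) addrC; congr (_ + _).
    by rewrite (vderiv_pd Z oW Wq cq (spd k)) mulr_sumr.
  by rewrite mulrC.
have vl Z Z' k : vderiv Z (fun p => vcoord c Z' p 0 k) q =
    vderiv Z (vderiv Z' (xcoord c k)) q.
  by apply: (vderiv_local Z oU Uq) => p _; rewrite mxE.
rewrite !second // (vderiv_pd _ oW Wq cq sfW).
under eq_bigr => k _ do rewrite vcoord_chart_at mxE -/c -!vl mulrBl.
rewrite sumrB opprD addrACA -[LHS]addr0; congr (_ + _).
apply/esym/eqP; rewrite subr_eq0 exchange_big; apply/eqP.
apply: eq_bigr => k _; apply: eq_bigr => l _.
by rewrite (pd_comm oW Wq cq k l sfW) mulrCA.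
Qed.

End VectorFields.

(** * Poisson calculus in a chart *)

Section PoissonCalculus.
Variables (R : realType) (n : nat) (P : manifold R n) (Pi : poisson P).
Implicit Types (U V W : set P) (f g h : P -> R) (c : chart P) (p q : P).
Implicit Types (X Y : vfield P) (a b : covfield P).

Definition acoord c a q : 'cV[R]_n := \col_j pairing (frame c j q) (a q).

Lemma acoordE c a q : acoord c a q = frames c q *m a q.
Proof.
by apply/colP => j; rewrite mxE /pairing -row_frames -row_mul mxE.
Qed.

Lemma pairing_sum (v : 'rV[R]_n) (w : 'cV[R]_n) :
  pairing v w = \sum_k v 0 k * w k 0.
Proof. by rewrite /pairing mxE. Qed.

Lemma pairing_coord c X a q : cdom c q ->
  pairing (X q) (a q) = \sum_k vcoord c X q 0 k * acoord c a q k 0.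
Proof.
move=> cq; rewrite -pairing_sum acoordE {1}(vcoord_frames X cq).
by rewrite /pairing mulmxA.
Qed.

Lemma smooth_acoord U c a j : open U -> U `<=` cdom c -> covsmooth_on U a ->
  smooth_on U (fun q => acoord c a q j 0).
Proof.
move=> oU Uc sa; have := sa U (frame c j) oU (@subset_refl _ _).
move=> /(_ (vsmooth_on_subset Uc (vsmooth_frame c j))).
by apply: smooth_ext => // q _; rewrite mxE.
Qed.

Lemma covsmooth_dfun U f : open U -> smooth_on U f -> covsmooth_on U (dfun f).
Proof.
move=> oU sf V X oV VU sX; apply: (smooth_vderiv oV sX).
exact: smooth_on_subset sf.
Qed.

Lemma covsmooth_subset U V a : V `<=` U -> covsmooth_on U a -> covsmooth_on V a.
Proof.
by move=> VU sa W X oW WV; apply: sa => //; exact: subset_trans VU.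
Qed.

Lemma vsmooth_sharp U a : open U -> covsmooth_on U a -> vsmooth_on U (sharp Pi a).
Proof.
move=> oU sa i k; have oUi : open (U `&` cdom i) by exact: open_setI_cdom.
apply: (@biv_smooth _ _ _ Pi (U `&` cdom i) a (dfun (xcoord i k))) => //.
  by apply: covsmooth_subset sa => ? [].
apply: covsmooth_dfun => //; apply: smooth_on_subset (smooth_xcoord i k).
by move=> ? [].
Qed.

Lemma tangent_sharp U a : open U -> covsmooth_on U a ->
  tangent_on Pi U (sharp Pi a).
Proof.
by move=> oU sa; split=> [|p _]; [exact: vsmooth_sharp | exact: submxMl].
Qed.

Definition ham f : vfield P := sharp Pi (dfun f).

Lemma vsmooth_ham U f : open U -> smooth_on U f -> vsmooth_on U (ham f).
Proof. by move=> oU sf; apply: vsmooth_sharp => //; exact: covsmooth_dfun. Qed.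

Lemma tangent_ham U f : open U -> smooth_on U f -> tangent_on Pi U (ham f).
Proof. by move=> oU sf; apply: tangent_sharp => //; exact: covsmooth_dfun. Qed.

Lemma pairing_sharpC p (a b : 'cV[R]_n) :
  pairing (sharp_at Pi p a) b = - pairing (sharp_at Pi p b) a.
Proof.
rewrite /pairing /sharp_at -[LHS]/((a^T *m Pi p *m b) 0 0).
have -> : a^T *m Pi p *m b = (b^T *m (Pi p)^T *m a)^T.
  by rewrite !trmx_mul !trmxK mulmxA.
by rewrite biv_skew mulmxN mulNmx !mxE.
Qed.

Lemma vderiv_hamC f g q : vderiv (ham f) g q = - vderiv (ham g) f q.
Proof. exact: pairing_sharpC. Qed.

Section AtPoint.
Variables (U : set P) (q : P).
Hypotheses (oU : open U) (Uq : U q).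

(** Skew-symmetry turns the cyclic Jacobi identity into [X_f, X_g] = X_{X_f g}, tested on [h]. *)
Lemma ham_jacobi f g h : smooth_on U f -> smooth_on U g -> smooth_on U h ->
  vderiv (ham f) (vderiv (ham g) h) q - vderiv (ham g) (vderiv (ham f) h) q =
  vderiv (ham (vderiv (ham f) g)) h q.
Proof.
move=> sf sg sh; have J := @biv_jacobi _ _ _ Pi U f g h oU sf sg sh q Uq.
rewrite -[X in X + _ + _]/(vderiv (ham f) (vderiv (ham g) h) q) in J.
rewrite -[X in _ + X + _]/(vderiv (ham g) (vderiv (ham h) f) q) in J.
rewrite -[X in _ + _ + X]/(vderiv (ham h) (vderiv (ham f) g) q) in J.
rewrite [vderiv (ham h) (vderiv _ _) q]vderiv_hamC in J.
rewrite (@vderiv_local _ _ _ U q (ham g) oU Uq (vderiv (ham h) f)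
  (fun p => - vderiv (ham f) h p)) in J; last first.
  by move=> p _; exact: vderiv_hamC.
rewrite (vderivN _ oU Uq) in J; first by move/subr0_eq: J.
by apply: smooth_vderiv => //; exact: vsmooth_ham.
Qed.

End AtPoint.

(** Poisson brackets of the coordinate functions of [c]: the matrix of the bivector in a fixed
    chart, smooth in [q]. *)
Definition bivc c q : 'M[R]_n :=
  \matrix_(j, k) vderiv (ham (xcoord c j)) (xcoord c k) q.

Lemma bivcE c q : bivc c q = (jac c q)^T *m Pi q *m jac c q.
Proof.
have E k : dfun (xcoord c k) q = col k (jac c q).
  by apply/colP => j; rewrite !mxE.
apply/matrixP => j k; rewrite mxE /vderiv /pairing /ham /sharp /sharp_at !E.
by rewrite tr_col -!row_mul [col k _]colE mulmxA -colE !mxE.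
Qed.

Lemma biv_bivc c q : cdom c q ->
  Pi q = (frames c q)^T *m bivc c q *m frames c q.
Proof.
move=> cq; rewrite bivcE !mulmxA -trmx_mul jac_frames // trmx1 mul1mx.
by rewrite -mulmxA jac_frames // mulmx1.
Qed.

Lemma bivc_chart_at q : bivc (chart_at q) q = Pi q.
Proof. by rewrite bivcE jac_chart_at trmx1 mul1mx mulmx1. Qed.

Lemma bivcC c j k q : bivc c q j k = - bivc c q k j.
Proof. by rewrite !mxE vderiv_hamC. Qed.

Lemma smooth_bivc c j k : smooth_on (cdom c) (fun q => bivc c q j k).
Proof.
have oc := @open_cdom _ _ P c.
have : smooth_on (cdom c) (vderiv (ham (xcoord c j)) (xcoord c k)).
  apply: smooth_vderiv => //; last exact: smooth_xcoord.
  by apply: vsmooth_ham => //; exact: smooth_xcoord.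
by apply: smooth_ext => // q _; rewrite mxE.
Qed.

Lemma vcoord_sharp c a q : cdom c q ->
  vcoord c (sharp Pi a) q = (acoord c a q)^T *m bivc c q.
Proof.
move=> cq; rewrite vcoordE acoordE bivcE trmx_mul !mulmxA.
by rewrite -[_ *m (frames c q)^T *m _]mulmxA -trmx_mul jac_frames // trmx1 mulmx1.
Qed.

Lemma acoord_dfun U c f q j : open U -> U q -> cdom c q -> smooth_on U f ->
  acoord c (dfun f) q j 0 = pd c j f q.
Proof. by move=> oU Uq cq sf; rewrite mxE -(vderiv_frame j oU Uq cq sf). Qed.

Lemma vderiv_sharp U c a f q : open U -> U q -> cdom c q -> smooth_on U f ->
  vderiv (sharp Pi a) f q =
  \sum_j acoord c a q j 0 * vderiv (ham (xcoord c j)) f q.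
Proof.
move=> oU Uq cq sf; rewrite (vderiv_pd _ oU Uq cq sf).
under [RHS]eq_bigr => j _ do rewrite (vderiv_pd _ oU Uq cq sf) mulr_sumr.
rewrite exchange_big /=; apply: eq_bigr => k _.
rewrite vcoord_sharp // mxE mulr_suml; apply: eq_bigr => j _.
by rewrite !mxE mulrA.
Qed.

Lemma vderiv_vcoord_sharp W c a Z q k : open W -> W q -> W `<=` cdom c ->
  covsmooth_on W a ->
  vderiv Z (fun p => vcoord c (sharp Pi a) p 0 k) q =
  \sum_i (acoord c a q i 0 * vderiv Z (fun p => bivc c p i k) q +
          bivc c q i k * vderiv Z (fun p => acoord c a p i 0) q).
Proof.
move=> oW Wq Wc sa.
have sA i : smooth_on W (fun p => acoord c a p i 0) by exact: smooth_acoord.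
have sM i : smooth_on W (fun p => bivc c p i k).
  exact: smooth_on_subset (smooth_bivc c i k).
rewrite (@vderiv_local _ _ _ W q Z oW Wq _
  (fun p => \sum_i acoord c a p i 0 * bivc c p i k)); last first.
  move=> p Wp; rewrite vcoord_sharp ?mxE; last exact: Wc.
  by apply: eq_bigr => i _; rewrite !mxE.
rewrite (vderiv_sum _ oW Wq) => [|i]; last exact: smoothM.
by apply: eq_bigr => i _; rewrite (vderivM _ oW Wq).
Qed.

(** The bracket term changes sign because a coordinate field has constant components: [X, d/dx_l] is
    minus the l-th derivative of X. *)
Lemma covLie_coord W X b q l : open W -> W q -> W `<=` cdom (chart_at q) ->
  vsmooth_on W X -> covsmooth_on W b ->
  covLie X b q l 0 = vderiv X (fun p => acoord (chart_at q) b p l 0) q +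
    \sum_k vderiv (frame (chart_at q) l) (fun p => vcoord (chart_at q) X p 0 k) q
      * acoord (chart_at q) b q k 0.
Proof.
set c := chart_at q => oW Wq Wc sX sb; rewrite mxE -/c.
have -> : (fun p => pairing (frame c l p) (b p)) = (fun p => acoord c b p l 0).
  by apply/funext => p; rewrite mxE.
congr (_ + _); rewrite pairing_sum -sumrN; apply: eq_bigr => k _.
rewrite -mulNr acoordE frames_chart_at mul1mx; congr (_ * _).
rewrite mxE -/c (@vderiv_local _ _ _ W q X oW Wq _ (fun=> (l == k)%:R)).
  rewrite vderiv_cst sub0r opprK.
  by apply: (vderiv_local _ oW Wq) => p _; rewrite mxE.
move=> p /Wc cp; rewrite (vderiv_frame _ (@open_cdom _ _ P c) cp cp).
  by rewrite pd_xcoord.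
exact: smooth_xcoord.
Qed.

Lemma cobracket_coord W a b q l : open W -> W q -> W `<=` cdom (chart_at q) ->
  covsmooth_on W a -> covsmooth_on W b ->
  cobracket Pi a b q l 0 =
    vderiv (sharp Pi a) (fun p => acoord (chart_at q) b p l 0) q
    - vderiv (sharp Pi b) (fun p => acoord (chart_at q) a p l 0) q
    + \sum_i \sum_j acoord (chart_at q) a q i 0 * (acoord (chart_at q) b q j 0
        * vderiv (frame (chart_at q) l) (fun p => bivc (chart_at q) p i j) q).
Proof.
set c := chart_at q => oW Wq Wc sa sb.
have sX := vsmooth_sharp oW sa; have sY := vsmooth_sharp oW sb.
have cq : cdom c q by exact: Wc.
have sA i : smooth_on W (fun p => acoord c a p i 0) by exact: smooth_acoord.
have sB i : smooth_on W (fun p => acoord c b p i 0) by exact: smooth_acoord.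
have sXk k : smooth_on W (fun p => vcoord c (sharp Pi a) p 0 k).
  exact: vsmooth_coord.
have -> : cobracket Pi a b q l 0 =
    covLie (sharp Pi a) b q l 0 - covLie (sharp Pi b) a q l 0
    - partial q l (fun p => pairing (sharp Pi a p) (b p)).
  by rewrite !mxE.
rewrite (covLie_coord l oW Wq Wc sX sb) (covLie_coord l oW Wq Wc sY sa) -/c.
have sXb : smooth_on W (fun p => pairing (sharp Pi a p) (b p)).
  by apply: sb => //.
rewrite -[partial q l _]/(pd c l _ q) -(vderiv_frame l oW Wq cq sXb).
rewrite (@vderiv_local _ _ _ W q (frame c l) oW Wq _
  (fun p => \sum_k vcoord c (sharp Pi a) p 0 k * acoord c b p k 0)); last first.
  by move=> p /Wc cp; exact: pairing_coord.
rewrite (vderiv_sum _ oW Wq) => [|k]; last exact: smoothM.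
under [X in _ - X]eq_bigr => k _ do
  rewrite (vderivM _ oW Wq (sXk k) (sB k)) [acoord c b q k 0 * _]mulrC.
rewrite [X in _ - X]big_split /=.
under [X in _ - (X + _)]eq_bigr => k _ do
  rewrite vcoord_sharp // mxE mulr_suml.
under [X in _ - (_ + X) - _]eq_bigr => k _ do
  rewrite (vderiv_vcoord_sharp _ k oW Wq Wc sb) mulr_suml.
set S := \sum_k vderiv _ _ _ * _; set T := \sum_k \sum_i _ * _.
set T' := \sum_k \sum_i _ * _; set Q := \sum_i \sum_j _.
(* [S], which carries the derivatives of [a], has cancelled against itself. In [T + T'] the
   derivatives of [b] cancel by skew-symmetry of [bivc], leaving the derivative of the bivector. *)
suff TQ : T + T' = - Q.
  set x := vderiv (sharp Pi a) _ q; set y := vderiv (sharp Pi b) _ q.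
  by rewrite -[Q]opprK -TQ; clearbody x y S T T' Q; ring.
have sM i j : smooth_on W (fun p => bivc c p i j).
  exact: smooth_on_subset (smooth_bivc c i j).
rewrite /T' exchange_big /T /Q -sumrN -big_split /=; apply: eq_bigr => i _.
rewrite -sumrN -big_split /=; apply: eq_bigr => j _.
rewrite (@vderiv_local _ _ _ W q (frame c l) oW Wq (fun p => bivc c p j i)
  (fun p => - bivc c p i j)); last by move=> p _; rewrite bivcC.
rewrite (vderivN _ oW Wq) // [bivc c q j i]bivcC [(_^T) 0 i]mxE.
by rewrite !mulrN !mulNr; ring.
Qed.

(** In a chart the terms with derivatives of [a] and [b] agree on both sides. The rest is bilinear
    in the values of [a] and [b], so that the Jacobi identity for coordinate functions settles
    it. *)
Lemma sharp_cobracket U a b q : open U -> U q ->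
  covsmooth_on U a -> covsmooth_on U b ->
  sharp Pi (cobracket Pi a b) q = lie_bracket (sharp Pi a) (sharp Pi b) q.
Proof.
set c := chart_at q => oU Uq sa' sb'; pose W := U `&` cdom c.
have oW : open W by exact: open_setI_cdom.
have Wc : W `<=` cdom c by move=> ? [].
have cq : cdom c q by exact: mem_cdom_chart_at.
have Wq : W q by [].
have sa : covsmooth_on W a by apply: covsmooth_subset sa' => ? [].
have sb : covsmooth_on W b by apply: covsmooth_subset sb' => ? [].
have sM i j : smooth_on W (fun p => bivc c p i j).
  exact: smooth_on_subset (smooth_bivc c i j).
have sx k : smooth_on W (xcoord c k) by exact: smooth_on_subset (smooth_xcoord c k).
apply/rowP => k; rewrite [RHS]mxE -/c.
have vl e e' : vderiv (sharp Pi e) (vderiv (sharp Pi e') (xcoord c k)) q =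
    vderiv (sharp Pi e) (fun p => vcoord c (sharp Pi e') p 0 k) q.
  by apply: (vderiv_local _ oW Wq) => p _; rewrite mxE.
rewrite !vl (vderiv_vcoord_sharp _ k oW Wq Wc sa).
rewrite (vderiv_vcoord_sharp _ k oW Wq Wc sb) -/c.
under [X in X - _]eq_bigr => j _ do
  rewrite (vderiv_sharp a oW Wq cq (sM j k)) mulr_sumr.
under [X in _ - X]eq_bigr => j _ do
  rewrite (vderiv_sharp b oW Wq cq (sM j k)) mulr_sumr.
rewrite -[sharp Pi _ q]/((cobracket Pi a b q)^T *m Pi q) [LHS]mxE.
under [LHS]eq_bigr => l _ do
  rewrite [(_^T) _ _]mxE (cobracket_coord l oW Wq Wc sa sb) -/c.
rewrite -bivc_chart_at -/c.
(* The Jacobi identity for x_i, x_j, x_k, with the Hamiltonian field of {x_i, x_j} expanded in the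
   chart. *)
have K i j : vderiv (ham (xcoord c i)) (fun p => bivc c p j k) q
    - vderiv (ham (xcoord c j)) (fun p => bivc c p i k) q =
    \sum_l vderiv (frame c l) (fun p => bivc c p i j) q * bivc c q l k.
  have E i' j' : vderiv (ham (xcoord c i')) (fun p => bivc c p j' k) q =
      vderiv (ham (xcoord c i')) (vderiv (ham (xcoord c j')) (xcoord c k)) q.
    by apply: (vderiv_local _ oW Wq) => p _; rewrite mxE.
  have sF : smooth_on W (vderiv (ham (xcoord c i)) (xcoord c j)).
    by apply: smooth_vderiv => //; exact: vsmooth_ham.
  rewrite !E (ham_jacobi oW Wq) // (vderiv_sharp _ oW Wq cq (sx k)).
  apply: eq_bigr => l _; rewrite [bivc c q l k]mxE; congr (_ * _).
  rewrite mxE; apply: (vderiv_local _ oW Wq) => p _.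
  by rewrite [in RHS]mxE.
rewrite -sumrB [in RHS](eq_bigr (fun j => bivc c q j k *
    (vderiv (sharp Pi a) (fun p => acoord c b p j 0) q
     - vderiv (sharp Pi b) (fun p => acoord c a p j 0) q) +
  ((\sum_i acoord c b q j 0 * (acoord c a q i 0 *
       vderiv (ham (xcoord c i)) (fun p => bivc c p j k) q)) -
   (\sum_i acoord c a q j 0 * (acoord c b q i 0 *
       vderiv (ham (xcoord c i)) (fun p => bivc c p j k) q)))));
  last by move=> j _; rewrite mulrBr opprD addrACA addrC.
rewrite big_split /=.
under [LHS]eq_bigr => l _ do rewrite mulrDl [_ * bivc c q l k]mulrC.
rewrite big_split /=; congr (_ + _).
rewrite sumrB [X in _ = X - _]exchange_big -sumrB /=.
under [LHS]eq_bigr => l _ do rewrite mulr_suml.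
rewrite exchange_big /=; apply: eq_bigr => i _.
under [LHS]eq_bigr => l _ do rewrite mulr_suml.
rewrite exchange_big /= -sumrB; apply: eq_bigr => j _.
under [LHS]eq_bigr => l _ do rewrite -!mulrA.
rewrite -!mulr_sumr -K; ring.
Qed.

End PoissonCalculus.

(** * Alternating forms and contraction with a bivector *)

Section AlternatingForms.
Variables (R : realType) (n : nat).
Local Notation V := 'rV[R]_n.
Local Notation e_ j := (delta_mx 0 j : 'rV[R]_n).

Definition multilin k (F : ('I_k -> V) -> R) : Prop :=
  forall w i (a : R) u v, F (set_slot w i (a *: u + v)) =
    a * F (set_slot w i u) + F (set_slot w i v).

Definition is_alternating k (F : ('I_k -> V) -> R) : Prop :=
  forall w i j, i != j -> w i = w j -> F w = 0.

Definition altform k (F : ('I_k -> V) -> R) : Prop := multilin F /\ is_alternating F.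

Lemma set_slot_id k (w : 'I_k -> V) i : set_slot w i (w i) = w.
Proof. by apply/funext => j; rewrite /set_slot; case: eqP => // ->. Qed.

Lemma set_slotK k (w : 'I_k -> V) i u v :
  set_slot (set_slot w i u) i v = set_slot w i v.
Proof. by apply/funext => j; rewrite /set_slot; case: eqP. Qed.

Lemma set_slotC k (w : 'I_k -> V) i j u v : i != j ->
  set_slot (set_slot w i u) j v = set_slot (set_slot w j v) i u.
Proof.
move=> ij; apply/funext => l; rewrite /set_slot.
by case: eqP => [->|] //; rewrite eq_sym (negbTE ij).
Qed.

Lemma set_slot_eq k (w : 'I_k -> V) i v : set_slot w i v i = v.
Proof. by rewrite /set_slot eqxx. Qed.

Lemma set_slot_neq k (w : 'I_k -> V) i j v : j != i -> set_slot w i v j = w j.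
Proof. by rewrite /set_slot => /negbTE ->. Qed.

Section Multilinear.
Variables (k : nat) (F : ('I_k -> V) -> R).
Hypothesis mF : multilin F.

Lemma multilinD w i u v :
  F (set_slot w i (u + v)) = F (set_slot w i u) + F (set_slot w i v).
Proof. by have := mF w i 1 u v; rewrite scale1r mul1r. Qed.

Lemma multilin0 w i : F (set_slot w i 0) = 0.
Proof.
have := multilinD w i 0 0; rewrite addr0 => /eqP.
by rewrite -subr_eq0 opprD addrA subrr sub0r oppr_eq0 => /eqP.
Qed.

Lemma multilinZ w i a u : F (set_slot w i (a *: u)) = a * F (set_slot w i u).
Proof. by have := mF w i a u 0; rewrite addr0 multilin0 addr0. Qed.

Lemma multilin_sum (I : Type) (s : seq I) (c : I -> R) (g : I -> V) w i :
  F (set_slot w i (\sum_(l <- s) c l *: g l)) =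
  \sum_(l <- s) c l * F (set_slot w i (g l)).
Proof.
elim: s => [|l s IHs]; first by rewrite !big_nil multilin0.
by rewrite !big_cons multilinD IHs multilinZ.
Qed.

Lemma multilinB w i u v :
  F (set_slot w i (u - v)) = F (set_slot w i u) - F (set_slot w i v).
Proof. by rewrite multilinD -scaleN1r multilinZ mulN1r. Qed.

End Multilinear.

Lemma multilin_ext k (F G : ('I_k -> V) -> R) : multilin F -> multilin G ->
  (forall K : 'I_k -> 'I_n, F (fun i => e_ (K i)) = G (fun i => e_ (K i))) ->
  F =1 G.
Proof.
move=> mF mG FG.
(* [s] lists the slots not yet known to hold basis vectors; expanding one of them in the basis
   shortens the list. *)
have H (s : seq 'I_k) w :
    (forall i, i \notin s -> exists j, w i = e_ j) -> F w = G w.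
  elim: s w => [|i s IHs] w Hw.
    have /choice[K HK] : forall i, exists j, w i = e_ j by move=> i; exact: Hw.
    have -> : w = fun i => e_ (K i) by exact/funext.
    exact: FG.
  rewrite -(set_slot_id w i) [w i]row_sum_delta !multilin_sum //.
  apply: eq_bigr => j _; congr (_ * _); apply: IHs => l ls.
  have [->|li] := eqVneq l i; first by exists j; rewrite set_slot_eq.
  by rewrite set_slot_neq //; apply: Hw; rewrite in_cons negb_or li.
move=> w; apply: (H (enum 'I_k)) => i; by rewrite mem_enum.
Qed.

Section Alternating.
Variables (k : nat) (F : ('I_k -> V) -> R).
Hypothesis aF : altform F.
Let mF : multilin F := aF.1.

(** Polarization: the form vanishes with [w i + w j] in both slots. *)
Lemma alt_tperm w i j : i != j -> F (w \o tperm i j) = - F w.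
Proof.
move=> ij; have ji : j != i by rewrite eq_sym.
pose G x y := F (set_slot (set_slot w i x) j y).
have GC x y : G x y = F (set_slot (set_slot w j y) i x) by rewrite /G set_slotC.
have G0 x : G x x = 0.
  apply: (aF.2 _ i j ij); rewrite set_slot_eq set_slot_neq //.
  by rewrite set_slot_eq.
have GDl x x' y : G (x + x') y = G x y + G x' y by rewrite !GC (multilinD mF).
have GDr x y y' : G x (y + y') = G x y + G x y' by rewrite /G (multilinD mF).
have := G0 (w i + w j); rewrite GDl !GDr !G0 add0r addr0 => /eqP.
rewrite addr_eq0 => /eqP E.
have -> : F w = G (w i) (w j) by rewrite /G set_slot_id set_slot_id.
rewrite E opprK /G; congr F; apply/funext => l /=; rewrite /set_slot.
by case: tpermP => [->|->|/eqP/negbTE-> /eqP/negbTE->//];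
  rewrite ?eqxx // (negbTE ij).
Qed.

Lemma alt_perm w (s : 'S_k) : F (w \o s) = (-1) ^+ s * F w.
Proof.
have [ts -> dts] := prod_tpermP s.
elim: ts w dts => [|t ts IHts] w /=.
  move=> _; rewrite big_nil odd_perm1 mul1r; congr F.
  by apply/funext => i /=; rewrite perm1.
move=> /andP[dt dts]; rewrite big_cons odd_permM odd_tperm dt signr_addb.
have -> : w \o (tperm t.1 t.2 * \prod_(t <- ts) tperm t.1 t.2)%g =
    (w \o (\prod_(t <- ts) tperm t.1 t.2)%g) \o tperm t.1 t.2.
  by apply/funext => i /=; rewrite permM.
by rewrite alt_tperm // IHts // expr1 mulN1r mulNr.
Qed.

End Alternating.

Definition detform (w : 'I_n -> V) : R := \det (\matrix_i w i).

Lemma detform_alt : altform detform.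
Proof.
split=> [w i a u v|w i j ij wij]; last first.
  apply: (determinant_alternate ij) => l; by rewrite !mxE wij.
transitivity (a * detform (set_slot w i u) + 1 * detform (set_slot w i v));
  last by rewrite mul1r.
apply: (determinant_multilinear (i0 := i)).
- by apply/rowP => l; rewrite !mxE /set_slot eqxx !mxE mul1r.
- by apply/matrixP => l l'; rewrite !mxE /set_slot eq_sym (negbTE (neq_lift _ _)).
- by apply/matrixP => l l'; rewrite !mxE /set_slot eq_sym (negbTE (neq_lift _ _)).
Qed.

Definition std_basis (i : 'I_n) : V := e_ i.

Lemma detform_std : detform std_basis = 1.
Proof.
rewrite /detform (_ : \matrix_i std_basis i = 1%:M) ?det1 //.
by apply/matrixP => i j; rewrite !mxE eqxx eq_sym.
Qed.

(** By multilinearity only tuples of basis vectors matter; such a tuple is a permutation of the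
    basis or has a repetition. *)
Lemma altform_det (F : ('I_n -> V) -> R) w : altform F ->
  F w = detform w * F std_basis.
Proof.
move=> aF; pose G w := F std_basis * detform w.
have [mD aD] := detform_alt.
have mG : multilin G by move=> w' i a u v; rewrite /G mD mulrDr mulrCA.
rewrite mulrC -/(G w); apply: (multilin_ext aF.1 mG) => K.
have [Kinj|] := boolP (injectiveb K).
  pose s := perm (injectiveP K Kinj).
  have -> : (fun i => e_ (K i)) = std_basis \o s.
    by apply/funext => i; rewrite /= permE.
  rewrite (alt_perm aF) /G (alt_perm detform_alt) detform_std mulr1.
  by rewrite mulrC.
move=> /injectivePn[i [j ij Kij]].
by rewrite /G (aF.2 _ i j ij) ?Kij // (aD _ i j ij) ?Kij // mulr0.
Qed.

End AlternatingForms.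

(** * Forms that vanish on a subspace *)

Section QuotientForms.
Variables (R : realType) (n m q : nat) (M : 'M[R]_(m, n)) (B : 'M[R]_(q, n)).
Hypothesis full : row_full (col_mx M B).
Implicit Types F G : ('I_q -> 'rV[R]_n) -> R.

Definition kills F : Prop := forall w i, (w i <= M)%MS -> F w = 0.

(** Modulo the row space of [M] each argument is a combination of the [q] rows of [B], so that the
    form is a multiple of the determinant of these combinations. The coefficient depends on [w]
    alone; sharing it among all forms makes any two of them comparable. *)
Lemma kills_det F w : altform F -> kills F -> exists2 d : R,
  F w = d * F (fun i => row i B) & forall G, altform G -> kills G ->
    G w = d * G (fun i => row i B).
Proof.
have /choice[c Hc] : forall i, exists c : 'rV[R]_(m + q), w i = c *m col_mx M B.
  by move=> i; apply/submxP; exact: submx_full.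
pose d i : 'rV[R]_q := rsubmx (c i).
have wd i : (w i - d i *m B <= M)%MS.
  by rewrite Hc -[c i]hsubmxK mul_row_col /d addrK submxMl.
suff H G : altform G -> kills G -> G w = detform d * G (fun i => row i B).
  by move=> aF kF; exists (detform d) => *; exact: H.
move=> [mG aG] kG.
have -> : G w = G (fun i => d i *m B).
  (* Arguments are exchanged one slot at a time; each exchange changes the argument by a vector of
     [M], which the form kills. *)
  have K (s : seq 'I_q) u v : (forall i, i \notin s -> u i = v i) ->
      (forall i, (u i - v i <= M)%MS) -> G u = G v.
    elim: s u => [|i s IHs] u uv uvM; first by congr G; apply/funext => i; exact: uv.
    rewrite -(IHs (set_slot u i (v i))); first last.
    - move=> j; have [->|ji] := eqVneq j i; first by rewrite set_slot_eq subrr sub0mx.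
      by rewrite set_slot_neq.
    - move=> j js; have [->|ji] := eqVneq j i; first by rewrite set_slot_eq.
      by rewrite set_slot_neq //; apply: uv; rewrite in_cons negb_or ji.
    rewrite -{1}(set_slot_id u i); apply/eqP; rewrite -subr_eq0.
    rewrite -(multilinB mG); apply/eqP; apply: (kG _ i).
    by rewrite set_slot_eq.
  by apply: (K (enum 'I_q)) => // i; rewrite mem_enum.
pose H (u : 'I_q -> 'rV[R]_q) := G (fun i => u i *m B).
have slot u i x : (fun j => set_slot u i x j *m B) =
    set_slot (fun j => u j *m B) i (x *m B).
  by apply/funext => j; rewrite /set_slot; case: eqP.
have aH : altform H.
  split=> [u i a x y|u i j ij uij]; last by apply: (aG _ i j ij); rewrite uij.
  by rewrite /H !slot mulmxDl -scalemxAl mG.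
rewrite -/(H d) (altform_det d aH); congr (_ * G _).
by apply/funext => i; rewrite /std_basis -rowE.
Qed.

End QuotientForms.

(** * Contraction of forms with a bivector *)

Section ListForms.
Variables (R : realType) (n : nat).
Local Notation V := 'rV[R]_n.
Local Notation e_ j := (delta_mx 0 j : 'rV[R]_n).
Implicit Types (G H : seq V -> R) (M N A B : 'M[R]_n) (s : seq V).

(** Forms are functions on lists of any length here: a contraction lowers the degree by two, and on
    lists it stays in one type and can be iterated. *)
Definition lmultilin G : Prop := forall s1 s2 (a : R) u v,
  G (s1 ++ (a *: u + v) :: s2) = a * G (s1 ++ u :: s2) + G (s1 ++ v :: s2).

Definition lalt G : Prop := forall s1 s2 s3 x, G (s1 ++ x :: s2 ++ x :: s3) = 0.

Definition lform G : Prop := lmultilin G /\ lalt G.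

Section LForm.
Variable G : seq V -> R.
Hypothesis lG : lform G.

Lemma lformD s1 s2 u v :
  G (s1 ++ (u + v) :: s2) = G (s1 ++ u :: s2) + G (s1 ++ v :: s2).
Proof. by have := lG.1 s1 s2 1 u v; rewrite scale1r mul1r. Qed.

Lemma lform0 s1 s2 : G (s1 ++ 0 :: s2) = 0.
Proof.
have := lformD s1 s2 0 0; rewrite addr0 => /eqP.
by rewrite -subr_eq0 opprD addrA subrr sub0r oppr_eq0 => /eqP.
Qed.

Lemma lform_sum (I : Type) (r : seq I) (c : I -> R) (g : I -> V) s1 s2 :
  G (s1 ++ (\sum_(l <- r) c l *: g l) :: s2) =
  \sum_(l <- r) c l * G (s1 ++ g l :: s2).
Proof.
elim: r => [|l r IHr]; first by rewrite !big_nil lform0.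
by rewrite !big_cons lG.1 IHr.
Qed.

Lemma lform_swap s1 s2 x y : G (s1 ++ x :: y :: s2) = - G (s1 ++ y :: x :: s2).
Proof.
have alt z : G (s1 ++ z :: z :: s2) = 0 by have := lG.2 s1 [::] s2 z.
have D2 u x' y' : G (s1 ++ u :: (x' + y') :: s2) =
    G (s1 ++ u :: x' :: s2) + G (s1 ++ u :: y' :: s2).
  by have := lformD (rcons s1 u) s2 x' y'; rewrite !cat_rcons.
have := alt (x + y); rewrite lformD !D2 !alt add0r addr0 => /eqP.
by rewrite addr_eq0 => /eqP.
Qed.

Lemma lform_swap2 a b c d s :
  G [:: a, b, c, d & s] = G [:: c, d, a, b & s].
Proof.
rewrite (lform_swap [:: a] (d :: s) b c) /= (lform_swap [::] _ a c) /=.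
rewrite (lform_swap [:: c; a] s b d) /= (lform_swap [:: c] (b :: s) a d) /=.
by rewrite !opprK.
Qed.

Lemma lform_mem s1 s2 x : x \in s1 -> G (s1 ++ x :: s2) = 0.
Proof.
case/splitPr => s3 s4; rewrite -catA cat_cons; exact: lG.2.
Qed.

End LForm.

(** The sum runs over all ordered pairs of indices, without the factor 1/2; hence g /\ h is inserted
    twice, the origin of the 2 in [contr_biv_of]. *)
Definition contr M G s : R :=
  \sum_a \sum_b M a b * G [:: e_ a, e_ b & s].

Lemma lform_contr M G : lform G -> lform (contr M G).
Proof.
move=> lG; split=> [s1 s2 a u v|s1 s2 s3 x].
  rewrite /contr mulr_sumr -big_split /=; apply: eq_bigr => i _.
  rewrite mulr_sumr -big_split /=; apply: eq_bigr => j _.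
  by have := lG.1 [:: e_ i, e_ j & s1] s2 a u v => /= ->; ring.
rewrite /contr big1 // => i _; rewrite big1 // => j _.
by have := lG.2 [:: e_ i, e_ j & s1] s2 s3 x => /= ->; rewrite mulr0.
Qed.

Lemma lform_iter_contr M G k : lform G -> lform (iter k (contr M) G).
Proof. by move=> lG; elim: k => //= k; exact: lform_contr. Qed.

Lemma contrD M N G s : contr (M + N) G s = contr M G s + contr N G s.
Proof.
rewrite /contr -big_split; apply: eq_bigr => i _.
by rewrite -big_split; apply: eq_bigr => j _; rewrite mxE mulrDl.
Qed.

Lemma contrN M G s : contr (- M) G s = - contr M G s.
Proof.
rewrite /contr -sumrN; apply: eq_bigr => i _.
by rewrite -sumrN; apply: eq_bigr => j _; rewrite mxE mulNr.
Qed.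

Lemma contr_tensor (g h : V) G s : lform G ->
  contr (g^T *m h) G s = G [:: g, h & s].
Proof.
move=> lG; rewrite [g in RHS]row_sum_delta.
rewrite (lform_sum lG _ _ _ [::]) /contr; apply: eq_bigr => a _ /=.
rewrite [h in RHS]row_sum_delta (lform_sum lG _ _ _ [:: e_ a]) mulr_sumr.
apply: eq_bigr => b _ /=.
by rewrite mxE big_ord1 mxE mulrA.
Qed.

Lemma contr_ext M G H s : G =1 H -> contr M G s = contr M H s.
Proof.
move=> GH; apply: eq_bigr => i _; apply: eq_bigr => j _.
by rewrite GH.
Qed.

Lemma contr_lin M G H a s :
  contr M (fun t => a * G t + H t) s = a * contr M G s + contr M H s.
Proof.
rewrite /contr mulr_sumr -big_split; apply: eq_bigr => i _.
by rewrite mulr_sumr -big_split; apply: eq_bigr => j _ /=; ring.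
Qed.

Lemma contrZ M G a s : contr M (fun t => a * G t) s = a * contr M G s.
Proof.
rewrite /contr mulr_sumr; apply: eq_bigr => i _.
by rewrite mulr_sumr; apply: eq_bigr => j _ /=; ring.
Qed.

(** Lets an identity known in top degree only pass through contractions: [k] of them evaluate the
    form on lists that are longer by 2k. *)
Lemma iter_contr_size M G H k l : (forall t, size t = l -> G t = H t) ->
  forall s, (k.*2 + size s)%N = l -> iter k (contr M) G s = iter k (contr M) H s.
Proof.
move=> GH; elim: k => [|k IHk] s /= sN; first exact: GH.
apply: eq_bigr => i _; apply: eq_bigr => j _; rewrite IHk //=.
by rewrite -sN doubleS /= !addnS.
Qed.

Lemma iter_contrZ M G a k s :
  iter k (contr M) (fun t => a * G t) s = a * iter k (contr M) G s.
Proof.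
elim: k s => //= k IHk s; rewrite -contrZ; apply: contr_ext => t; exact: IHk.
Qed.

Definition biv_of (ps : seq (V * V)) : 'M[R]_n :=
  \sum_(p <- ps) (p.1^T *m p.2 - p.2^T *m p.1).

(** The head pair comes last, next to the remaining arguments, which is the order in which
    [iter_contr_cons] peels the pairs off. *)
Fixpoint flat (ps : seq (V * V)) : seq V :=
  if ps is p :: ps' then flat ps' ++ [:: p.1; p.2] else [::].

Lemma size_flat ps : size (flat ps) = (size ps).*2.
Proof. by elim: ps => //= p ps IH; rewrite size_cat IH addn2. Qed.

Lemma mem_flat ps p : p \in ps -> (p.1 \in flat ps) && (p.2 \in flat ps).
Proof.
elim: ps => //= q ps IH; rewrite in_cons => /orP[/eqP <-|/IH /andP[a b]].
  by rewrite !mem_cat !inE !eqxx !orbT.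
by rewrite !mem_cat a b.
Qed.

Lemma contr_biv_of ps G s : lform G ->
  contr (biv_of ps) G s = 2 * \sum_(p <- ps) G [:: p.1, p.2 & s].
Proof.
move=> lG; elim: ps => [|p ps IH].
  rewrite /biv_of !big_nil mulr0 /contr big1 // => i _.
  by rewrite big1 // => j _; rewrite mxE mul0r.
rewrite /biv_of big_cons contrD -/(biv_of ps) IH big_cons mulrDr; congr (_ + _).
rewrite contrD contrN !contr_tensor //.
have -> : G [:: p.2, p.1 & s] = - G [:: p.1, p.2 & s].
  exact: (lform_swap lG [::]).
by rewrite opprK mulr_natl mulr2n.
Qed.

(* Contractions commute and the contraction with g /\ h squares to zero. *)
Lemma iter_contr_cons p ps G k s : lform G ->
  iter k.+1 (contr (biv_of (p :: ps))) G s =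
  iter k.+1 (contr (biv_of ps)) G s +
  (2 * k.+1)%:R * iter k (contr (biv_of ps)) G [:: p.1, p.2 & s].
Proof.
move=> lG; set N := biv_of ps.
have one H t : lform H -> contr (biv_of (p :: ps)) H t =
    contr N H t + 2 * H [:: p.1, p.2 & t].
  by move=> lH; rewrite !contr_biv_of // big_cons mulrDr addrC.
have comm H t : lform H ->
    contr N (fun t' => H [:: p.1, p.2 & t']) t = contr N H [:: p.1, p.2 & t].
  move=> lH; apply: eq_bigr => i _; apply: eq_bigr => j _.
  by rewrite (lform_swap2 lH).
elim: k s => [|k IHk] s; first by rewrite /= one // mulr1.
rewrite iterS one; last exact: lform_iter_contr.
rewrite (contr_ext _ _ IHk).
rewrite [contr N _ s](_ : _ = iter k.+2 (contr N) G s + (2 * k.+1)%:R *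
    iter k.+1 (contr N) G [:: p.1, p.2 & s]); last first.
  rewrite -[iter k.+1 _ _ [:: _, _ & s]]comm; last exact: lform_iter_contr.
  rewrite addrC -contr_lin; apply: contr_ext => t; exact: addrC.
rewrite IHk (_ : iter k _ _ [:: p.1, p.2, p.1, p.2 & s] = 0); last first.
  have lk := lform_iter_contr N k lG.
  exact: (lk.2 [::] [:: p.2] (p.2 :: s) p.1).
by rewrite mulr0 addr0 -addrA -mulrDl -natrD [(2 * k.+2)%N]mulnS addnC.
Qed.

Lemma iter_contr_biv_of ps G : lform G -> exists2 C : R, C != 0 &
  forall s, iter (size ps) (contr (biv_of ps)) G s = C * G (flat ps ++ s).
Proof.
move=> lG; elim: ps => [|p ps [C C0 HC]].
  by exists 1; [exact: oner_neq0 | move=> s; rewrite mul1r].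
exists ((2 * (size ps).+1)%:R * C).
  by rewrite mulf_neq0 // pnatr_eq0.
move=> s; rewrite [size _]/= iter_contr_cons // HC /= -catA /= mulrA.
(* The term without the pair [p] vanishes: it has one contraction more than there are pairs in [ps],
   so some vector is inserted twice. *)
rewrite contr_biv_of; last exact: lform_iter_contr.
rewrite big1_seq ?mulr0 ?add0r // => r /andP[_ rps].
by rewrite HC (lform_mem lG) ?mulr0 //; have /andP[] := mem_flat rps.
Qed.

End ListForms.

(** * Tuples as lists, and derivations of forms *)

Section ListsOfVectors.
Variables (R : realType) (n : nat).
Local Notation V := 'rV[R]_n.
Local Notation e_ j := (delta_mx 0 j : 'rV[R]_n).
Implicit Types (G H : seq V -> R) (M N A B : 'M[R]_n) (s : seq V).

Definition list_of k (w : 'I_k -> V) : seq V := [seq w i | i <- enum 'I_k].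

(** The default 0 on lists of another length respects [lform], whose conditions are homogeneous and
    relate lists of equal length. *)
Definition lift_form k (F : ('I_k -> V) -> R) s : R :=
  if size s == k then F (fun i => nth 0 s i) else 0.

Lemma size_list_of k (w : 'I_k -> V) : size (list_of w) = k.
Proof. by rewrite size_map size_enum_ord. Qed.

Lemma nth_list_of k (w : 'I_k -> V) (i : 'I_k) : nth 0 (list_of w) i = w i.
Proof. by rewrite (nth_map i) ?size_enum_ord // nth_ord_enum. Qed.

Lemma lift_formE k (F : ('I_k -> V) -> R) w : lift_form F (list_of w) = F w.
Proof.
rewrite /lift_form size_list_of eqxx; congr F; apply/funext => i.
exact: nth_list_of.
Qed.

Lemma lform_lift k (F : ('I_k -> V) -> R) : altform F -> lform (lift_form F).
Proof.
move=> [mF aF]; have szE s1 s2 x y :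
  size (s1 ++ x :: s2) = size (s1 ++ y :: s2) :> nat by rewrite !size_cat.
split=> [s1 s2 a u v|s1 s2 s3 x]; rewrite /lift_form.
  rewrite (szE s1 s2 _ 0) (szE s1 s2 u 0) (szE s1 s2 v 0).
  case: eqP => [sk|_]; last by rewrite mulr0 addr0.
  have lt1 : (size s1 < k)%N by rewrite -sk size_cat /= addnS ltnS leq_addr.
  have E x : (fun i : 'I_k => nth 0 (s1 ++ x :: s2) i) =
      set_slot (fun i : 'I_k => nth 0 (s1 ++ 0 :: s2) i) (Ordinal lt1) x.
    apply/funext => i; rewrite /set_slot -val_eqE /= !nth_cat.
    have [->|ne] := eqVneq (i : nat) (size s1); first by rewrite ltnn subnn.
    case: ltnP => // le.
    by case: (i - size s1)%N (subn_eq0 i (size s1)) => // /esym;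
      rewrite eqxx leqNgt ltn_neqAle eq_sym ne le.
  by rewrite (E (a *: u + v)) (E u) (E v) mF.
case: eqP => // sk; set s := s1 ++ _ in sk *.
have lt1 : (size s1 < k)%N by rewrite -sk size_cat /= addnS ltnS leq_addr.
have lt2 : (size s1 + (size s2).+1 < k)%N.
  by rewrite -sk /s !size_cat /= size_cat /= ltn_add2l ltnS addnS ltnS leq_addr.
apply: (aF _ (Ordinal lt1) (Ordinal lt2)).
  by rewrite -val_eqE /= -[X in X != _]addn0 eqn_add2l.
rewrite /= /s !nth_cat ltnn subnn /= ltnNge leq_addr /= addKn /=.
by rewrite nth_cat ltnn subnn.
Qed.

Lemma list_of_slot k (w : 'I_k -> V) i v :
  list_of (set_slot w i v) = take i (list_of w) ++ v :: drop i.+1 (list_of w).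
Proof.
have sz : size (take i (list_of w)) = i.
  by rewrite size_takel // size_list_of ltnW.
apply: (@eq_from_nth _ 0) => [|l].
  rewrite size_cat sz /= size_drop !size_list_of addnS -addSn.
  by rewrite addnC subnK.
rewrite size_list_of => lk; rewrite (nth_list_of _ (Ordinal lk)).
rewrite nth_cat sz /set_slot -val_eqE /=.
have [->|ne] := eqVneq l i; first by rewrite ltnn subnn.
case: ltnP => il; first by rewrite nth_take // (nth_list_of _ (Ordinal lk)).
have {}il : (i < l)%N by rewrite ltn_neqAle eq_sym ne il.
case E : (l - i)%N => [|d] /=; first by move/eqP: E; rewrite subn_eq0 leqNgt il.
rewrite nth_drop -(nth_list_of _ (Ordinal lk)) /=; congr nth.
by rewrite addSn -addnS -E subnKC // ltnW.
Qed.

Lemma altform_list_of k G : lform G -> altform (fun w : 'I_k -> V => G (list_of w)).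
Proof.
move=> [mG aG]; split=> [w i a u v|w i j ij wij].
  by rewrite !list_of_slot mG.
wlog lt : i j ij wij / (i < j)%N.
  move=> H; have /orP[lt|lt] : (i < j)%N || (j < i)%N by rewrite -neq_ltn.
    exact: (H i j).
  by apply: (H j i) => //; rewrite eq_sym.
rewrite -(set_slot_id w i) list_of_slot.
set s := drop i.+1 _.
have E : s = take (j - i.+1) s ++ w i :: drop (j - i.+1).+1 s.
  rewrite -[LHS](cat_take_drop (j - i.+1)); congr (_ ++ _).
  rewrite (drop_nth 0); last by rewrite size_drop size_list_of ltn_sub2r // (leq_ltn_trans lt (ltn_ord j)).
  by rewrite nth_drop subnKC // nth_list_of wij.
by rewrite E; exact: aG.
Qed.

(* The derivation of forms induced by the endomorphism A. *)
Fixpoint der A G s : R :=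
  if s is x :: s' then G (x *m A :: s') + der A (fun t => G (x :: t)) s' else 0.

Lemma der_ext A G H s : G =1 H -> der A G s = der A H s.
Proof.
elim: s G H => //= x s IHs G H GH; rewrite GH; congr (_ + _).
by apply: IHs => t; exact: GH.
Qed.

Lemma der_lin A G H a s :
  der A (fun t => a * G t + H t) s = a * der A G s + der A H s.
Proof.
elim: s G H => [|x s IHs] G H /=; first by rewrite mulr0 addr0.
by rewrite IHs; ring.
Qed.

Lemma der0 A s : der A (fun=> 0) s = 0.
Proof. by elim: s => //= x s ->; rewrite addr0. Qed.

Lemma der_sum (I : Type) (r : seq I) (c : I -> R) (G : I -> seq V -> R) A s :
  der A (fun t => \sum_(i <- r) c i * G i t) s =
  \sum_(i <- r) c i * der A (G i) s.
Proof.
elim: r => [|i r IHr].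
  by rewrite big_nil -[RHS](der0 A s); apply: der_ext => t; rewrite big_nil.
rewrite big_cons -IHr -der_lin; apply: der_ext => t; exact: big_cons.
Qed.

Lemma derE A G s :
  der A G s = \sum_(i < size s) G (take i s ++ nth 0 s i *m A :: drop i.+1 s).
Proof.
elim: s G => [|x s IHs] G /=; first by rewrite big_ord0.
by rewrite big_ord_recl /= drop0 IHs.
Qed.

Lemma der_list_of k A G (w : 'I_k -> V) :
  der A G (list_of w) = \sum_i G (list_of (set_slot w i (w i *m A))).
Proof.
rewrite derE.
rewrite -(big_mkord xpredT (fun i => G (take i (list_of w) ++
  nth 0 (list_of w) i *m A :: drop i.+1 (list_of w)))) size_list_of big_mkord.
by apply: eq_bigr => i _; rewrite list_of_slot nth_list_of.
Qed.

(** Leibniz rule: before contraction the derivation also acts on the two slots filled by the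
    bivector, and this is the same as acting on the bivector. *)
Lemma der_contr A M G s : lform G ->
  contr M (der A G) s = contr (A^T *m M + M *m A) G s + der A (contr M G) s.
Proof.
move=> lG; rewrite contrD.
have -> : contr (A^T *m M) G s =
    \sum_a \sum_b M a b * G [:: e_ a *m A, e_ b & s].
  rewrite /contr exchange_big [RHS]exchange_big /=; apply: eq_bigr => b _.
  under [RHS]eq_bigr => a _ do rewrite -rowE [row a A]row_sum_delta
    (lform_sum lG _ _ _ [::]) mulr_sumr /=.
  rewrite exchange_big; apply: eq_bigr => c _ /=.
  rewrite mxE mulr_suml; apply: eq_bigr => a _; rewrite !mxE; ring.
have -> : contr (M *m A) G s =
    \sum_a \sum_b M a b * G [:: e_ a, e_ b *m A & s].
  rewrite /contr; apply: eq_bigr => a _.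
  under [RHS]eq_bigr => b _ do rewrite -rowE [row b A]row_sum_delta
    (lform_sum lG _ _ _ [:: e_ a]) mulr_sumr /=.
  rewrite exchange_big; apply: eq_bigr => c _ /=.
  rewrite mxE mulr_suml; apply: eq_bigr => b _; rewrite !mxE; ring.
have -> : der A (contr M G) s =
    \sum_a \sum_b M a b * der A (fun t => G [:: e_ a, e_ b & t]) s.
  transitivity (\sum_a 1 * \sum_b M a b * der A (fun t => G [:: e_ a, e_ b & t]) s).
    under eq_bigr => a _ do rewrite -der_sum.
    by rewrite -der_sum; apply: der_ext => t; apply: eq_bigr => a _; rewrite mul1r.
  by apply: eq_bigr => a _; rewrite mul1r.
rewrite -!big_split /=; apply: eq_bigr => a _.
rewrite -!big_split /=; apply: eq_bigr => b _.
by rewrite !mulrDr addrA.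
Qed.

(** Naturality under the linear map [B]: the bivector is pushed forward and the form pulled back. *)
Lemma contr_natural B M G s : lform G ->
  contr (B^T *m M *m B) G (map (mulmxr B) s) =
  contr M (fun t => G (map (mulmxr B) t)) s.
Proof.
move=> lG; rewrite /contr.
under [RHS]eq_bigr => a _ do under eq_bigr => b _ do
  rewrite /= -!rowE [row a B]row_sum_delta (lform_sum lG _ _ _ [::]) mulr_sumr /=.
transitivity (\sum_a \sum_b \sum_c \sum_d
   M a b * (B a c * (B b d * G [:: e_ c, e_ d & map (mulmxr B) s]))).
  under eq_bigr => c _ do under eq_bigr => d _ do
    rewrite mxE mulr_suml.
  under eq_bigr => c _ do rewrite exchange_big /=.
  under eq_bigr => c _ do under eq_bigr => b _ do under eq_bigr => d _ do
    rewrite mxE !mulr_suml.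
  under eq_bigr => c _ do under eq_bigr => b _ do rewrite exchange_big /=.
  under eq_bigr => c _ do rewrite exchange_big /=.
  rewrite exchange_big; apply: eq_bigr => a _ /=.
  rewrite exchange_big; apply: eq_bigr => b _ /=.
  apply: eq_bigr => c _; apply: eq_bigr => d _; rewrite !mxE; ring.
apply: eq_bigr => a _; apply: eq_bigr => b _; apply: eq_bigr => c _.
rewrite [row b B]row_sum_delta (lform_sum lG _ _ _ [:: e_ c]) !mulr_sumr.
by apply: eq_bigr => d _; rewrite !mxE.
Qed.

End ListsOfVectors.

(** * Splitting a skew matrix into decomposable bivectors *)

Section SkewForms.
Variables (R : realType) (n : nat).
Local Notation V := 'rV[R]_n.
Implicit Types (M N : 'M[R]_n).

Lemma rank_biv_of (ps : seq (V * V)) : (\rank (biv_of ps) <= (size ps).*2)%N.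
Proof.
have rank1 (g h : V) : (\rank (g^T *m h) <= 1)%N.
  exact: leq_trans (mxrankM_maxr _ _) (rank_leq_row _).
elim: ps => [|p ps IH]; first by rewrite /biv_of big_nil mxrank0.
rewrite /biv_of big_cons -/(biv_of ps) doubleS -addn2 addnC.
apply: leq_trans (mxrank_add _ _) _; apply: leq_add => //.
apply: leq_trans (mxrank_add _ _) _.
by rewrite mxrank_opp (leq_add (rank1 _ _) (rank1 _ _)).
Qed.

(** One step of symplectic elimination: the pivot [M i j] clears the rows [i] and [j], hence also
    the two columns by skew-symmetry. *)
Lemma skew_pivot M N i j (g := (M i j)^-1 *: row i M) (h := row j M) :
  M^T = - M -> M i j != 0 -> N = M - (g^T *m h - h^T *m g) ->
  [/\ N^T = - N, (N <= M)%MS & (\rank N + 2 <= \rank M)%N].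
Proof.
move=> skM Mij NMgh.
have sk a b : M a b = - M b a.
  by have := congr1 (fun X : 'M[R]_n => X b a) skM; rewrite !mxE => ->; rewrite ?opprK.
have M0 a : M a a = 0.
  have /eqP := sk a a; rewrite -addr_eq0 -mulr2n mulrn_eq0 /=.
  by move/eqP.
have NE a b : N a b = M a b -
    (M i j)^-1 * (M i a * M j b - M j a * M i b).
  by rewrite NMgh !mxE !big_ord1 !mxE; ring.
have skN : N^T = - N.
  apply/matrixP => a b; rewrite mxE [RHS]mxE !NE (sk b a); ring.
have Ni b : N i b = 0.
  by rewrite NE M0 (sk j i) mul0r sub0r mulNr opprK mulrA mulVf // mul1r subrr.
have Nj b : N j b = 0.
  by rewrite NE M0 mul0r subr0 mulrA mulVf // mul1r subrr.
pose f (l : 'I_2) := if l == 0 then i else j.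
(* [S] reads off the columns [i] and [j]. It annihilates [N] while [M *m S] has rank 2, so [N] lies
   in a subspace of codimension 2 of the row space of [M]. *)
pose S : 'M[R]_(n, 2) := colsub f 1%:M.
have NS : N *m S = 0.
  rewrite mulmx_colsub mulmx1; apply/matrixP => a l; rewrite !mxE.
  have := congr1 (fun X : 'M[R]_n => X (f l) a) skN; rewrite mxE [RHS]mxE => ->.
  by rewrite /f; case: ifP => _; rewrite ?Ni ?Nj oppr0.
have NM : (N <= M)%MS.
  rewrite NMgh addmx_sub ?eqmx_opp ?addmx_sub ?eqmx_opp //.
    by rewrite mulmx_sub // row_sub.
  by rewrite mulmx_sub // scalemx_sub // row_sub.
split=> //; rewrite -(mxrank_mul_ker M S) addnC leq_add //; last first.
  by apply: mxrankS; rewrite sub_capmx NM sub_kermx NS eqxx.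
have r2 : \rank (rowsub f (M *m S)) = 2%N.
  apply: mxrank_unit; set X := rowsub _ _.
  (* [X] is the skew 2 x 2 matrix with entry x = [M i j], whose square is -x^2 times the
     identity. *)
  suff /mulmx1_unit[] : X *m (- (M i j) ^- 2 *: X) = 1%:M by [].
  have XE a b : X a b = M (f a) (f b) by rewrite /X mulmx_colsub mulmx1 !mxE.
  have f0 : f 0 = i by []. have f1 : f 1 = j by [].
  have c2 (a : 'I_2) : a = 0 \/ a = 1.
    by case: a => [[|[|//]] ?]; [left | right]; exact: val_inj.
  apply/matrixP => a b; rewrite mxE !big_ord_recl big_ord0 addr0.
  rewrite (_ : lift ord0 ord0 = 1); last exact: val_inj.
  rewrite (_ : ord0 = 0) // ![(_ *: X) _ _]mxE !XE.
  have Mij2 : M i j * M i j * (M i j ^- 2) = 1.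
    by rewrite -expr2 mulfV // expf_neq0.
  by case: (c2 a) => ->; case: (c2 b) => ->; rewrite f0 f1 !M0 ?(sk j i) ?mxE /=;
    rewrite -?Mij2; ring.
apply: leq_trans (eq_leq (esym r2)) _; exact: mxrankS (rowsub_sub _ _).
Qed.

(** Pivots are split off until nothing is left. Each lowers the rank by at least 2, and
    [rank_biv_of] is the reverse bound, so that the number of pairs is exactly half the rank. *)
Lemma skew_biv_of M : M^T = - M -> exists ps : seq (V * V),
  M = biv_of ps /\ \rank M = (size ps).*2.
Proof.
move=> skM.
suff [ps [Mps le]] : exists ps : seq (V * V),
    M = biv_of ps /\ ((size ps).*2 <= \rank M)%N.
  by exists ps; split=> //; apply/eqP; rewrite eqn_leq le andbT {1}Mps rank_biv_of.
have [k] := ubnP (\rank M); elim: k M skM => // k IHk M skM /ltnSE rk.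
have [->|] := eqVneq M 0; first by exists [::]; rewrite /biv_of big_nil.
move=> M0; have [i [j Mij]] : exists i j, M i j != 0.
  apply: contrapT => H; case/eqP: M0; apply/matrixP => i j; rewrite mxE.
  by apply: contrapT => Mij; apply: H; exists i, j; apply/eqP.
have [skN _ rN] := skew_pivot skM Mij (erefl _).
set N := M - _ in skN rN.
have [|ps [Nps le]] := IHk N skN.
  by apply: leq_trans _ rk; apply: leq_trans _ rN; rewrite addn2 ltnS leqW.
exists (((M i j)^-1 *: row i M, row j M) :: ps); split.
  by rewrite /biv_of big_cons -/(biv_of ps) -Nps addrC subrK.
by rewrite /= doubleS -addn2; apply: leq_trans _ rN; rewrite leq_add2r.
Qed.

Lemma exists_complement M q : (\rank M + q = n)%N ->
  exists B : 'M[R]_(q, n), row_full (col_mx M B).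
Proof.
move=> rk; have e : \rank (M^C)%MS = q.
  apply/eqP; rewrite mxrank_compl -(eqn_add2l (\rank M)).
  by rewrite subnKC ?rank_leq_col // rk.
case: q / e rk => _; exists (row_base M^C%MS).
rewrite -sub1mx; have := addsmx_compl_full M; rewrite -sub1mx => full.
apply: submx_trans full _; rewrite -addsmxE addsmxS //.
by rewrite eq_row_base.
Qed.

(** By [iter_contr_biv_of] the vectors of [flat ps] fill the first slots, and they span the row
    space of the bivector: an argument from that space is already present. *)
Lemma contr_kills ps q (G : seq V -> R) : lform G ->
  kills (biv_of ps) (fun w : 'I_q -> V => iter (size ps) (contr (biv_of ps)) G (list_of w)).
Proof.
move=> lG w i; have [C _ HC] := iter_contr_biv_of ps lG; rewrite HC.
have span (v : V) : (v <= biv_of ps)%MS -> exists c d : V * V -> R,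
    v = \sum_(p <- ps) (c p *: p.1 + d p *: p.2).
  move=> /submxP[x ->]; exists (fun p => - (x *m p.2^T) 0 0), (fun p => (x *m p.1^T) 0 0).
  rewrite /biv_of mulmx_sumr; apply: eq_bigr => p _.
  rewrite mulmxBr !mulmxA [x *m p.1^T]mx11_scalar [x *m p.2^T]mx11_scalar.
  by rewrite !mul_scalar_mx addrC scaleNr !mxE.
move=> /span[c [d wE]].
rewrite -(set_slot_id w i) list_of_slot catA.
set s1 := flat ps ++ _; set s2 := drop _ _.
have mem p : p \in ps -> (p.1 \in s1) && (p.2 \in s1).
  by move=> /mem_flat /andP[a b]; rewrite !mem_cat a b.
have {wE} : w i = \sum_(p <- ps) (c p *: p.1 + d p *: p.2) by [].
move=> ->; suff -> : G (s1 ++ \sum_(p <- ps) (c p *: p.1 + d p *: p.2) :: s2) = 0.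
  by rewrite mulr0.
have H (r : seq (V * V)) : {subset r <= ps} ->
    G (s1 ++ \sum_(p <- r) (c p *: p.1 + d p *: p.2) :: s2) = 0.
  elim: r => [|p r IHr] sub; first by rewrite big_nil lform0.
  have /mem/andP[p1 p2] : p \in ps by apply: sub; rewrite mem_head.
  rewrite big_cons -addrA !lG.1 (lform_mem lG) // (lform_mem lG) // IHr.
    by rewrite !mulr0 !addr0.
  by move=> x xr; apply: sub; rewrite in_cons xr orbT.
exact: H.
Qed.

(** The contraction [lam] of the determinant kills [M], as [nu] does, so the two are proportional;
    the determinant only has to be rescaled. *)
Lemma exists_contr_form M q (nu : ('I_q -> V) -> R) :
  M^T = - M -> (\rank M + q = n)%N -> altform nu -> kills M nu ->
  (exists w, nu w != 0) ->
  let m := (n - q)./2 in n = (m.*2 + q)%N /\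
  exists F : ('I_n -> V) -> R, [/\ altform F, exists w, F w != 0 &
    forall w, iter m (contr M) (lift_form F) (list_of w) = nu w].
Proof.
move=> skM rk anu knu [w0 nu0]; have [ps [Mps rps]] := skew_biv_of skM.
have mE : (n - q)./2 = size ps by rewrite -{1}rk addnK rps doubleK.
rewrite mE /=; have nE : n = ((size ps).*2 + q)%N by rewrite -rps rk.
split=> //; have [B full] := exists_complement rk.
have lD := lform_lift (detform_alt R n).
pose lam (w : 'I_q -> V) :=
  iter (size ps) (contr M) (lift_form (@detform R n)) (list_of w).
have alam : altform lam by apply: altform_list_of; exact: lform_iter_contr.
have klam : kills M lam by rewrite /lam Mps; exact: contr_kills.
pose b i := row i B; pose s := flat ps ++ list_of b.
have sz : size s = n by rewrite size_cat size_flat size_list_of.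
(* The list [s] has [n] vectors and they span everything: the pairs span the rows of [M], which the
   rows of [B] complete. *)
have lamb : lam b != 0.
  have [C C0 HC] := iter_contr_biv_of ps lD.
  rewrite /lam Mps HC mulf_neq0 // -/s /lift_form sz eqxx /detform.
  set X := \matrix_i _; rewrite -unitfE -unitmxE -row_full_unit.
  have memX v : v \in s -> (v <= X)%MS.
    move=> vs; have : (index v s < size s)%N by rewrite index_mem.
    rewrite sz => iv.
    have -> : v = row (Ordinal iv) X by rewrite rowK nth_index.
    exact: row_sub.
  rewrite -sub1mx; apply: submx_trans (_ : (col_mx M B <= X)%MS).
    by rewrite sub1mx.
  rewrite col_mx_sub; apply/andP; split.
    rewrite Mps /biv_of big_seq; apply: summx_sub => p /mem_flat/andP[p1 p2].
    by rewrite addmx_sub ?eqmx_opp ?mulmx_sub ?memX // mem_cat ?p1 ?p2.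
  apply/row_subP => i; apply: memX; rewrite mem_cat; apply/orP; right.
  by apply/mapP; exists i; rewrite ?mem_enum.
have nub : nu b != 0.
  have [d E _] := kills_det full w0 anu knu.
  by apply: contraNneq nu0 => nub; rewrite E nub mulr0.
(* Forms of degree [q] that kill [M] are determined by their value on [b], which fixes the scale. *)
pose c := nu b / lam b.
have [mD aD] := detform_alt R n.
exists (fun w => c * detform w); split.
- split=> [w i a u v|w i j ij wij]; first by rewrite mD; ring.
  by rewrite (aD _ i j ij wij) mulr0.
- exists (@std_basis R n); rewrite detform_std mulr1 /c.
  by rewrite mulf_neq0 // invr_eq0.
move=> w; have -> : lift_form (fun w => c * detform w) =
    fun s => c * lift_form (@detform R n) s.
  by apply/funext => t; rewrite /lift_form; case: eqP; rewrite ?mulr0.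
rewrite iter_contrZ -/(lam w); have [d -> Ed] := kills_det full w alam klam.
by rewrite Ed // /c mulrCA divfK.
Qed.

End SkewForms.

(** * Lie derivatives of forms in a chart *)

Section LieDerivative.
Variables (R : realType) (n : nat) (P : manifold R n).
Implicit Types (U V W : set P) (f g : P -> R) (c : chart P) (p q : P).
Implicit Types (X Y Z : vfield P).

Local Notation e_ j := (delta_mx 0 j : 'rV[R]_n).

Definition cfield c (w : 'rV[R]_n) : vfield P := fun q => w *m frames c q.

Definition coform c k (om : kform P k) : kform P k :=
  fun q w => om q (fun i => w i *m frames c q).

(** The differential of [X] in the chart, acting on row vectors from the right: [w *m dmat c X q] is
    the derivative of the components of [X] along [w]. *)
Definition dmat c X q : 'M[R]_n :=
  \matrix_(l, k) pd c l (fun p => vcoord c X p 0 k) q.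

(** The Lie derivative on fields with constant components [w] in the chart; for these [X, w] = - w
    dX, whence the plus sign before the sum. *)
Definition Lcoord c X k (om : kform P k) q (w : 'I_k -> 'rV[R]_n) : R :=
  vderiv X (fun p => coform c om p w) q +
  \sum_i coform c om q (set_slot w i (w i *m dmat c X q)).

Lemma vcoord_cfield c w q : cdom c q -> vcoord c (cfield c w) q = w.
Proof. by move=> cq; rewrite vcoordE -mulmxA frames_jac // mulmx1. Qed.

Lemma vsmooth_cfield c w : vsmooth_on (cdom c) (cfield c w).
Proof.
have oc := @open_cdom _ _ P c.
apply: vsmooth_chart => // p cp; exists c, (cdom c); split=> // k.
by apply: (smooth_ext oc _ (smooth_cst _ (w 0 k))) => q cq; rewrite vcoord_cfield.
Qed.

Lemma vderiv_at X Y f q : X q = Y q -> vderiv X f q = vderiv Y f q.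
Proof. by rewrite /vderiv => ->. Qed.

Lemma mul_row_frames c (w : 'rV[R]_n) q :
  w *m frames c q = \sum_l w 0 l *: frame c l q.
Proof. by rewrite mulmx_sum_row; apply: eq_bigr => l _; rewrite row_frames. Qed.

Lemma vderiv_vcoord U c X Y k q : open U -> U q -> U `<=` cdom c ->
  vsmooth_on U X -> vderiv Y (fun p => vcoord c X p 0 k) q =
  (vcoord c Y q *m dmat c X q) 0 k.
Proof.
move=> oU Uq Uc sX.
rewrite (vderiv_pd Y oU Uq (Uc _ Uq) (vsmooth_coord k oU Uc sX)) mxE.
by apply: eq_bigr => l _; rewrite [dmat _ _ _ _ _]mxE.
Qed.

Lemma vcoord_lie_bracket U c X Y q : open U -> U q -> U `<=` cdom c ->
  vsmooth_on U X -> vsmooth_on U Y ->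
  vcoord c (lie_bracket X Y) q =
    vcoord c X q *m dmat c Y q - vcoord c Y q *m dmat c X q.
Proof.
move=> oU Uq Uc sX sY; apply/rowP => k; rewrite mxE.
have sx : smooth_on U (xcoord c k) by exact: smooth_on_subset (smooth_xcoord c k).
have subE (u v : 'rV[R]_n) : (u - v) 0 k = u 0 k - v 0 k by rewrite !mxE.
rewrite (vderiv_lie_bracket oU Uq sX sY sx) subE.
rewrite -(vderiv_vcoord X k oU Uq Uc sY) -(vderiv_vcoord Y k oU Uq Uc sX).
by congr (_ - _); apply: (vderiv_local _ oU Uq) => p _; rewrite mxE.
Qed.

Lemma coform_slot c k (om : kform P k) p w i v : coform c om p (set_slot w i v) =
  om p (set_slot (fun j => w j *m frames c p) i (v *m frames c p)).
Proof.
congr (om p); apply/funext => j; rewrite /set_slot; by case: eqP.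
Qed.

Lemma coform_altform c k (om : kform P k) p : altform (om p) ->
  altform (coform c om p).
Proof.
move=> [mo ao]; split=> [w i a u v|w i j ij wij].
  by rewrite !coform_slot mulmxDl -scalemxAl mo.
by apply: (ao _ i j ij); rewrite wij.
Qed.

Section Form.
Variables (k : nat) (om : kform P k).
Hypothesis fom : is_form om.

Lemma is_form_alt p : altform (om p).
Proof. by have [m a _] := fom; split; [exact: m | exact: a]. Qed.

Lemma smooth_form U (Y : 'I_k -> vfield P) : open U ->
  (forall i, vsmooth_on U (Y i)) -> smooth_on U (fun p => om p (fun i => Y i p)).
Proof. by have [_ _ s] := fom; exact: s. Qed.

Lemma smooth_coform c w : smooth_on (cdom c) (fun p => coform c om p w).
Proof.
apply: (@smooth_form _ (fun i => cfield c (w i))); first exact: open_cdom.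
by move=> i; exact: vsmooth_cfield.
Qed.

Lemma coform_alt c p : altform (coform c om p).
Proof. by apply: coform_altform; exact: is_form_alt. Qed.

Lemma coform_vcoord c (Y : 'I_k -> vfield P) q : cdom c q ->
  coform c om q (fun i => vcoord c (Y i) q) = om q (fun i => Y i q).
Proof.
move=> cq; congr (om q); apply/funext => i.
by rewrite -(vcoord_frames _ cq).
Qed.

(** The Lie derivative is tensorial in [Y]: the derivatives of the components of [Y] in the first
    term cancel those in the brackets. *)
Lemma lie_formE U c X (Y : 'I_k -> vfield P) q : open U -> U q ->
  U `<=` cdom c -> vsmooth_on U X -> (forall i, vsmooth_on U (Y i)) ->
  lie_form X om Y q = Lcoord c X om q (fun i => vcoord c (Y i) q).
Proof.
move=> oU Uq Uc sX sY; have cq := Uc _ Uq; set w := fun i => vcoord c (Y i) q.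
have [mom aom] := is_form_alt q.
pose z i : 'rV[R]_n := \row_l vderiv X (fun p => vcoord c (Y i) p 0 l) q.
(* Interpolates between the fields with constant components and [Y]. Adding a slot to [s] leaves the
   values at [q] unchanged and contributes the term of [z i], the derivative of [Y i] along [X]. *)
pose Ys (s : seq 'I_k) i : vfield P := if i \in s then Y i else cfield c (w i).
have Ysq s i : Ys s i q = Y i q.
  by rewrite /Ys; case: ifP => // _; rewrite /cfield -(vcoord_frames _ cq).
have sYs s i : vsmooth_on U (Ys s i).
  rewrite /Ys; case: ifP => _; first exact: sY.
  exact: vsmooth_on_subset (vsmooth_cfield c (w i)).
have main (s : seq 'I_k) : uniq s ->
    vderiv X (fun p => om p (fun i => Ys s i p)) q =
    vderiv X (fun p => coform c om p w) q +
    \sum_(i <- s) om q (set_slot (fun j => Y j q) i (z i *m frames c q)).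
  elim: s => [_|i s IHs /= /andP[nis us]]; first by rewrite big_nil addr0.
  pose F l p := om p (set_slot (fun j => Ys s j p) i (frame c l p)).
  have sF l : smooth_on U (F l).
    have -> : F l = fun p => om p (fun j => (if j == i then frame c l else Ys s j) p).
      apply/funext => p; congr (om p); apply/funext => j; rewrite /set_slot.
      by case: eqP.
    apply: smooth_form => // j; case: eqP => _; last exact: sYs.
    exact: vsmooth_on_subset (vsmooth_frame c l).
  pose y l p := vcoord c (Y i) p 0 l.
  have sy l : smooth_on U (y l) by exact: vsmooth_coord.
  rewrite (@vderiv_local _ _ _ U q X oU Uq _ (fun p => \sum_l y l p * F l p)); last first.
    move=> p /Uc cp; have [momp _] := is_form_alt p.
    have -> : (fun j => Ys (i :: s) j p) = set_slot (fun j => Ys s j p) i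
        (\sum_l y l p *: frame c l p).
      apply/funext => j; rewrite /set_slot /Ys in_cons.
      case: eqP => [->|_] //=; rewrite -mul_row_frames; exact: vcoord_frames.
    by rewrite (multilin_sum momp).
  rewrite (vderiv_sum _ oU Uq) => [|l]; last exact: smoothM.
  under [LHS]eq_bigr => l _ do rewrite (vderivM X oU Uq (sy l) (sF l)).
  rewrite big_split /= big_cons addrCA -IHs // addrC; congr (_ + _).
    rewrite mul_row_frames (multilin_sum mom); apply: eq_bigr => l _.
    rewrite [z i 0 l]mxE mulrC; congr (_ * om q (set_slot _ i _)).
    by apply/funext => j; exact: Ysq.
  have -> : \sum_l y l q * vderiv X (F l) q =
      vderiv X (fun p => \sum_l y l q * F l p) q.
    rewrite (vderiv_sum _ oU Uq) => [|l].
      by apply: eq_bigr => l _; rewrite (vderivZ X oU Uq).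
    apply: smoothM => //; exact: smooth_cst.
  apply: (vderiv_local _ oU Uq) => p Up; have [momp _] := is_form_alt p.
  rewrite -(multilin_sum momp) -mul_row_frames; congr (om p).
  apply/funext => j; rewrite /set_slot; case: eqP => [->|//].
  by rewrite /Ys (negbTE nis).
have := main (enum 'I_k) (enum_uniq _).
have -> : (fun p => om p (fun i => Ys (enum 'I_k) i p)) =
    fun p => om p (fun i => Y i p).
  apply/funext => p; congr (om p); apply/funext => i.
  by rewrite /Ys mem_enum.
rewrite /lie_form /Lcoord => ->; rewrite big_enum /= -addrA -sumrB; congr (_ + _).
apply: eq_bigr => i _; rewrite coform_slot.
have -> : (fun j => w j *m frames c q) = (fun j => Y j q).
  by apply/funext => j; rewrite /w -(vcoord_frames _ cq).
rewrite -(multilinB mom); congr (om q (set_slot _ i _)).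
rewrite [lie_bracket X (Y i) q](vcoord_frames _ cq) -mulmxBl; congr (_ *m _).
rewrite (vcoord_lie_bracket oU Uq Uc sX (sY i)) opprB addrCA.
have -> : z i = vcoord c X q *m dmat c (Y i) q.
  by apply/rowP => l; rewrite mxE; exact: (vderiv_vcoord X l oU Uq Uc (sY i)).
by rewrite subrr addr0.
Qed.

End Form.
End LieDerivative.

(** * Lie derivatives and contraction with the Poisson bivector *)

Section LieContraction.
Variables (R : realType) (n : nat) (P : manifold R n) (Pi : poisson P).
Implicit Types (U V W : set P) (f g : P -> R) (c : chart P) (p q : P).
Implicit Types (X Y Z : vfield P) (G : P -> seq 'rV[R]_n -> R).

Definition Llist X (A : 'M[R]_n) G q s : R :=
  vderiv X (fun p => G p s) q + der A (G q) s.

Lemma Llist_coform c X k (om : kform P k) q w :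
  Llist X (dmat c X q) (fun p => lift_form (coform c om p)) q (list_of w) =
  Lcoord c X om q w.
Proof.
rewrite /Llist /Lcoord der_list_of; congr (_ + _).
  by congr (vderiv X _ q); apply/funext => p; rewrite lift_formE.
by apply: eq_bigr => i _; rewrite lift_formE.
Qed.

Lemma smooth_iter_contr U (M : P -> 'M[R]_n) G j s : open U ->
  (forall a b, smooth_on U (fun p => M p a b)) ->
  (forall t, smooth_on U (fun p => G p t)) ->
  smooth_on U (fun p => iter j (contr (M p)) (G p) s).
Proof.
move=> oU sM sG; elim: j s => [|j IHj] s //=; rewrite /contr.
apply: smooth_sum => // a; apply: smooth_sum => // b.
by apply: smoothM.
Qed.

(* The last hypothesis says that the bivector M is preserved by X, the matrix A
   being the differential of X. *)
Lemma Llist_contr U X A (M : P -> 'M[R]_n) G q s : open U -> U q ->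
  (forall a b, smooth_on U (fun p => M p a b)) ->
  (forall t, smooth_on U (fun p => G p t)) -> lform (G q) ->
  (forall a b, vderiv X (fun p => M p a b) q = (A^T *m M q + M q *m A) a b) ->
  Llist X A (fun p => contr (M p) (G p)) q s =
  contr (M q) (fun t => Llist X A G q t) s.
Proof.
move=> oU Uq sM sG lG DM; rewrite /Llist.
have -> : contr (M q) (fun t => vderiv X (fun p => G p t) q + der A (G q) t) s =
    contr (M q) (fun t => vderiv X (fun p => G p t) q) s +
    contr (M q) (der A (G q)) s.
  rewrite -[X in X + _]mul1r -contr_lin; apply: contr_ext => t.
  by rewrite mul1r.
rewrite der_contr // addrA; congr (_ + _).
rewrite /contr (vderiv_sum _ oU Uq) => [|a]; last first.
  by apply: smooth_sum => // b; exact: smoothM.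
rewrite -big_split /=; apply: eq_bigr => a _.
rewrite (vderiv_sum _ oU Uq) => [|b]; last exact: smoothM.
rewrite -big_split /=; apply: eq_bigr => b _.
by rewrite (vderivM _ oU Uq) // DM [_ * G _ _]mulrC.
Qed.

Lemma Llist_iter_contr U X A (M : P -> 'M[R]_n) G q j s : open U -> U q ->
  (forall a b, smooth_on U (fun p => M p a b)) ->
  (forall t, smooth_on U (fun p => G p t)) -> (forall p, lform (G p)) ->
  (forall a b, vderiv X (fun p => M p a b) q = (A^T *m M q + M q *m A) a b) ->
  Llist X A (fun p => iter j (contr (M p)) (G p)) q s =
  iter j (contr (M q)) (fun t => Llist X A G q t) s.
Proof.
move=> oU Uq sM sG lG DM; elim: j s => [|j IHj] s //=.
rewrite (Llist_contr _ oU Uq) //.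
- exact: contr_ext.
- by move=> t; exact: smooth_iter_contr.
- exact: lform_iter_contr.
Qed.

(** The invariance L_X pi = 0 of the bivector under its Hamiltonian fields, which is the Jacobi
    identity for [f] and two coordinate functions. *)
Lemma vderiv_ham_bivc U c f q a b : open U -> U q -> U `<=` cdom c ->
  smooth_on U f ->
  vderiv (ham Pi f) (fun p => bivc Pi c p a b) q =
  ((dmat c (ham Pi f) q)^T *m bivc Pi c q + bivc Pi c q *m dmat c (ham Pi f) q) a b.
Proof.
move=> oU Uq Uc sf; have cq := Uc _ Uq.
have sx k : smooth_on U (xcoord c k) by exact: smooth_on_subset (smooth_xcoord c k).
have sX : vsmooth_on U (ham Pi f) by exact: vsmooth_ham.
have -> : vderiv (ham Pi f) (fun p => bivc Pi c p a b) q =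
    vderiv (ham Pi f) (vderiv (ham Pi (xcoord c a)) (xcoord c b)) q.
  by apply: (vderiv_local _ oU Uq) => p _; rewrite mxE.
have := ham_jacobi Pi oU Uq sf (sx a) (sx b) => /eqP.
rewrite subr_eq => /eqP ->; rewrite mxE; congr (_ + _).
  have sXa : smooth_on U (vderiv (ham Pi f) (xcoord c a)) by exact: smooth_vderiv.
  rewrite (vderiv_sharp _ _ oU Uq cq (sx b)) mxE; apply: eq_bigr => l _.
  rewrite (acoord_dfun _ oU Uq cq sXa) [(_^T) a l]mxE !mxE; congr (_ * _).
  by apply: (pd_local oU Uq cq) => p _; rewrite mxE.
have E : vcoord c (ham Pi (xcoord c a)) q = row a (bivc Pi c q).
  by apply/rowP => l; rewrite !mxE.
rewrite [RHS](_ : _ = (row a (bivc Pi c q) *m dmat c (ham Pi f) q) 0 b); last first.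
  by rewrite -row_mul [RHS]mxE.
rewrite -E -(vderiv_vcoord _ b oU Uq Uc sX).
by apply: (vderiv_local _ oU Uq) => p _; rewrite mxE.
Qed.

Lemma iter_contr_natural (B M : 'M[R]_n) (F : seq 'rV[R]_n -> R) j s : lform F ->
  iter j (contr (B^T *m M *m B)) F (map (mulmxr B) s) =
  iter j (contr M) (fun t => F (map (mulmxr B) t)) s.
Proof.
move=> lF; elim: j s => //= j IHj s.
rewrite contr_natural; last exact: lform_iter_contr.
exact: contr_ext.
Qed.

Lemma lift_coform c k (om : kform P k) q s :
  lift_form (om q) (map (mulmxr (frames c q)) s) = lift_form (coform c om q) s.
Proof.
rewrite /lift_form size_map; case: eqP => // sk; congr (om q).
by apply/funext => i; rewrite (nth_map 0) ?sk.
Qed.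

(** Moves a contraction identity from [chart_at q], where [Pi q] is written, to a fixed chart, where
    it can be differentiated. *)
Lemma iter_contr_coform c k k' (om : kform P k) (eta : kform P k') j q w :
  altform (om q) -> cdom c q ->
  (forall w, iter j (contr (Pi q)) (lift_form (om q)) (list_of w) = eta q w) ->
  iter j (contr (bivc Pi c q)) (lift_form (coform c om q)) (list_of w) =
  coform c eta q w.
Proof.
move=> aom cq E; rewrite -[coform c eta q w]/(eta q (fun i => w i *m frames c q)) -E.
rewrite [in RHS](biv_bivc Pi cq).
have -> : list_of (fun i => w i *m frames c q) = map (mulmxr (frames c q)) (list_of w).
  by rewrite /list_of -[RHS]map_comp.
rewrite iter_contr_natural; last exact: lform_lift.
by congr (iter _ _ _ _); apply/funext => t; rewrite lift_coform.
Qed.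

End LieContraction.

(** * The volume form associated with a transverse form *)

Section FormAlgebra.
Variables (R : realType) (n : nat).
Local Notation V := 'rV[R]_n.
Local Notation e_ j := (delta_mx 0 j : 'rV[R]_n).

Lemma altform_slot_sum k (F : ('I_k -> V) -> R) (A : 'M[R]_n) : altform F ->
  altform (fun w => \sum_i F (set_slot w i (w i *m A))).
Proof.
move=> aF; have [mF altF] := aF; split=> [w j a u v|w i j ij wij].
  rewrite mulr_sumr -big_split /=; apply: eq_bigr => i _.
  have [->|ij] := eqVneq i j.
    by rewrite !set_slotK !set_slot_eq mulmxDl -scalemxAl mF.
  have ji : j != i by rewrite eq_sym.
  by rewrite !(set_slot_neq _ _ ij) !(set_slotC _ _ _ ji) mF.
have ji : j != i by rewrite eq_sym.
(* Only the terms [i] and [j] survive, the others having two equal arguments; these two differ by a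
   transposition and cancel. *)
rewrite (bigD1 i) //= (bigD1 j) //= big1 ?addr0 => [|l /andP[li lj]]; last first.
  by apply: (altF _ i j ij); rewrite !set_slot_neq // eq_sym.
have -> : set_slot w j (w j *m A) = set_slot w i (w i *m A) \o tperm i j.
  apply/funext => l /=; rewrite /set_slot.
  by case: tpermP => [->|->|/eqP/negbTE-> /eqP/negbTE->//]; rewrite ?eqxx;
    rewrite ?(negbTE ij) ?(negbTE ji) ?wij.
by rewrite (alt_tperm aF) // subrr.
Qed.

Lemma altform_add k (F G : ('I_k -> V) -> R) : altform F -> altform G ->
  altform (fun w => F w + G w).
Proof.
move=> [mF aF] [mG aG]; split=> [w i a u v|w i j ij wij].
  by rewrite mF mG; ring.
by rewrite (aF _ i j) // (aG _ i j) // addr0.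
Qed.

Lemma list_of_nth k (s : seq V) : size s = k ->
  s = list_of (fun i : 'I_k => nth 0 s i).
Proof.
move=> sk; apply: (@eq_from_nth _ 0); first by rewrite size_list_of.
by move=> l; rewrite sk => lk; rewrite (nth_list_of _ (Ordinal lk)).
Qed.

Lemma linear_rV (L : V -> R) : (forall a u v, L (a *: u + v) = a * L u + L v) ->
  forall v, L v = \sum_k v 0 k * L (e_ k).
Proof.
move=> LL v; have L0 : L 0 = 0.
  have := LL 1 0 0; rewrite scale1r addr0 mul1r => /eqP.
  by rewrite -subr_eq0 opprD addrA subrr sub0r oppr_eq0 => /eqP.
rewrite {1}[v]row_sum_delta; elim: (index_enum _) => [|k s IHs].
  by rewrite !big_nil.
by rewrite !big_cons LL IHs.
Qed.

(** With [B] complementary to [M], putting [v] in slot [j] of the rows of [B] multiplies the nonzero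
    value of [nu] by the j-th component of [v] along [B]. *)
Lemma kills_kernel q (M : 'M[R]_n) (nu : ('I_q -> V) -> R) v :
  (\rank M + q = n)%N -> altform nu -> kills M nu -> (exists w, nu w != 0) ->
  (forall w i, nu (set_slot w i v) = 0) -> (v <= M)%MS.
Proof.
move=> rk anu knu [w0 nu0] nuv; have [B full] := exists_complement rk.
have [mnu altnu] := anu; pose b i := row i B.
have nub : nu b != 0.
  have [d E _] := kills_det full w0 anu knu.
  by apply: contraNneq nu0 => nub; rewrite E nub mulr0.
have /submxP[x vE] : (v <= col_mx M B)%MS by exact: submx_full.
rewrite -[x]hsubmxK mul_row_col in vE.
set t := lsubmx x *m M in vE; set d := rsubmx x in vE.
have tM : (t <= M)%MS by exact: submxMl.
suff d0 : d = 0 by rewrite vE d0 mul0mx addr0.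
apply/rowP => j; rewrite [RHS]mxE; apply: (mulIf nub); rewrite mul0r.
rewrite -(nuv b j) vE (multilinD mnu) (knu (set_slot b j t) j) ?set_slot_eq //.
rewrite add0r mulmx_sum_row (multilin_sum mnu) (bigD1 j) //=.
rewrite (_ : row j B = b j) // set_slot_id big1 ?addr0 // => l lj.
by rewrite (altnu _ j l) ?mulr0 ?set_slot_eq ?set_slot_neq // eq_sym.
Qed.

End FormAlgebra.

Section ModularForm.
Variables (R : realType) (n r : nat) (P : manifold R n) (Pi : poisson P).
Variable nu : kform P r.
Hypothesis regular : forall p, (\rank (Pi p) + r = n)%N.
Hypothesis nu_orient : transverse_orientation Pi nu.
Implicit Types (U V W : set P) (f g : P -> R) (c : chart P) (p q : P).
Implicit Types (X Y Z : vfield P).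

(** Half the rank of the bivector: the number of contractions leading from degree [n] to degree
    [r]. *)
Let m := (n - r)./2.

Lemma transverse_form : is_form nu. Proof. by have [] := nu_orient. Qed.

Lemma transverse_neq0 p : exists w, nu p w != 0.
Proof. by have [_ + _] := nu_orient; exact. Qed.

Lemma transverse_kills p : kills (Pi p) (nu p).
Proof. by have [_ _ +] := nu_orient; exact. Qed.

Definition contracts_to p (F : ('I_n -> 'rV[R]_n) -> R) : Prop :=
  [/\ n = (m.*2 + r)%N, altform F, exists w, F w != 0 &
    forall w, iter m (contr (Pi p)) (lift_form F) (list_of w) = nu p w].

Lemma exists_contracts_to p : exists F, contracts_to p F.
Proof.
have := exists_contr_form (biv_skew Pi p) (regular p) (is_form_alt transverse_form p)
  (@transverse_kills p) (transverse_neq0 p).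
by move=> [nE [F [aF F0 HF]]]; exists F.
Qed.

(* The volume form determined by the transverse form and the leafwise
   symplectic form: its contraction with pi^m, 2m = rank pi, is nu. *)
Definition mu0 : kform P n := fun p => sval (cid (exists_contracts_to p)).

Lemma mu0P p : contracts_to p (mu0 p).
Proof. exact: (svalP (cid (exists_contracts_to p))). Qed.

Lemma altform_mu0 p : altform (mu0 p). Proof. by have [] := mu0P p. Qed.

Lemma coform_neq0 c k (om : kform P k) p : cdom c p -> (exists w, om p w != 0) ->
  exists w, coform c om p w != 0.
Proof.
move=> cp [w om0]; exists (fun i => w i *m jac c p); rewrite /coform.
rewrite (_ : (fun i => _) = w) //; apply/funext => i.
by rewrite -mulmxA jac_frames // mulmx1.
Qed.

Lemma coform_det c (mu : kform P n) p w : altform (mu p) ->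
  coform c mu p w = detform w * coform c mu p (@std_basis R n).
Proof. by move=> amu; apply: altform_det; exact: coform_altform. Qed.

Lemma coform_std_neq0 c (mu : kform P n) p : altform (mu p) -> cdom c p ->
  (exists w, mu p w != 0) -> coform c mu p (@std_basis R n) != 0.
Proof.
move=> amu cp /(coform_neq0 cp)[w]; apply: contraNneq => h0.
by rewrite coform_det // h0 mulr0.
Qed.

Lemma mu0_contr c p w : cdom c p ->
  iter m (contr (bivc Pi c p)) (lift_form (coform c mu0 p)) (list_of w) =
  coform c nu p w.
Proof.
move=> cp; apply: iter_contr_coform => //; first exact: altform_mu0.
by have [] := mu0P p.
Qed.

(** [mu0] is chosen at each point separately, so smoothness is an issue. Contraction is linear: in a
    chart nu(w) is the density of [mu0] times [lam], the contraction of the determinant, and near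
    [p] both nu(w) and [lam] are smooth and nonzero, so their quotient is smooth. *)
Lemma is_form_mu0 : is_form mu0.
Proof.
split=> [p w i a u v|p w i j ij wij|U Y oU sY].
- by have [mo _] := altform_mu0 p; exact: mo.
- by have [_ ao] := altform_mu0 p; exact: (ao _ i j).
apply: smooth_local => p Up; pose c := chart_at p.
have cp : cdom c p := mem_cdom_chart_at p.
have [w w0] := coform_neq0 cp (transverse_neq0 p).
have [W [oW Wp Wc nuW]] := smooth_neq0 (@open_cdom _ _ P c) cp
  (smooth_coform transverse_form c w) w0.
exists (U `&` W); split=> //; first exact: openI.
have oUW : open (U `&` W) by exact: openI.
have UWc : U `&` W `<=` cdom c by move=> x [_ /Wc].
pose lam x := iter m (contr (bivc Pi c x)) (lift_form (@detform R n)) (list_of w).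
have lamE x : cdom c x ->
    coform c nu x w = coform c mu0 x (@std_basis R n) * lam x.
  move=> cx; rewrite -mu0_contr // -iter_contrZ; congr (iter _ _ _ _).
  apply/funext => s; rewrite /lift_form; case: eqP; rewrite ?mulr0 // => _.
  by rewrite mulrC; apply: coform_det; exact: altform_mu0.
have lam0 x : (U `&` W) x -> lam x != 0.
  move=> [_ Wx]; apply: contraNneq (nuW _ Wx) => l0.
  by rewrite lamE ?l0 ?mulr0 //; exact: Wc.
have slam : smooth_on (U `&` W) lam.
  apply: smooth_iter_contr => // [a b|t]; last exact: smooth_cst.
  exact: smooth_on_subset (smooth_bivc Pi c a b).
have sdet : smooth_on (U `&` W) (fun x => detform (fun i => vcoord c (Y i) x)).
  rewrite /detform /determinant; apply: smooth_sum => // s.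
  apply: smoothM => //; first exact: smooth_cst.
  apply: smooth_prod => // i.
  have : smooth_on (U `&` W) (fun x => vcoord c (Y i) x 0 (s i)).
    apply: vsmooth_coord => //; apply: vsmooth_on_subset (sY i).
    by move=> x [].
  by apply: smooth_ext => // x _; rewrite [RHS]mxE.
have snu : smooth_on (U `&` W) (fun x => coform c nu x w).
  exact: smooth_on_subset (smooth_coform transverse_form c w).
have := smoothM oUW sdet (smoothM oUW snu (smoothV oUW lam0 slam)).
apply: smooth_ext => // x UWx; have cx := UWc _ UWx.
rewrite lamE // mulfK ?lam0 //.
by rewrite -coform_det ?coform_vcoord //; exact: altform_mu0.
Qed.

Lemma altform_Lcoord c X k (om : kform P k) U p : is_form om -> open U -> U p ->
  U `<=` cdom c -> altform (Lcoord c X om p).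
Proof.
move=> fom oU Up Uc; apply: altform_add.
  have sc w : smooth_on U (fun x => coform c om x w).
    exact: smooth_on_subset (smooth_coform fom c w).
  split=> [w i a u v|w i j ij wij].
    rewrite -(vderiv_lin X a oU Up (sc _) (sc _)); apply: (vderiv_local _ oU Up) => x _.
    by have [mo _] := coform_alt fom c x; exact: mo.
  rewrite -(vderiv_cst p X 0); apply: (vderiv_local _ oU Up) => x _.
  by have [_ ao] := coform_alt fom c x; exact: (ao _ i j).
by apply: altform_slot_sum; exact: coform_alt.
Qed.

(** The scalar comes from top degree, where all alternating forms are proportional; it is the
    divergence of the field at [p]. *)
Lemma ham_scale U f p : open U -> U p -> smooth_on U f -> exists t : R,
  (forall W (Y : 'I_n -> vfield P), open W -> W p ->
     (forall i, vsmooth_on W (Y i)) ->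
     lie_form (ham Pi f) mu0 Y p = t * mu0 p (fun i => Y i p)) /\
  (forall W (Y : 'I_r -> vfield P), open W -> W p ->
     (forall i, vsmooth_on W (Y i)) ->
     lie_form (ham Pi f) nu Y p = t * nu p (fun i => Y i p)).
Proof.
move=> oU Up sf; set X := ham Pi f; pose c := chart_at p.
have cp : cdom c p := mem_cdom_chart_at p.
pose U0 := U `&` cdom c.
have oU0 : open U0 by exact: open_setI_cdom.
have U0p : U0 p by [].
have U0c : U0 `<=` cdom c by move=> x [].
have sf0 : smooth_on U0 f by apply: smooth_on_subset sf => x [].
have sX : vsmooth_on U0 X by exact: vsmooth_ham.
pose h := coform c mu0 p (@std_basis R n).
have [nE amu mu_neq0 _] := mu0P p.
have h0 : h != 0 by exact: coform_std_neq0.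
pose t := Lcoord c X mu0 p (@std_basis R n) / h.
have Lmu w : Lcoord c X mu0 p w = t * coform c mu0 p w.
  rewrite (altform_det w (altform_Lcoord X is_form_mu0 oU0 U0p U0c)).
  by rewrite (coform_det c w amu) /t mulrCA divfK.
have Lnu w : Lcoord c X nu p w = t * coform c nu p w.
  pose A := dmat c X p; pose M x := bivc Pi c x.
  pose G x := lift_form (coform c mu0 x).
  have sG s : smooth_on U0 (fun x => G x s).
    rewrite /G /lift_form; case: eqP => _; last exact: smooth_cst.
    exact: smooth_on_subset (smooth_coform is_form_mu0 c _).
  have sM a b : smooth_on U0 (fun x => M x a b).
    exact: smooth_on_subset (smooth_bivc Pi c a b).
  transitivity (Llist X A (fun x => iter m (contr (M x)) (G x)) p (list_of w)).
    rewrite /Llist /Lcoord; congr (_ + _).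
      apply: (vderiv_local _ oU0 U0p) => x /U0c cx; by rewrite mu0_contr.
    by rewrite der_list_of; apply: eq_bigr => i _; rewrite mu0_contr.
  rewrite (Llist_iter_contr _ _ oU0 U0p) //; first last.
  - by move=> a b; apply: (vderiv_ham_bivc Pi _ _ oU0 U0p U0c sf0).
  - by move=> x; apply: lform_lift; exact: (coform_alt is_form_mu0).
  (* The proportionality to [mu0] is known on lists of length [n], and [m] contractions over a list
     of length [r] evaluate exactly there. *)
  rewrite (@iter_contr_size _ _ _ _ (fun s => t * G p s) m n); first last.
  - by rewrite size_list_of; exact: esym nE.
  - move=> s /list_of_nth ->.
    by rewrite /A /G (Llist_coform c X mu0 p) Lmu lift_formE.
  by rewrite iter_contrZ mu0_contr.
exists t; split=> W Y oW Wp sY.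
  have oW0 : open (W `&` U0) by exact: openI.
  rewrite (lie_formE (c := c) is_form_mu0 oW0 (conj Wp U0p)).
  - by rewrite Lmu coform_vcoord.
  - by move=> x [_ /U0c].
  - by apply: vsmooth_on_subset sX => x [].
  - by move=> i; apply: vsmooth_on_subset (sY i) => x [].
have oW0 : open (W `&` U0) by exact: openI.
rewrite (lie_formE (c := c) transverse_form oW0 (conj Wp U0p)).
- by rewrite Lnu coform_vcoord.
- by move=> x [_ /U0c].
- by apply: vsmooth_on_subset sX => x [].
- by move=> i; apply: vsmooth_on_subset (sY i) => x [].
Qed.

End ModularForm.

(** * The Reeb form *)

Section ReebForm.
Variables (R : realType) (n r : nat) (P : manifold R n) (Pi : poisson P).
Variable nu : kform P r.
Hypothesis regular : forall p, (\rank (Pi p) + r = n)%N.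
Hypothesis nu_orient : transverse_orientation Pi nu.
Implicit Types (U V W : set P) (f g : P -> R) (c : chart P) (p q : P).
Implicit Types (X Y Z : vfield P).

Local Notation e_ j := (delta_mx 0 j : 'rV[R]_n).
Let fnu : is_form nu := transverse_form nu_orient.
Local Notation mu0 := (mu0 regular nu_orient).

(* The interior product of d nu with v, in the coordinates of the chart c. *)
Definition dnu c p (v : 'rV[R]_n) (w : 'I_r -> 'rV[R]_n) : R :=
  vderiv (cfield c v) (fun x => coform c nu x w) p -
  \sum_i vderiv (cfield c (w i)) (fun x => coform c nu x (set_slot w i v)) p.

Lemma vderiv_cfield_lin c (a : R) u v f p :
  vderiv (cfield c (a *: u + v)) f p =
  a * vderiv (cfield c u) f p + vderiv (cfield c v) f p.
Proof.
by rewrite /vderiv /cfield mulmxDl -scalemxAl pairing_lin.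
Qed.

Lemma vderiv_vcoord_cfield c X f p : cdom c p ->
  vderiv X f p = vderiv (cfield c (vcoord c X p)) f p.
Proof. by move=> cp; apply: vderiv_at; exact: vcoord_frames. Qed.

Lemma dnu_lin c p w (a : R) u v : cdom c p ->
  dnu c p (a *: u + v) w = a * dnu c p u w + dnu c p v w.
Proof.
move=> cp; have oc := @open_cdom _ _ P c.
rewrite /dnu vderiv_cfield_lin.
rewrite (eq_bigr (fun i => a *
   vderiv (cfield c (w i)) (fun x => coform c nu x (set_slot w i u)) p +
   vderiv (cfield c (w i)) (fun x => coform c nu x (set_slot w i v)) p)).
  by rewrite big_split -mulr_sumr /=; ring.
move=> i _.
rewrite -(vderiv_lin _ a oc cp (smooth_coform fnu c _) (smooth_coform fnu c _)).
apply: (vderiv_local _ oc cp) => x _.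
by have [mo _] := coform_alt fnu c x; exact: mo.
Qed.

Lemma smooth_dnu c v w : smooth_on (cdom c) (fun p => dnu c p v w).
Proof.
have oc := @open_cdom _ _ P c.
have H u u' : smooth_on (cdom c)
    (vderiv (cfield c u) (fun x => coform c nu x u')).
  by apply: smooth_vderiv => //; [exact: vsmooth_cfield | exact: smooth_coform].
by apply: smoothB => //; apply: smooth_sum.
Qed.

(** Cartan's formula with i_X nu = 0. The right-hand side involves [X] through its value at [p]
    only. *)
Lemma Lcoord_tangent U c X p w : open U -> U p -> U `<=` cdom c ->
  tangent_on Pi U X -> Lcoord c X nu p w = dnu c p (vcoord c X p) w.
Proof.
move=> oU Up Uc [sX tX]; have cp := Uc _ Up.
rewrite /Lcoord /dnu -sumrN -vderiv_vcoord_cfield //; congr (_ + _).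
apply: eq_bigr => i _; set v := vcoord c X p; set Z := cfield c (w i).
pose y k x := vcoord c X x 0 k; pose F k x := coform c nu x (set_slot w i (e_ k)).
have sy k : smooth_on U (y k) by exact: vsmooth_coord.
have sF k : smooth_on U (F k) by exact: smooth_on_subset (smooth_coform fnu c _).
(* Differentiating nu(.., X, ..) = 0 along the i-th argument trades the derivatives of [X] for
   derivatives of [nu]. *)
have : vderiv Z (fun x => \sum_k y k x * F k x) p = 0.
  rewrite -[RHS](vderiv_cst p Z 0); apply: (vderiv_local _ oU Up) => x Ux.
  have [mo _] := coform_alt fnu c x; rewrite /y /F /= -(multilin_sum mo).
  rewrite -row_sum_delta coform_slot -(vcoord_frames X (Uc _ Ux)).
  apply: (transverse_kills nu_orient (i := i)).
  by rewrite set_slot_eq; exact: tX.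
rewrite (vderiv_sum _ oU Up) => [|k]; last exact: smoothM.
under eq_bigr => k _ do rewrite (vderivM Z oU Up (sy k) (sF k)).
rewrite big_split /= => /eqP; rewrite addrC addr_eq0 => /eqP E.
have [mo _] := coform_alt fnu c p.
rewrite [w i *m _]row_sum_delta (multilin_sum mo).
transitivity (\sum_k F k p * vderiv Z (y k) p).
  apply: eq_bigr => k _; rewrite mulrC; congr (_ * _).
  by rewrite (vderiv_vcoord Z k oU Up Uc sX) vcoord_cfield.
rewrite E; congr (- _).
transitivity (vderiv Z (fun x => \sum_k y k p * F k x) p).
  rewrite (vderiv_sum _ oU Up) => [|k].
    by apply: eq_bigr => k _; rewrite (vderivZ Z oU Up).
  apply: smoothM => //; exact: smooth_cst.
apply: (vderiv_local _ oU Up) => x _.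
have [mox _] := coform_alt fnu c x.
by rewrite /y /F /= -(multilin_sum mox) -row_sum_delta.
Qed.

Definition transverse_frame p : 'I_r -> 'rV[R]_n :=
  sval (cid (transverse_neq0 nu_orient p)).

Lemma transverse_frame_neq0 p : nu p (transverse_frame p) != 0.
Proof. exact: (svalP (cid (transverse_neq0 nu_orient p))). Qed.

(** The factor in L_v nu = alpha(v) nu, read off from one tuple on which [nu] does not vanish;
    independence of the tuple is [reeb_formE]. *)
Definition reeb_form : tcovfield P := fun p v =>
  if (v <= Pi p)%MS then
    dnu (chart_at p) p v (transverse_frame p) / nu p (transverse_frame p)
  else 0.

Lemma exists_ham p v : (v <= Pi p)%MS -> exists2 f,
  smooth_on (cdom (chart_at p)) f & ham Pi f p = v.
Proof.
move=> /submxP[b ->]; set c := chart_at p.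
have oc := @open_cdom _ _ P c; have cp : cdom c p := mem_cdom_chart_at p.
have sx k : smooth_on (cdom c) (fun x => b 0 k * xcoord c k x).
  by apply: smoothM => //; [exact: smooth_cst | exact: smooth_xcoord].
(* A function linear in the coordinates, with prescribed differential [b] at [p]. *)
pose f x := \sum_k b 0 k * xcoord c k x.
have sf : smooth_on (cdom c) f by exact: smooth_sum.
exists f => //; rewrite -[LHS]/((dfun f p)^T *m Pi p); congr (_ *m _).
apply/rowP => j; rewrite mxE.
rewrite -[dfun f p]mul1mx -(frames_chart_at p) -acoordE.
rewrite (acoord_dfun j oc cp cp sf) -(vderiv_frame j oc cp cp sf).
rewrite (vderiv_sum _ oc cp) // (bigD1 j) //=.
have E k : vderiv (frame c j) (fun x => b 0 k * xcoord c k x) p = b 0 k * (j == k)%:R.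
  rewrite (vderivZ _ oc cp); last exact: smooth_xcoord.
  by rewrite (vderiv_frame j oc cp cp (smooth_xcoord c k)) pd_xcoord.
rewrite E eqxx mulr1 big1 ?addr0 // => k kj.
by rewrite E eq_sym (negbTE kj) mulr0.
Qed.

Lemma reeb_form_scale p v f : (v <= Pi p)%MS ->
  smooth_on (cdom (chart_at p)) f -> ham Pi f p = v -> forall W,
  open W -> W p ->
  (forall Y : 'I_n -> vfield P, (forall i, vsmooth_on W (Y i)) ->
     lie_form (ham Pi f) mu0 Y p = reeb_form p v * mu0 p (fun i => Y i p)) /\
  (forall Y : 'I_r -> vfield P, (forall i, vsmooth_on W (Y i)) ->
     lie_form (ham Pi f) nu Y p = reeb_form p v * nu p (fun i => Y i p)).
Proof.
move=> vP sf fv W oW Wp; set c := chart_at p.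
have oc := @open_cdom _ _ P c; have cp : cdom c p := mem_cdom_chart_at p.
have [t [Hmu Hnu]] := ham_scale regular nu_orient oc cp sf.
suff <- : t = reeb_form p v.
  by split=> Y sY; [exact: Hmu sY | exact: Hnu sY].
set w0 := transverse_frame p.
have := Hnu _ (fun i => cfield c (w0 i)) oc cp (fun i => vsmooth_cfield c (w0 i)).
rewrite (lie_formE (c := c) fnu oc cp (@subset_refl _ _)); first last.
- by move=> i; exact: vsmooth_cfield.
- exact: vsmooth_ham.
rewrite (Lcoord_tangent _ oc cp (@subset_refl _ _) (tangent_ham Pi oc sf)).
have -> : (fun i => vcoord c (cfield c (w0 i)) p) = w0.
  by apply/funext => i; rewrite vcoord_cfield.
have -> : (fun i => cfield c (w0 i) p) = w0.
  by apply/funext => i; rewrite /cfield frames_chart_at mulmx1.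
rewrite vcoord_chart_at fv /reeb_form vP => ->.
by rewrite mulfK // transverse_frame_neq0.
Qed.

(** Since L_X nu at [p] depends on [X p] only, [X] may be replaced by a Hamiltonian field with the
    same value there, and for these [ham_scale] applies. *)
Lemma lie_reeb U X (Y : 'I_r -> vfield P) p : open U -> U p ->
  tangent_on Pi U X -> (forall i, vsmooth_on U (Y i)) ->
  lie_form X nu Y p = reeb_form p (X p) * nu p (fun i => Y i p).
Proof.
move=> oU Up tX sY; set c := chart_at p; pose W := U `&` cdom c.
have oW : open W by exact: open_setI_cdom.
have cp : cdom c p := mem_cdom_chart_at p.
have Wp : W p by [].
have Wc : W `<=` cdom c by move=> ? [].
have WU : W `<=` U by move=> ? [].
have tXp : (X p <= Pi p)%MS by have [_] := tX; exact.
have [f sf fX] := exists_ham tXp.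
have sfW : smooth_on W f by exact: smooth_on_subset sf.
have sYW i : vsmooth_on W (Y i) by exact: vsmooth_on_subset (sY i).
have tXW : tangent_on Pi W X.
  by have [sX tX'] := tX; split=> [|x /WU /tX'] //; exact: vsmooth_on_subset sX.
have [_ /(_ _ sYW) <-] := reeb_form_scale tXp sf fX oW Wp.
rewrite (lie_formE (c := c) fnu oW Wp Wc tXW.1 sYW).
rewrite (lie_formE (c := c) fnu oW Wp Wc (vsmooth_ham Pi oW sfW) sYW).
rewrite (Lcoord_tangent _ oW Wp Wc tXW).
rewrite (Lcoord_tangent _ oW Wp Wc (tangent_ham Pi oW sfW)).
by rewrite !vcoord_chart_at fX.
Qed.

(** The divergence with respect to [mu0] also scales [nu], and evaluating [nu] on the transverse
    frame identifies it with the Reeb form. *)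
Lemma lie_modular U f (Y : 'I_n -> vfield P) p : open U -> U p ->
  smooth_on U f -> (forall i, vsmooth_on U (Y i)) ->
  lie_form (ham Pi f) mu0 Y p = reeb_form p (ham Pi f p) * mu0 p (fun i => Y i p).
Proof.
move=> oU Up sf sY.
have [t [Hmu Hnu]] := ham_scale regular nu_orient oU Up sf.
have tX := tangent_ham Pi oU sf.
rewrite (Hmu _ _ oU Up sY); congr (_ * _).
set c := chart_at p; set w0 := transverse_frame p; pose W := U `&` cdom c.
have oW : open W by exact: open_setI_cdom.
have cp : cdom c p := mem_cdom_chart_at p.
have Wp : W p by [].
have WU : W `<=` U by move=> ? [].
have sw i : vsmooth_on W (cfield c (w0 i)).
  by apply: vsmooth_on_subset (vsmooth_cfield c (w0 i)) => ? [].
have := Hnu _ (fun i => cfield c (w0 i)) oW Wp sw.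
have tXW : tangent_on Pi W (ham Pi f).
  by have [sX tX'] := tX; split=> [|x /WU /tX'] //; exact: vsmooth_on_subset sX.
rewrite (lie_reeb oW Wp tXW sw) => /mulIf ->//.
rewrite (_ : (fun i => _) = w0) ?transverse_frame_neq0 //.
by apply/funext => i; rewrite /cfield frames_chart_at mulmx1.
Qed.

(** Replaces [transverse_frame], which varies arbitrarily with the point, by a tuple constant in a
    chart; this gives the smooth local formula of the Reeb form. *)
Lemma reeb_formE U c X p w : open U -> U p -> U `<=` cdom c ->
  tangent_on Pi U X ->
  reeb_form p (X p) * coform c nu p w = dnu c p (vcoord c X p) w.
Proof.
move=> oU Up Uc tX; have cp := Uc _ Up.
have sw i : vsmooth_on U (cfield c (w i)).
  exact: vsmooth_on_subset (vsmooth_cfield c (w i)).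
rewrite -(lie_reeb oU Up tX sw) (lie_formE (c := c) fnu oU Up Uc tX.1 sw).
rewrite (Lcoord_tangent _ oU Up Uc tX); congr (dnu _ _ _ _).
by apply/funext => i; rewrite vcoord_cfield.
Qed.

(* Contracting nu with a bracket of tangent fields gives 0, and the kernel of nu is
   the tangent space of the leaf. *)
Lemma tangent_lie_bracket U X Y p : open U -> U p -> tangent_on Pi U X ->
  tangent_on Pi U Y -> (lie_bracket X Y p <= Pi p)%MS.
Proof.
move=> oU Up tX tY; have [sY tYp] := tY; set c := chart_at p.
pose W := U `&` cdom c.
have oW : open W by exact: open_setI_cdom.
have cp : cdom c p := mem_cdom_chart_at p.
have Wp : W p by [].
have WU : W `<=` U by move=> ? [].
apply: (kills_kernel (regular p) (is_form_alt fnu p)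
  (@transverse_kills _ _ _ _ _ _ nu_orient p) (transverse_neq0 nu_orient p)) => w i.
(* With [Y] in slot [i], [nu] vanishes identically on these fields, so that L_X nu = h nu reduces to
   the vanishing of nu(.., [X, Y], ..). *)
pose Ys j : vfield P := if j == i then Y else cfield c (w j).
have sYs j : vsmooth_on W (Ys j).
  rewrite /Ys; case: eqP => _; first exact: vsmooth_on_subset sY.
  by apply: vsmooth_on_subset (vsmooth_cfield c (w j)) => ? [].
have tXW : tangent_on Pi W X.
  by have [sX tX'] := tX; split=> [|x /WU /tX'] //; exact: vsmooth_on_subset sX.
have kill x (u : 'I_r -> 'rV[R]_n) : U x -> u i = Y x -> nu x u = 0.
  move=> Ux ui; apply: (transverse_kills nu_orient (i := i)).
  by rewrite ui; exact: tYp.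
have := lie_reeb oW Wp tXW sYs.
rewrite [nu p _](kill p) //; last by rewrite /Ys eqxx.
rewrite mulr0 /lie_form (@vderiv_local _ _ _ W p X oW Wp _ (fun=> 0)); last first.
  by move=> x /WU Ux; rewrite (kill x) // /Ys eqxx.
rewrite vderiv_cst sub0r (bigD1 i) //= big1 ?addr0 => [|j ji]; last first.
  by rewrite (kill p) // set_slot_neq 1?eq_sym // /Ys eqxx.
move=> /eqP; rewrite oppr_eq0 => /eqP <-.
congr (nu p _); apply/funext => j; rewrite /set_slot /Ys eqxx.
case: eqP => // _; by rewrite /cfield frames_chart_at mulmx1.
Qed.

Lemma reeb_form_tangential : tangential Pi reeb_form.
Proof.
split=> [p a u v uP vP|p v|U X oU tX].
- rewrite /reeb_form uP vP addmx_sub ?scalemx_sub //.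
  by rewrite (dnu_lin _ _ _ _ (mem_cdom_chart_at p)) mulrDl mulrA.
- by rewrite /reeb_form => /negbTE ->.
apply: smooth_local => p Up; pose c := chart_at p.
have cp : cdom c p := mem_cdom_chart_at p.
have [w w0] := coform_neq0 cp (transverse_neq0 nu_orient p).
have oUc : open (U `&` cdom c) by exact: open_setI_cdom.
have Ucc : U `&` cdom c `<=` cdom c by move=> ? [].
have [W [oW Wp WUc nuW]] := smooth_neq0 oUc (conj Up cp)
  (smooth_on_subset Ucc (smooth_coform fnu c w)) w0.
have Wc : W `<=` cdom c by exact: subset_trans Ucc.
have WU : W `<=` U by move=> x /WUc [].
exists W; split=> //.
have tXW : tangent_on Pi W X.
  by have [sX tX'] := tX; split=> [|x /WU /tX'] //; exact: vsmooth_on_subset sX.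
have sF k : smooth_on W (fun x => vcoord c X x 0 k * dnu c x (e_ k) w).
  apply: smoothM => //; first by apply: vsmooth_coord => //; exact: tXW.1.
  exact: smooth_on_subset (smooth_dnu c _ w).
have sN := smooth_on_subset Wc (smooth_coform fnu c w).
have := smoothM oW (smooth_sum (index_enum _) oW sF) (smoothV oW nuW sN).
apply: smooth_ext => // x Wx; rewrite -(linear_rV (L := fun v => dnu c x v w)).
  by rewrite -(reeb_formE w oW Wx Wc tXW) mulfK // nuW.
by move=> a u v; apply: dnu_lin; exact: Wc.
Qed.

End ReebForm.

(** * Divergence of brackets in a chart *)

Section Divergence.
Variables (R : realType) (n : nat) (P : manifold R n) (Pi : poisson P).
Implicit Types (U W : set P) (f g : P -> R) (c : chart P) (p q : P).
Implicit Types (X Y Z : vfield P).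

Lemma smooth_dmat U c X k l : open U -> U `<=` cdom c -> vsmooth_on U X ->
  smooth_on U (fun q => dmat c X q k l).
Proof.
move=> oU Uc sX; have := smooth_pd k oU Uc (vsmooth_coord l oU Uc sX).
by apply: smooth_ext => // q _; rewrite [RHS]mxE.
Qed.

Lemma smooth_trace_dmat U c X : open U -> U `<=` cdom c -> vsmooth_on U X ->
  smooth_on U (fun q => \tr (dmat c X q)).
Proof. by move=> oU Uc sX; apply: smooth_sum => // k; exact: smooth_dmat. Qed.

(** The rule div [X, Y] = X div Y - Y div X for the coordinate volume. The quadratic terms are the
    traces of dX dY and of dY dX, which agree. *)
Lemma trace_dmat_lie_bracket U c X Y p : open U -> U p -> U `<=` cdom c ->
  vsmooth_on U X -> vsmooth_on U Y ->
  \tr (dmat c (lie_bracket X Y) p) =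
  vderiv X (fun q => \tr (dmat c Y q)) p - vderiv Y (fun q => \tr (dmat c X q)) p.
Proof.
move=> oU Up Uc sX sY; have cp := Uc _ Up.
have half Z Z' : vsmooth_on U Z -> vsmooth_on U Z' ->
    \sum_k pd c k (fun q => (vcoord c Z q *m dmat c Z' q) 0 k) p =
    vderiv Z (fun q => \tr (dmat c Z' q)) p + \tr (dmat c Z p *m dmat c Z' p).
  move=> sZ sZ'.
  have sd k l : smooth_on U (fun q => dmat c Z' q k l) by exact: smooth_dmat.
  have sz k : smooth_on U (fun q => vcoord c Z q 0 k) by exact: vsmooth_coord.
  rewrite /mxtrace (vderiv_sum _ oU Up) // -big_split /=; apply: eq_bigr => k _.
  have sm l : smooth_on U (fun q => vcoord c Z q 0 l * dmat c Z' q l k).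
    exact: smoothM.
  have sS : smooth_on U (fun q => (vcoord c Z q *m dmat c Z' q) 0 k).
    have := smooth_sum (index_enum _) oU sm.
    by apply: smooth_ext => // q _; rewrite [RHS]mxE.
  rewrite -(vderiv_frame k oU Up cp sS).
  rewrite (@vderiv_local _ _ _ U p (frame c k) oU Up _
    (fun q => \sum_l vcoord c Z q 0 l * dmat c Z' q l k)); last first.
    by move=> q _; rewrite mxE.
  rewrite (vderiv_sum _ oU Up) //.
  rewrite (vderiv_pd _ oU Up cp (sd k k)) [X in _ = _ + X]mxE -big_split /=.
  apply: eq_bigr => l _; rewrite (vderivM _ oU Up) //; congr (_ * _ + _).
    have sy : smooth_on U (fun q => vcoord c Z' q 0 k) by exact: vsmooth_coord.
    rewrite (vderiv_frame k oU Up cp (sd l k)).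
    have -> : pd c k (fun q => dmat c Z' q l k) p =
        pd c k (pd c l (fun q => vcoord c Z' q 0 k)) p.
      by apply: (pd_local oU Up cp) => q _; rewrite mxE.
    rewrite (pd_comm oU Up cp k l sy).
    by apply: (pd_local oU Up cp) => q _; rewrite [RHS]mxE.
  by rewrite (vderiv_frame k oU Up cp (sz l)) [dmat c Z p k l]mxE mulrC.
transitivity (\sum_k (pd c k (fun q => (vcoord c X q *m dmat c Y q) 0 k) p -
  pd c k (fun q => (vcoord c Y q *m dmat c X q) 0 k) p)); last first.
  have H1 := half _ _ sX sY; have H2 := half _ _ sY sX.
  rewrite sumrB.
  transitivity ((vderiv X (fun q => \tr (dmat c Y q)) p + \tr (dmat c X p *m dmat c Y p))
    - (vderiv Y (fun q => \tr (dmat c X q)) p + \tr (dmat c Y p *m dmat c X p))).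
    by congr (_ - _); [exact: H1 | exact: H2].
  have T := mxtrace_mulC (dmat c X p) (dmat c Y p).
  have E (a b t : R) : (a + t) - (b + t) = a - b by ring.
  by rewrite -T; exact: E.
have sM Z Z' k : vsmooth_on U Z -> vsmooth_on U Z' ->
    smooth_on U (fun q => (vcoord c Z q *m dmat c Z' q) 0 k).
  move=> sZ sZ'.
  have sm l : smooth_on U (fun q => vcoord c Z q 0 l * dmat c Z' q l k).
    by apply: smoothM => //; [exact: vsmooth_coord | exact: smooth_dmat].
  have := smooth_sum (index_enum _) oU sm.
  by apply: smooth_ext => // q _; rewrite [RHS]mxE.
apply: eq_bigr => k _; rewrite mxE.
rewrite -!(vderiv_frame k oU Up cp (sM _ _ k _ _)) //.
have -> : pd c k (fun q => vcoord c (lie_bracket X Y) q 0 k) p =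
    pd c k (fun q => (vcoord c X q *m dmat c Y q) 0 k -
                     (vcoord c Y q *m dmat c X q) 0 k) p.
  apply: (pd_local oU Up cp) => q Uq.
  by rewrite (vcoord_lie_bracket oU Uq Uc sX sY) mxE [X in _ + X]mxE.
rewrite -(vderiv_frame k oU Up cp); last by apply: smoothB => //; exact: sM.
by rewrite (vderivB _ oU Up) //; exact: sM.
Qed.

Lemma ham_lie_bracket U f g p : open U -> U p -> smooth_on U f -> smooth_on U g ->
  lie_bracket (ham Pi f) (ham Pi g) p = ham Pi (vderiv (ham Pi f) g) p.
Proof.
move=> oU Up sf sg; set c := chart_at p; pose W := U `&` cdom c.
have oW : open W by exact: open_setI_cdom.
have cp : cdom c p := mem_cdom_chart_at p.
have WU : W `<=` U by move=> ? [].
apply/rowP => k; rewrite [LHS]mxE -/c.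
rewrite -[in RHS](vcoord_chart_at (ham Pi _)) [RHS]mxE -/c.
have sx : smooth_on W (xcoord c k).
  by apply: smooth_on_subset (smooth_xcoord c k) => ? [].
rewrite -(ham_jacobi Pi oW (conj Up cp)) //; exact: smooth_on_subset WU _.
Qed.

End Divergence.

(** * Closedness of the Reeb form *)

Section ReebCocycle.
Variables (R : realType) (n r : nat) (P : manifold R n) (Pi : poisson P).
Variable nu : kform P r.
Hypothesis regular : forall p, (\rank (Pi p) + r = n)%N.
Hypothesis nu_orient : transverse_orientation Pi nu.
Implicit Types (U V W : set P) (f g : P -> R) (c : chart P) (p q : P).
Implicit Types (X Y Z : vfield P).

Local Notation e_ j := (delta_mx 0 j : 'rV[R]_n).
Let fnu : is_form nu := transverse_form nu_orient.
Local Notation mu0 := (mu0 regular nu_orient).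
Local Notation reeb := (reeb_form nu_orient).

Let h c q := coform c mu0 q (@std_basis R n).
(** Squaring allows a density of either sign; the factor 1/2 in [reeb_form_ham] compensates for
    it. *)
Let l c q := ln (h c q * h c q).

Lemma volume_density_neq0 c q : cdom c q -> h c q != 0.
Proof.
move=> cq; have [_ amu mu_neq0 _] := mu0P regular nu_orient q.
exact: coform_std_neq0.
Qed.

Lemma smooth_log_density c : smooth_on (cdom c) (l c).
Proof.
have oc := @open_cdom _ _ P c.
have sh : smooth_on (cdom c) (h c) by apply: smooth_coform; exact: is_form_mu0.
apply: smooth_ln => //; last exact: smoothM.
by move=> q cq; rewrite -expr2 exprn_even_gt0 // volume_density_neq0.
Qed.

(* As l is the logarithm of the squared density of mu0, the right-hand side is the
   divergence of the Hamiltonian field with respect to mu0. *)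
Lemma reeb_form_ham U c f p : open U -> U p -> U `<=` cdom c -> smooth_on U f ->
  reeb p (ham Pi f p) = \tr (dmat c (ham Pi f) p) + 2^-1 * vderiv (ham Pi f) (l c) p.
Proof.
move=> oU Up Uc sf; have cp := Uc _ Up; set X := ham Pi f.
have sX : vsmooth_on U X by exact: vsmooth_ham.
pose Y i := cfield c (@std_basis R n i).
have sY i : vsmooth_on U (Y i) by exact: vsmooth_on_subset (vsmooth_cfield c _).
have fmu := is_form_mu0 regular nu_orient.
have h0 := volume_density_neq0 cp.
have sh : smooth_on U (h c) by exact: smooth_on_subset (smooth_coform fmu c _).
have := lie_modular regular nu_orient oU Up sf sY.
rewrite (lie_formE (c := c) fmu oU Up Uc sX sY).
have -> : (fun i => vcoord c (Y i) p) = @std_basis R n.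
  by apply/funext => i; rewrite vcoord_cfield.
rewrite -[mu0 p _]/(h c p) /Lcoord -[vderiv X _ p]/(vderiv X (h c) p).
have [mo ao] := coform_alt fmu c p.
(* In slot [i] only the i-th basis vector survives, any other one being repeated; the diagonal
   entries of [dmat] remain. *)
rewrite [X in _ + X = _](_ : _ = \tr (dmat c X p) * h c p); last first.
  rewrite mulr_suml; apply: eq_bigr => i _.
  rewrite [_ *m _]row_sum_delta (multilin_sum mo) (bigD1 i) //= big1 ?addr0.
    rewrite /std_basis -rowE mxE; congr (_ * coform c mu0 p _).
    exact: (set_slot_id (@std_basis R n) i).
  move=> j ji; rewrite (ao _ i j) ?mulr0 // 1?eq_sym //.
  by rewrite set_slot_eq set_slot_neq.
have -> : vderiv X (l c) p = 2 * ((h c p)^-1 * vderiv X (h c) p).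
  rewrite (vderiv_ln _ oU Up).
  - rewrite (vderivM _ oU Up) //.
    have E (a x : R) : a != 0 -> (a * a)^-1 * (a * x + a * x) = 2 * (a^-1 * x).
      by move=> a0; field.
    exact: E.
  - by rewrite -expr2 exprn_even_gt0.
  - exact: smoothM.
move=> E; apply: (mulIf h0); rewrite -E mulrDl mulKf ?pnatr_eq0 // addrC.
by congr (_ + _); rewrite mulrAC mulVf // mul1r.
Qed.

(** The bracket is again Hamiltonian, so [reeb_form_ham] applies to all three terms; the trace parts
    cancel by [trace_dmat_lie_bracket], the logarithmic parts by [ham_jacobi]. *)
Lemma dF_ham U c f g p : open U -> U p -> U `<=` cdom c -> smooth_on U f ->
  smooth_on U g -> dF reeb (ham Pi f) (ham Pi g) p = 0.
Proof.
move=> oU Up Uc sf sg; set X := ham Pi f; set Y := ham Pi g.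
have sX : vsmooth_on U X by exact: vsmooth_ham.
have sY : vsmooth_on U Y by exact: vsmooth_ham.
have sl : smooth_on U (l c) by exact: smooth_on_subset (smooth_log_density c).
have sF : smooth_on U (vderiv X g) by exact: smooth_vderiv.
have der Z e : smooth_on U e -> vderiv Z (fun q => reeb q (ham Pi e q)) p =
    vderiv Z (fun q => \tr (dmat c (ham Pi e) q)) p +
    2^-1 * vderiv Z (vderiv (ham Pi e) (l c)) p.
  move=> se; have sXe : vsmooth_on U (ham Pi e) by exact: vsmooth_ham.
  have st := smooth_trace_dmat oU Uc sXe.
  have sd : smooth_on U (vderiv (ham Pi e) (l c)) by exact: smooth_vderiv.
  rewrite -(vderivZ _ oU Up _ sd) -(vderivD _ oU Up st); last first.
    by apply: smoothM => //; exact: smooth_cst.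
  apply: (vderiv_local _ oU Up) => q Uq.
  exact: reeb_form_ham oU Uq Uc se.
have arith (a b s t1 t2 t3 d1 d2 d3 k : R) : a = t1 + k * d1 -> b = t2 + k * d2 ->
    s = t3 + k * d3 -> d1 - d2 = d3 -> t3 = t1 - t2 -> a - b - s = 0.
  by move=> -> -> -> <- ->; ring.
have tr : \tr (dmat c (ham Pi (vderiv X g)) p) = \tr (dmat c (lie_bracket X Y) p).
  apply: eq_bigr => k _; rewrite [LHS]mxE [RHS]mxE.
  apply: (pd_local oU Up (Uc _ Up)) => q Uq.
  by rewrite !vcoordE (ham_lie_bracket Pi oU Uq sf sg).
rewrite /dF (ham_lie_bracket Pi oU Up sf sg).
exact: (arith _ _ _ _ _ _ _ _ _ _ (der X g sg) (der Y f sf)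
  (reeb_form_ham oU Up Uc sF) (ham_jacobi Pi oU Up sf sg sl)
  (etrans tr (trace_dmat_lie_bracket oU Up Uc sX sY))).
Qed.

Lemma tangent_on_subset U W X : W `<=` U -> tangent_on Pi U X -> tangent_on Pi W X.
Proof.
by move=> WU [sX tX]; split=> [|x /WU /tX] //; exact: vsmooth_on_subset sX.
Qed.

(* On tangent fields the Reeb form is given near p by an honest smooth 1-form,
   so that d_F of it is tensorial. *)
Lemma reeb_form_local U p : open U -> U p -> exists W (a : 'I_n -> P -> R),
  [/\ open W, W p, W `<=` U `&` cdom (chart_at p), forall k, smooth_on W (a k) &
   forall V X q, open V -> V `<=` W -> V q -> tangent_on Pi V X ->
     reeb q (X q) = \sum_k a k q * vcoord (chart_at p) X q 0 k].
Proof.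
move=> oU Up; set c := chart_at p.
have cp : cdom c p := mem_cdom_chart_at p.
have [w w0] := coform_neq0 cp (transverse_neq0 nu_orient p).
have oUc : open (U `&` cdom c) by exact: open_setI_cdom.
have Ucc : U `&` cdom c `<=` cdom c by move=> ? [].
have [W [oW Wp WUc nuW]] := smooth_neq0 oUc (conj Up cp)
  (smooth_on_subset Ucc (smooth_coform fnu c w)) w0.
have Wc : W `<=` cdom c by exact: subset_trans Ucc.
exists W, (fun k q => dnu nu c q (e_ k) w * (coform c nu q w)^-1); split=> //.
  move=> k; apply: smoothM => //; first exact: smooth_on_subset (smooth_dnu nu_orient c _ w).
  apply: smoothV => //; exact: smooth_on_subset (smooth_coform fnu c w).
move=> V X q oV VW Vq tX; have Wq := VW _ Vq.
have := reeb_formE regular nu_orient w oV Vq (subset_trans VW Wc) tX.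
rewrite (linear_rV (L := fun v => dnu nu c q v w)); last first.
  by move=> a u v; apply: (dnu_lin nu_orient); exact: Wc.
move=> /(canRL (mulfK (nuW _ Wq))) ->; rewrite mulr_suml.
by apply: eq_bigr => k _; rewrite [RHS]mulrC mulrA.
Qed.

Lemma reeb_form_cocycle : reeb \in leafwise_cocycle Pi.
Proof.
apply/asboolP; split; first exact: (reeb_form_tangential regular nu_orient).
move=> U X Y oU tX tY p Up; set c := chart_at p.
have [W [a [oW Wp WUc sa aE]]] := reeb_form_local oU Up.
have Wc : W `<=` cdom c by move=> x /WUc [].
have WU : W `<=` U by move=> x /WUc [].
(* Tensoriality: the derivatives of the components of the two fields cancel against the bracket,
   leaving their values at [p]. *)
have expand Z Z' : tangent_on Pi W Z -> tangent_on Pi W Z' ->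
    dF reeb Z Z' p = \sum_k (vderiv Z (a k) p * Z' p 0 k - vderiv Z' (a k) p * Z p 0 k).
  move=> tZ tZ'.
  have half S S' : tangent_on Pi W S' -> vderiv S (fun q => reeb q (S' q)) p =
      \sum_k a k p * vderiv S (fun q => vcoord c S' q 0 k) p +
      \sum_k vderiv S (a k) p * S' p 0 k.
    move=> tS; have ss k : smooth_on W (fun q => vcoord c S' q 0 k).
      by apply: vsmooth_coord => //; exact: tS.1.
    rewrite (@vderiv_local _ _ _ W p S oW Wp _
      (fun q => \sum_k a k q * vcoord c S' q 0 k)); last first.
      by move=> q Wq; exact: (aE W).
    rewrite (vderiv_sum _ oW Wp) => [|k]; last exact: smoothM.
    rewrite -big_split /=; apply: eq_bigr => k _.
    by rewrite (vderivM _ oW Wp) // vcoord_chart_at [X in _ + X]mulrC.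
  have br : reeb p (lie_bracket Z Z' p) = \sum_k a k p *
      (vderiv Z (fun q => vcoord c Z' q 0 k) p - vderiv Z' (fun q => vcoord c Z q 0 k) p).
    have tB := tangent_lie_bracket regular nu_orient oW Wp tZ tZ'.
    (* The local formula [aE] is about fields tangent on an open set, while the bracket is only
       taken at [p]; a Hamiltonian field with the same value stands in for it. *)
    have [f sf fB] := exists_ham tB.
    have tf : tangent_on Pi W (ham Pi f).
      by apply: tangent_ham => //; exact: smooth_on_subset sf.
    rewrite -fB (aE W) // vcoord_chart_at fB; apply: eq_bigr => k _.
    congr (_ * _); rewrite mxE; congr (_ - _).
      by apply: (vderiv_local _ oW Wp) => q _; rewrite mxE.
    by apply: (vderiv_local _ oW Wp) => q _; rewrite mxE.
  have arith (a1 a2 b1 b2 s : R) : s = a1 - b1 -> a1 + a2 - (b1 + b2) - s = a2 - b2.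
    by move=> ->; ring.
  rewrite /dF (half _ _ tZ') (half _ _ tZ) sumrB; apply: arith.
  by rewrite br -sumrB; apply: eq_bigr => k _; rewrite mulrBr.
(* By [expand], both fields can be exchanged for Hamiltonian fields with the same values at [p], the
   case of [dF_ham]. *)
have ex Z : tangent_on Pi U Z -> exists2 f, smooth_on W f & ham Pi f p = Z p.
  move=> [_ /(_ _ Up)] tZ; have [f sf fZ] := exists_ham tZ.
  by exists f => //; exact: smooth_on_subset sf.
have [f sf fX] := ex _ tX; have [g sg gY] := ex _ tY.
rewrite -(dF_ham oW Wp Wc sf sg) !expand.
- by apply: eq_bigr => k _; rewrite fX gY !(vderiv_at _ fX) !(vderiv_at _ gY).
- exact: tangent_ham.
- exact: tangent_ham.
- exact: tangent_on_subset tX.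
- exact: tangent_on_subset tY.
Qed.

End ReebCocycle.

(** * Cohomology classes *)

Lemma subquot_classP (R : nzRingType) (V : lmodType R) (Z B : submodClosed V)
    (u v : submod Z) :
  (subquot_class B u = subquot_class B v) <-> (val u - val v \in B).
Proof.
rewrite /subquot_class lquot_classP -[_ \in submodI B]/(val (u - v) \in B).
by rewrite GRing.valB.
Qed.

Lemma subquot_class_lin (R : nzRingType) (V : lmodType R) (Z B : submodClosed V)
    (r : R) (u v : submod Z) :
  subquot_class B (r *: u + v) = r *: subquot_class B u + subquot_class B v.
Proof. by rewrite /subquot_class lquot_classD lquot_classZ. Qed.

Lemma subquot_reprK (R : nzRingType) (V : lmodType R) (Z B : submodClosed V)
    (x : subquot Z B) : subquot_class B (lquot_repr x) = x.
Proof. exact: lquot_reprK. Qed.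

(** * The map induced on first cohomology *)

Section SharpCohomology.
Variables (R : realType) (n : nat) (P : manifold R n) (Pi : poisson P).
Implicit Types (U V W : set P) (f g : P -> R) (c : chart P) (p q : P).
Implicit Types (X Y Z : vfield P) (a b : tcovfield P).

(** As [delta_mx 0 k *m Pi p] is pi(dx_k), the components are the values of beta -> a(pi(beta)) on
    the dual basis. *)
Definition tsharp (a : tcovfield P) : vfield P :=
  fun p => \row_k a p (delta_mx 0 k *m Pi p).

Lemma tsharpP a : tangential Pi a -> is_tsharp Pi a (tsharp a).
Proof.
move=> [la _ _] p b; rewrite /pairing mxE -[sharp_at Pi p b]/(b^T *m Pi p).
rewrite (linear_rV (L := fun v => a p (v *m Pi p))) => [|r u v].
  by apply: eq_bigr => k _; rewrite !mxE mulrC.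
by rewrite mulmxDl -scalemxAl la ?submxMl.
Qed.

Lemma tsharp_lin (r : R) a b : tsharp (r *: a + b) = r *: tsharp a + tsharp b.
Proof. by apply/funext => p; apply/rowP => k; rewrite !mxE. Qed.

(** A component in a chart is the value of [a] on the Hamiltonian field of a coordinate function, a
    smooth tangent field. *)
Lemma vsmooth_tsharp a : tangential Pi a -> vsmooth_on setT (tsharp a).
Proof.
move=> ta i k; have [_ _ sa] := ta.
have oT : open (setT `&` @cdom _ _ P i) by exact: open_setI_cdom openT.
have sx : smooth_on (setT `&` @cdom _ _ P i) (xcoord i k).
  by apply: smooth_on_subset (smooth_xcoord i k) => ? [].
have := sa _ _ oT (tangent_ham Pi oT sx).
by apply: smooth_ext => // p _; rewrite /vderiv (tsharpP ta).
Qed.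

Lemma tsharp_cocycle a : a \in leafwise_cocycle Pi ->
  tsharp a \in poisson_cocycle Pi.
Proof.
move=> /asboolP[ta za]; apply/asboolP; split; first exact: vsmooth_tsharp.
move=> U al be oU sal sbe p Up.
have := za U _ _ oU (tangent_sharp Pi oU sal) (tangent_sharp Pi oU sbe) p Up.
have E (e : covfield P) :
    (fun q => pairing (tsharp a q) (e q)) = (fun q => a q (sharp Pi e q)).
  by apply/funext => q; rewrite (tsharpP ta).
by rewrite /dF /dpi !E (tsharpP ta) -(sharp_cobracket Pi oU Up sal sbe).
Qed.

Lemma tsharp_coboundary a : tangential Pi a ->
  (tsharp a \in poisson_coboundary Pi) = (a \in leafwise_coboundary Pi).
Proof.
move=> ta; apply/asboolP/asboolP => [[_ [f sf Hf]]|[_ [f sf Hf]]].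
  split=> //; exists f => // p v /submxP[x ->].
  have -> : x *m Pi p = sharp_at Pi p x^T by rewrite /sharp_at trmxK.
  by rewrite -Hf (tsharpP ta).
split; first exact: vsmooth_tsharp.
by exists f => // p b; rewrite (tsharpP ta) Hf // submxMl.
Qed.

Lemma leafwise_cocycle_tangential a : a \in leafwise_cocycle Pi -> tangential Pi a.
Proof. by move=> /asboolP[]. Qed.

Definition sharp_Z1 (z : leafwise_Z1 Pi) : poisson_Z1 Pi :=
  exist _ (tsharp (val z)) (tsharp_cocycle (valP z)).

Lemma sharp_Z1_lin (r : R) u v :
  sharp_Z1 (r *: u + v) = r *: sharp_Z1 u + sharp_Z1 v.
Proof. by apply: val_inj; rewrite /= tsharp_lin. Qed.

Definition sharp_H1 (x : leafwise_H1 Pi) : poisson_H1 Pi :=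
  poisson_class (sharp_Z1 (lquot_repr x)).

Lemma leafwise_classP (u v : leafwise_Z1 Pi) :
  (leafwise_class u = leafwise_class v) <->
  (val u - val v \in leafwise_coboundary Pi).
Proof. exact: subquot_classP. Qed.

Lemma poisson_classP (u v : poisson_Z1 Pi) :
  (poisson_class u = poisson_class v) <->
  (val u - val v \in poisson_coboundary Pi).
Proof. exact: subquot_classP. Qed.

(** Read from right to left this makes [sharp_H1] independent of the chosen representative; from
    left to right it is injectivity. *)
Lemma sharp_Z1_class (u v : leafwise_Z1 Pi) :
  (poisson_class (sharp_Z1 u) = poisson_class (sharp_Z1 v)) <->
  (leafwise_class u = leafwise_class v).
Proof.
rewrite poisson_classP leafwise_classP.
have -> : val (sharp_Z1 u) - val (sharp_Z1 v) = tsharp (val (u - v)).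
  have := tsharp_lin (-1) (val v) (val u); rewrite !scaleN1r => /= E.
  by rewrite addrC -E addrC.
rewrite tsharp_coboundary //; exact: leafwise_cocycle_tangential (valP (u - v)).
Qed.

Lemma sharp_H1_class z : sharp_H1 (leafwise_class z) = poisson_class (sharp_Z1 z).
Proof. by apply/sharp_Z1_class; exact: subquot_reprK. Qed.

Lemma sharp_H1_linear : linear sharp_H1.
Proof.
move=> r x y; rewrite -(subquot_reprK x) -(subquot_reprK y).
rewrite -subquot_class_lin.
rewrite -![subquot_class (leafwise_coboundary Pi) _]/(leafwise_class _).
rewrite !sharp_H1_class sharp_Z1_lin.
exact: subquot_class_lin.
Qed.

HB.instance Definition _ := GRing.isLinear.Build R (leafwise_H1 Pi) (poisson_H1 Pi)
  _ sharp_H1 sharp_H1_linear.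

Lemma sharp_H1_inj : injective sharp_H1.
Proof.
move=> x y /sharp_Z1_class.
by rewrite -{2}(subquot_reprK x) -{2}(subquot_reprK y).
Qed.

End SharpCohomology.

(** * The modular class *)

Section ModularClass.
Variables (R : realType) (n r : nat) (P : manifold R n) (Pi : poisson P).
Variable nu : kform P r.
Hypothesis regular : forall p, (\rank (Pi p) + r = n)%N.
Hypothesis nu_orient : transverse_orientation Pi nu.
Implicit Types (U V W : set P) (f g : P -> R) (c : chart P) (p q : P).
Implicit Types (X Y Z : vfield P).

Local Notation mu0 := (mu0 regular nu_orient).
Local Notation reeb := (reeb_form nu_orient).

Definition leafwise_d (f : P -> R) : tcovfield P := fun p v =>
  if (v <= Pi p)%MS then pairing v (dfun f p) else 0.

Lemma leafwise_dE f U X p : tangent_on Pi U X -> U p ->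
  leafwise_d f p (X p) = vderiv X f p.
Proof. by move=> [_ tX] Up; rewrite /leafwise_d tX. Qed.

Lemma leafwise_d_tangential f : smooth_on setT f -> tangential Pi (leafwise_d f).
Proof.
move=> sf; split=> [p a u v uP vP|p v|U X oU tX].
- by rewrite /leafwise_d uP vP addmx_sub ?scalemx_sub // pairing_lin.
- by rewrite /leafwise_d => /negbTE ->.
have := smooth_vderiv oU tX.1 (smooth_on_subset (@subsetT _ U) sf).
by apply: smooth_ext => // q Uq; rewrite (leafwise_dE f tX Uq).
Qed.

Lemma leafwise_d_coboundary f : smooth_on setT f ->
  leafwise_d f \in leafwise_coboundary Pi.
Proof.
move=> sf; apply/asboolP; split; first exact: leafwise_d_tangential.
by exists f => // p v vP; rewrite /leafwise_d vP.
Qed.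

Lemma leafwise_d_cocycle f : smooth_on setT f ->
  leafwise_d f \in leafwise_cocycle Pi.
Proof.
move=> sf; apply/asboolP; split; first exact: leafwise_d_tangential.
move=> U X Y oU tX tY p Up.
have sfU : smooth_on U f by exact: smooth_on_subset sf.
have tB := tangent_lie_bracket regular nu_orient oU Up tX tY.
have E Z Z' : tangent_on Pi U Z' ->
    vderiv Z (fun q => leafwise_d f q (Z' q)) p = vderiv Z (vderiv Z' f) p.
  by move=> tZ'; apply: (vderiv_local _ oU Up) => q Uq; exact: leafwise_dE tZ' Uq.
have B : leafwise_d f p (lie_bracket X Y p) =
    vderiv X (vderiv Y f) p - vderiv Y (vderiv X f) p.
  rewrite -(vderiv_lie_bracket oU Up tX.1 tY.1 sfU).
  by rewrite /leafwise_d tB.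
have arith (a b s : R) : s = a - b -> a - b - s = 0 by move=> ->; rewrite subrr.
by rewrite /dF (E X Y tY) (E Y X tX); exact: arith.
Qed.

(** The ratio of two top-degree forms does not depend on the basis, so the jumps of [chart_at p] do
    not spoil its smoothness. *)
Definition density (mu : kform P n) p : R :=
  mu p (@std_basis R n) / mu0 p (@std_basis R n).

Lemma mu0_std_neq0 p : mu0 p (@std_basis R n) != 0.
Proof.
have [_ amu [w w0] _] := mu0P regular nu_orient p.
by apply: contraNneq w0 => m0; rewrite (altform_det w amu) m0 mulr0.
Qed.

Lemma densityE mu p w : volume_form mu -> mu p w = density mu p * mu0 p w.
Proof.
move=> [fmu _]; have [_ amu _ _] := mu0P regular nu_orient p.
rewrite (altform_det w amu) (altform_det w (is_form_alt fmu p)) /density.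
by rewrite mulrCA divfK // mu0_std_neq0.
Qed.

Lemma density_neq0 mu p : volume_form mu -> density mu p != 0.
Proof.
move=> vmu; have [_ /(_ p)[w]] := vmu; apply: contraNneq => d0.
by rewrite (densityE p _ vmu) d0 mul0r.
Qed.

Lemma smooth_density mu : volume_form mu -> smooth_on setT (density mu).
Proof.
move=> vmu; apply: smooth_local => p _; set c := chart_at p.
have oc := @open_cdom _ _ P c; have cp : cdom c p := mem_cdom_chart_at p.
exists (cdom c); split=> //.
have fmu0 := is_form_mu0 regular nu_orient.
have h0 := volume_density_neq0 regular nu_orient.
have s1 := smooth_coform vmu.1 c (@std_basis R n).
have s2 := smoothV oc (h0 c) (smooth_coform fmu0 c (@std_basis R n)).
have := smoothM oc s1 s2.
apply: smooth_ext => // q cq.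
have -> : coform c mu q (@std_basis R n) =
    density mu q * coform c mu0 q (@std_basis R n).
  exact: (densityE q _ vmu).
exact: (mulfK (h0 c q cq)).
Qed.

(** This is log |g| for the ratio g of [mu] to [mu0]; passing through g^2 keeps it smooth for either
    sign of g. *)
Definition log_density (mu : kform P n) p : R :=
  2^-1 * ln (density mu p * density mu p).

Lemma smooth_log_density_ratio mu : volume_form mu -> smooth_on setT (log_density mu).
Proof.
move=> vmu; have sd := smooth_density vmu; have oT : open [set: P] := openT.
apply: smoothM => //; first exact: smooth_cst.
apply: smooth_ln => //; last exact: smoothM.
by move=> p _; rewrite -expr2 exprn_even_gt0 // density_neq0.
Qed.

Lemma vderiv_log_density mu X p : volume_form mu ->
  vderiv X (log_density mu) p * density mu p = vderiv X (density mu) p.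
Proof.
move=> vmu; have sd := smooth_density vmu; have oT : open [set: P] := openT.
have d0 := density_neq0 p vmu.
have sl : smooth_on setT (fun q => ln (density mu q * density mu q)).
  apply: smooth_ln => //; last exact: smoothM.
  by move=> q _; rewrite -expr2 exprn_even_gt0 // density_neq0.
rewrite (vderivZ X oT I _ sl) (vderiv_ln X oT I); last exact: smoothM.
  rewrite (vderivM X oT I sd sd).
  have E (a x : R) : a != 0 -> 2^-1 * ((a * a)^-1 * (a * x + a * x)) * a = x.
    by move=> a0; field.
  exact: E.
by rewrite -expr2 exprn_even_gt0.
Qed.

(** Leibniz rule for mu = g mu0, with X g = g X(log |g|). *)
Lemma lie_volume mu U f (Y : 'I_n -> vfield P) p : volume_form mu ->
  open U -> U p -> smooth_on U f -> (forall i, vsmooth_on U (Y i)) ->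
  lie_form (ham Pi f) mu Y p =
  (reeb p (ham Pi f p) + vderiv (ham Pi f) (log_density mu) p) *
  mu p (fun i => Y i p).
Proof.
move=> vmu oU Up sf sY; set X := ham Pi f.
have sd : smooth_on U (density mu) by exact: smooth_on_subset (smooth_density vmu).
have sm := smooth_form (is_form_mu0 regular nu_orient) oU sY.
have := lie_modular regular nu_orient oU Up sf sY; rewrite -/X /lie_form => E.
have -> : vderiv X (fun q => mu q (fun i => Y i q)) p =
    density mu p * vderiv X (fun q => mu0 q (fun i => Y i q)) p +
    mu0 p (fun i => Y i p) * vderiv X (density mu) p.
  rewrite -(vderivM _ oU Up) //; apply: (vderiv_local _ oU Up) => q _.
  exact: (densityE q _ vmu).
under eq_bigr => i _ do rewrite (densityE p _ vmu).
rewrite -mulr_sumr (densityE p _ vmu) -(vderiv_log_density _ _ vmu).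
have arith (d x s m a l : R) : x - s = a * m ->
    d * x + m * (l * d) - d * s = (a + l) * (d * m).
  by move=> /eqP; rewrite subr_eq => /eqP ->; ring.
exact: arith.
Qed.

Definition reeb_Z1 : leafwise_Z1 Pi :=
  exist _ reeb (reeb_form_cocycle regular nu_orient).

Definition log_density_Z1 mu (vmu : volume_form mu) : leafwise_Z1 Pi :=
  exist _ (leafwise_d (log_density mu))
    (leafwise_d_cocycle (smooth_log_density_ratio vmu)).

Lemma reeb_class : is_reeb_class nu (leafwise_class reeb_Z1).
Proof.
exists reeb_Z1 => // U X oU tX V Y oV VU sY p Vp.
apply: (lie_reeb regular nu_orient oV Vp _ sY).
exact: tangent_on_subset tX.
Qed.

Lemma volume_form_mu0 : volume_form mu0.
Proof.
split=> [|p]; first exact: is_form_mu0.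
by exists (@std_basis R n); exact: mu0_std_neq0.
Qed.

Lemma modular_class : is_modular_class (poisson_class (sharp_Z1 reeb_Z1)).
Proof.
split=> [|mu vmu]; first by exists mu0; exact: volume_form_mu0.
(* The exact term d_F log |g| turns the modular field of [mu0] into that of [mu] without changing
   the class. *)
exists (sharp_Z1 (reeb_Z1 + log_density_Z1 vmu)).
  apply/sharp_Z1_class/esym/leafwise_classP.
  rewrite GRing.valD addrC addKr.
  exact: leafwise_d_coboundary (smooth_log_density_ratio vmu).
move=> U f oU sf V Y oV VU sY p Vp.
have sfV : smooth_on V f by exact: smooth_on_subset sf.
have tX := tangent_ham Pi oV sfV.
rewrite (lie_volume vmu oV Vp sfV sY); congr (_ * _).
have tz := leafwise_cocycle_tangential (valP (reeb_Z1 + log_density_Z1 vmu)).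
set z := reeb_Z1 + _ in tz *.
have -> : vderiv (val (sharp_Z1 z)) f p = val z p (ham Pi f p).
  exact: (tsharpP tz p (dfun f p)).
rewrite /z GRing.valD; congr (_ + _).
by rewrite -(leafwise_dE _ tX Vp).
Qed.

End ModularClass.

Theorem theorem4p1 (R : realType) (n q : nat) (P : manifold R n)
    (Pi : poisson P) (nu : kform P q)
    (regular : forall p, (\rank (Pi p) + q = n)%N)
    (nu_orient : transverse_orientation Pi nu) :
  exists pistar : {linear leafwise_H1 Pi -> poisson_H1 Pi},
    [/\ (forall a : leafwise_Z1 Pi, exists2 X : poisson_Z1 Pi,
          is_tsharp Pi (val a) (val X)
          & pistar (leafwise_class a) = poisson_class X),
        injective pistar
      & exists modF modP,
          [/\ is_reeb_class nu modF, is_modular_class modP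
            & pistar modF = modP]].
Proof.
exists (@sharp_H1 R n P Pi); split; last 2 first.
- exact: sharp_H1_inj.
- exists (leafwise_class (reeb_Z1 regular nu_orient)).
  exists (poisson_class (sharp_Z1 (reeb_Z1 regular nu_orient))); split.
  + exact: reeb_class.
  + exact: modular_class.
  + exact: sharp_H1_class.
move=> a; exists (sharp_Z1 a); last exact: sharp_H1_class.
exact: tsharpP (leafwise_cocycle_tangential (valP a)).
Qed.
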